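(* Let $\mu$ be a probability measure on $\mathbb R$ with compact support, and let $(x_{N,n})_{N\ge1,1\le n\le N}\subset\mathbb R$ satisfy $x_{N,n-1}\ge x_{N,n}$ for $2\le n\le N$ and be such that the normalized empirical measures $$\mu_{N,0}:=\frac1N\bigl(\delta_{x_{N,1}/\sqrt N}+\dots+\delta_{x_{N,N}/\sqrt N}\bigr)$$ tend weakly to $\mu$ for $N\to\infty$. For each $N$ let $(\phi_{N,1}(t),\dots,\phi_{N,N}(t))_{t\ge0}$ be the solution of $$\frac{d}{dt}x_i(t)=\sum_{j\ne i}\frac{1}{x_i(t)-x_j(t)}\qquad(i=1,\dots,N)$$ with $\phi_{N,n}(0)=x_{N,n}$ for $n=1,\dots,N$, and put $$\mu_{N,t}:=\frac1N\bigl(\delta_{\phi_{N,1}(t)/\sqrt N}+\dots+\delta_{\phi_{N,N}(t)/\sqrt N}\bigr)\qquad(t\ge0).$$ Then for each $t\in[0,\infty[$ the measures $\mu_{N,t}$ tend weakly to $\mu_{sc,2\sqrt t}\boxplus\mu$ for $N\to\infty$.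
   Context: $C_N^A:=\{x\in\mathbb R^N: x_1\ge x_2\ge\dots\ge x_N\}$. For every starting point $x_0\in C_N^A$ (including boundary points) the ODE has a unique solution in the following sense: a continuous map $[0,\infty[\to C_N^A$, $t\mapsto x(t)$, with $x(0)=x_0$, such that for $t>0$ the point $x(t)$ lies in the interior of $C_N^A$ and the ODE holds. $\mu_{sc,R}$ is the semicircle law with density $\frac{2}{\pi R^2}\sqrt{R^2-x^2}$ on $[-R,R]$ for $R>0$, and $\mu_{sc,0}=\delta_0$. $\boxplus$ denotes the free additive convolution of probability measures on $\mathbb R$. *)

(* Defs.v *)
From HB Require Import structures.
From mathcomp Require Import all_boot all_order all_algebra.
From mathcomp Require Import all_classical all_reals all_analysis.
From mathcomp Require Import measurable_realfun.
From mathcomp Require Import complex ring.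

Set Implicit Arguments.
Unset Strict Implicit.
Unset Printing Implicit Defensive.

Import Order.TTheory GRing.Theory Num.Theory.
Import numFieldNormedType.Exports.

Local Open Scope classical_set_scope.
Local Open Scope complex_scope.
Local Open Scope ring_scope.

Section weak_convergence.
Context {R : realType}.

Definition weakly_converges (m_ : nat -> {measure set R -> \bar R})
    (m : {measure set R -> \bar R}) : Prop :=
  forall f : R -> R, continuous f -> (exists M, forall x, `|f x| <= M) ->
    (\int[m_ n]_x f x) @[n --> \oo] --> \int[m]_x f x.

Definition compactly_supported (m : {measure set R -> \bar R}) : Prop :=
  exists2 K : set R, compact K & m (~` K) = 0%E.

End weak_convergence.

Section empirical_measure.
Context {R : realType} (N : nat) (y : 'I_N -> R).

(* For N = 0 this is the zero measure. *)
Definition empirical (A : set R) : \bar R :=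
  ((N%:R^-1)%:E * \sum_(i < N) \d_(y i) A)%E.

Let y_ (k : nat) : R := if insub k is Some i then y i else 0.

Let empiricalE :
  empirical = mscale (N%:R^-1)%:nng (msum (fun k => \d_(y_ k)) N).
Proof.
apply/funext => A; rewrite /mscale /msum /empirical /=; congr (_ * _)%E.
by apply: eq_bigr => i _; rewrite /y_ valK.
Qed.

Let empirical0 : empirical set0 = 0%E.
Proof. by rewrite empiricalE measure0. Qed.

Let empirical_ge0 A : (0 <= empirical A)%E.
Proof. by rewrite empiricalE. Qed.

Let empirical_sigma_additive : semi_sigma_additive empirical.
Proof. by rewrite empiricalE; exact: measure_semi_sigma_additive. Qed.

HB.instance Definition _ := isMeasure.Build _ _ _
  empirical empirical0 empirical_ge0 empirical_sigma_additive.

End empirical_measure.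

Section semicircle_density.
Context {R : realType}.
Notation mu := (@lebesgue_measure R).

(* [Num.sqrt] is 0 on negative numbers, hence the density vanishes outside
   [-r, r]. *)
Definition semicircle_pdf (r x : R) : R :=
  2 / (pi * r ^+ 2) * Num.sqrt (r ^+ 2 - x ^+ 2).

Lemma semicircle_pdf_ge0 r x : 0 <= semicircle_pdf r x.
Proof.
by rewrite mulr_ge0 ?sqrtr_ge0// divr_ge0// mulr_ge0 ?pi_ge0 ?sqr_ge0.
Qed.

Lemma continuous_semicircle_pdf r : continuous (semicircle_pdf r).
Proof.
move=> x; apply: cvgM; first exact: cvg_cst.
apply: (cvg_comp _ Num.sqrt); last exact: sqrt_continuous.
apply: cvgB; first exact: cvg_cst.
exact: exprn_continuous.
Qed.

Lemma measurable_semicircle_pdf r : measurable_fun setT (semicircle_pdf r).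
Proof. by apply: continuous_measurable_fun; exact: continuous_semicircle_pdf. Qed.

Lemma integral_semicircle_pdf (r : R) : 0 < r ->
  (\int[mu]_x (semicircle_pdf r x)%:E = 1)%E.
Proof.
move=> r0.
have pi_neq0 : @pi R != 0 by rewrite gt_eqF// pi_gt0.
have r20 : 0 < r ^+ 2 by rewrite exprn_gt0.
pose p : R := pi / 2.
have p0 : - p < p by rewrite gtrN// divr_gt0// pi_gt0.
have -> : (\int[mu]_x (semicircle_pdf r x)%:E =
           \int[mu]_(x in `[(- r)%R, r]) (semicircle_pdf r x)%:E)%E.
  rewrite [RHS]integral_mkcond; apply: eq_integral => x _.
  rewrite patchE; case: ifPn => //; rewrite notin_setE/= in_itv/= => xr.
  rewrite /semicircle_pdf ler0_sqrtr ?mulr0// subr_le0.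
  rewrite -(ger0_norm (ltW r0)) -[x ^+ 2]real_normK ?num_real// lerXn2r ?nnegrE//.
  by rewrite ger0_norm ?(ltW r0)// leNgt; apply/negP => /ltW; rewrite ler_norml.
pose F (u : R) := r * sin u.
have dF (u : R) : is_derive u (1 : R) F (r * cos u).
  by rewrite /F; apply: is_deriveZ.
have F'E : F^`()%classic = fun u => r * cos u.
  by apply/funext => u; rewrite derive1E; exact: derive_val.
have cF : continuous F.
  by move=> u; apply: cvgM; [exact: cvg_cst|exact: continuous_sin].
have cF' : continuous (fun u : R => r * cos u).
  by move=> u; apply: cvgM; [exact: cvg_cst|exact: continuous_cos].
have FNp : F (- p) = - r by rewrite /F sinN sin_pihalf mulrN1.
have Fp : F p = r by rewrite /F sin_pihalf mulr1.
have := @integration_by_substitution_increasing R F (semicircle_pdf r) (- p) p.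
rewrite FNp Fp F'E => ->; last first.
- exact/continuous_subspaceT/continuous_semicircle_pdf.
- split=> [u _||]; first exact: ex_derive.
  + exact/cvg_at_right_filter/cF.
  + exact/cvg_at_left_filter/cF.
- exact/cvgP/cvg_at_left_filter/cF'.
- exact/cvgP/cvg_at_right_filter/cF'.
- by move=> u _; exact: cF'.
- by move=> u v up vp uv; rewrite ltr_pM2l// ltr_sin.
- exact: ltW.
pose H (u : R) := (u + sin u * cos u) / pi.
have dH (u : R) : is_derive u (1 : R) H (2 / pi * cos u ^+ 2).
  rewrite /H; apply: is_derive_eq.
  rewrite !scaler0 add0r /GRing.scale/= mulrN -!expr2 sin2cos2.
  by move: (cos u) => c; move: pi_neq0; generalize (@pi R) => q q0; field.
have cH : continuous H.
  by move=> u; apply/differentiable_continuous/derivable1_diffP/ex_derive.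
transitivity (\int[mu]_(u in `[(- p)%R, p]) (2 / pi * cos u ^+ 2)%:E)%E.
  apply: eq_integral => u; rewrite inE/= in_itv/= => up; congr EFin.
  rewrite /semicircle_pdf /F /= !fctE exprMn.
  have -> : r ^+ 2 - r ^+ 2 * sin u ^+ 2 = r ^+ 2 * cos u ^+ 2.
    by rewrite cos2sin2 mulrBr mulr1.
  rewrite sqrtrM ?sqr_ge0// !sqrtr_sqr gtr0_norm//.
  rewrite ger0_norm; last exact: cos_ge0_pihalf.
  move: (cos u) pi_neq0 (lt0r_neq0 r0) => c; generalize (@pi R) => q q0 rn0.
  by field; rewrite q0.
rewrite (@continuous_FTC2 _ _ H)//.
- rewrite /H -EFinB; congr EFin; rewrite cosN !cos_pihalf !mulr0 !addr0 /p.
  by move: pi_neq0; generalize (@pi R) => q q0; field.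
- apply: continuous_subspaceT => u; apply: cvgM; first exact: cvg_cst.
  apply: (cvg_comp _ (fun v => v ^+ 2)); first exact: continuous_cos.
  exact: exprn_continuous.
- split=> [u _||]; first exact: ex_derive.
  + exact/cvg_at_right_filter/cH.
  + exact/cvg_at_left_filter/cH.
- by move=> u _; rewrite derive1E; exact: derive_val.
Qed.

Definition semicircle (r : R) (A : set R) : \bar R :=
  if 0 < r then (\int[mu]_(x in A) (semicircle_pdf r x)%:E)%E else \d_(0 : R) A.

End semicircle_density.

Section semicircle_probability.
Context {R : realType} (r : R).
Notation semicircle := (semicircle r).

Let semicircle0 : semicircle set0 = 0%E.
Proof.
by rewrite /semicircle; case: ifP => _; rewrite ?integral_set0 ?measure0.
Qed.

Let semicircle_ge0 A : (0 <= semicircle A)%E.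
Proof.
rewrite /semicircle; case: ifP => // _; apply: integral_ge0 => x _.
by rewrite lee_fin semicircle_pdf_ge0.
Qed.

Let semicircle_sigma_additive : semi_sigma_additive semicircle.
Proof.
have [r0|r0] := boolP (0 < r); last first.
  rewrite (_ : semicircle = \d_(0 : R)); first exact: measure_semi_sigma_additive.
  by apply/funext => A; rewrite /semicircle (negbTE r0).
rewrite /semicircle r0 => /= F mF tF mUF; apply: cvg_toP.
  apply: ereal_nondecreasing_is_cvgn => m n mn.
  apply: lee_sum_nneg_natr => // k _ _.
  by apply: integral_ge0 => /= x _; rewrite lee_fin semicircle_pdf_ge0.
rewrite ge0_integral_bigcup//=.
- apply: measurable_funTS; apply: measurableT_comp => //.
  exact: measurable_semicircle_pdf.
- by move=> x _; rewrite lee_fin semicircle_pdf_ge0.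
Qed.

HB.instance Definition _ := isMeasure.Build _ _ _ semicircle
  semicircle0 semicircle_ge0 semicircle_sigma_additive.

Let semicircle_setT : semicircle [set: _] = 1%E.
Proof.
rewrite /semicircle; case: ifPn => [r0|_]; last exact: diracT.
exact: integral_semicircle_pdf.
Qed.

HB.instance Definition _ := @Measure_isProbability.Build _ _ R
  semicircle semicircle_setT.

End semicircle_probability.

Section free_additive_convolution.
Context {R : realType}.
Implicit Types (m : probability R R) (z : R[i]).

Definition cauchy_transform m z : R[i] :=
  (\int[m]_x complex.Re (z - x%:C)^-1) +i* (\int[m]_x complex.Im (z - x%:C)^-1).

(* [F] in Bercovici and Voiculescu (1993); it maps the upper half-plane to
   itself. *)
Definition reciprocal_cauchy m z : R[i] := (cauchy_transform m z)^-1.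

(* The truncated cone $\Gamma_{\alpha,\beta}$. *)
Definition truncated_cone (a b : R) : set R[i] :=
  [set z | b < complex.Im z /\ `|complex.Re z| < a * complex.Im z].

(* [phi] is the Voiculescu transform $\phi(z) = F^{-1}(z) - z$ on the truncated
   cone. As [F] need not be injective on the whole upper half-plane, the last
   conjunct selects the branch $F^{-1}(z) = z (1 + o(1))$. *)
Definition is_voiculescu_transform m (a b : R) (phi : R[i] -> R[i]) : Prop :=
  [/\ forall z, truncated_cone a b z -> 0 < complex.Im (z + phi z),
      forall z, truncated_cone a b z -> reciprocal_cauchy m (z + phi z) = z
    & forall e : R, 0 < e -> exists M : R, forall z, truncated_cone a b z ->
        M%:C <= `|z| -> `|phi z| <= e%:C * `|z| ].

Definition is_free_add_conv m1 m2 m : Prop :=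
  forall a : R, 0 < a -> exists b : R, exists phi1 phi2 : R[i] -> R[i],
    [/\ 0 < b, is_voiculescu_transform m1 a b phi1,
        is_voiculescu_transform m2 a b phi2
      & is_voiculescu_transform m a b (phi1 \+ phi2)].

(* By Bercovici and Voiculescu, for any two probability measures there is exactly
   one [m] satisfying [is_free_add_conv]; [get] picks it. *)
Definition free_add_conv m1 m2 : probability R R :=
  get [set m | is_free_add_conv m1 m2 m].

End free_additive_convolution.

Definition weyl_chamberA {R : realType} (N : nat) : set 'rV[R]_N :=
  [set x | forall i j : 'I_N, (i <= j)%N -> x 0 j <= x 0 i].
Arguments weyl_chamberA {R} N _.

(* The values of [x] at negative times are irrelevant. *)
Definition is_frozen_solution {R : realType} (N : nat) (x0 : 'rV[R]_N)
    (x : R -> 'rV[R]_N) : Prop :=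
  [/\ {within `[0, +oo[, continuous x},
      forall t : R, 0 <= t -> weyl_chamberA N (x t),
      x 0 = x0,
      forall t : R, 0 < t -> (weyl_chamberA N)° (x t)
    & forall t : R, 0 < t -> forall i : 'I_N,
        is_derive t (1 : R) (fun s => x s 0 i)
          (\sum_(j < N | j != i) (x t 0 i - x t 0 j)^-1) ].

(* Main.v *)
(* Let G_N(s, .) be the Cauchy transform of mu_{N,s} and G that of mu. As
   1/(z - a) 1/(z - b) = (1/(z - a) - 1/(z - b)) / (a - b), the flow makes G_N an
   approximate solution of the Burgers equation, d_s G_N + G_N d_z G_N = O(1/N), so
   along the straight characteristics s |-> z + s G(z) Gronwall's inequality gives
   G_N(t, z + t G(z)) -> G(z) whenever t < (Im z)^2. In particular the mu_{N,t} are
   tight. Along an ultrafilter their quantile functions converge, so they have a weak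
   limit m, and m satisfies G_m(z + t G(z)) = G(z). This equation determines m, and it
   says that the Voiculescu transform of m is that of mu plus t/z, the latter being the
   Voiculescu transform of the semicircle law of radius 2 sqrt t. *)
From HB Require Import structures.
Require Import Defs.
From mathcomp Require Import all_boot all_order all_algebra.
From mathcomp Require Import all_classical all_reals all_analysis.
From mathcomp Require Import measurable_realfun.
From mathcomp Require Import complex ring lra.

Set Implicit Arguments.
Unset Strict Implicit.
Unset Printing Implicit Defensive.

Import Order.TTheory GRing.Theory Num.Theory.
Import numFieldNormedType.Exports.

Local Open Scope classical_set_scope.
Local Open Scope complex_scope.
Local Open Scope ring_scope.

(** * Integrals of bounded complex functions *)

Section complex_modulus.
Context {R : realType}.
Implicit Types (z w : R[i]) (x : R).

(** Two obstacles shape the proof. The measure returned by [get] is known only through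
    [is_free_add_conv], whose transforms are bare functions with no analyticity. So some measure
    with that property has to be exhibited before the property can be used, and the transforms have
    to be recovered from their equations: where |w| is large against the radius of the support, F
    differs from the identity by a bounded contraction, hence is injective, and the growth condition
    fixes the branch. Compact support enters here and in the tightness estimate. The other obstacle
    is that dominated convergence fails along an ultrafilter, so pointwise convergence of the
    quantile functions does not by itself carry over to integrals. Monotonicity helps: Riemann sums
    of bounded monotone functions have a uniform error, and a Riemann sum involves finitely many
    points. The equation for G_m is exploited only on a curve at bounded distance from the imaginary
    axis. That it determines m rests on linear combinations and bounded limits: divided differences
    along the curve yield all powers of one resolvent, and a Taylor series then yields every
    resolvent. *)

Definition cmod z : R := Normc.normc z.

(** The norm [|z|] is itself an element of [R[i]], while [cmod] is real. This is the bridge to the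
    growth condition of [is_voiculescu_transform], which is stated with the complex norm. *)
Lemma normcE_cmod z : `|z| = (cmod z)%:C.
Proof. by case: z. Qed.

Lemma cmodM z w : cmod (z * w) = cmod z * cmod w.
Proof. exact: Normc.normcM. Qed.

Lemma cmodV z : cmod z^-1 = (cmod z)^-1.
Proof. exact: Normc.normcV. Qed.

Lemma cmodD z w : cmod (z + w) <= cmod z + cmod w.
Proof. exact: le_normcD. Qed.

Lemma cmodN z : cmod (- z) = cmod z.
Proof. exact: normcN. Qed.

Lemma cmodB z w : cmod (z - w) <= cmod z + cmod w.
Proof. by rewrite -(cmodN w) cmodD. Qed.

Lemma cmod_distC z w : cmod (z - w) = cmod (w - z).
Proof. by rewrite -cmodN opprB. Qed.

Lemma cmod_tri z w : cmod z - cmod w <= cmod (z - w).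
Proof. by rewrite lerBlDr -{1}(subrK w z) cmodD. Qed.

Lemma cmod_ge0 z : 0 <= cmod z.
Proof. by case: z => a b; exact: sqrtr_ge0. Qed.

Lemma cmod0 : cmod 0 = 0.
Proof. exact: Normc.normc0. Qed.

Lemma cmod1 : cmod 1 = 1.
Proof. exact: Normc.normc1. Qed.

Lemma cmod_eq0 z : (cmod z == 0) = (z == 0).
Proof.
apply/eqP/eqP => [|->]; [exact: Normc.eq0_normc|exact: cmod0].
Qed.

Lemma cmod_gt0 z : (0 < cmod z) = (z != 0).
Proof. by rewrite lt_neqAle cmod_ge0 andbT eq_sym cmod_eq0. Qed.

Lemma cmodX z n : cmod (z ^+ n) = cmod z ^+ n.
Proof. by elim: n => [|n ih]; rewrite ?expr0 ?cmod1// !exprS cmodM ih. Qed.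

Lemma cmod_real x : cmod x%:C = `|x|.
Proof. by rewrite /cmod/= expr0n/= addr0 sqrtr_sqr. Qed.

Lemma sqr_cmod z : cmod z ^+ 2 = complex.Re z ^+ 2 + complex.Im z ^+ 2.
Proof. by case: z => a b; rewrite sqr_sqrtr// addr_ge0// sqr_ge0. Qed.

Lemma Re_le_cmod z : `|complex.Re z| <= cmod z.
Proof. by case: z => a b /=; rewrite -sqrtr_sqr ler_wsqrtr// lerDl sqr_ge0. Qed.

Lemma Im_le_cmod z : `|complex.Im z| <= cmod z.
Proof. by case: z => a b /=; rewrite -sqrtr_sqr ler_wsqrtr// lerDr sqr_ge0. Qed.

Lemma cmod_le_ReIm z : cmod z <= `|complex.Re z| + `|complex.Im z|.
Proof.
rewrite -(ler_pXn2r (ltn0Sn 1)) ?nnegrE ?cmod_ge0 ?addr_ge0//.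
rewrite sqr_cmod sqrrD !real_normK ?num_real//.
by rewrite -addrA lerD2l lerDr mulrn_wge0// mulr_ge0.
Qed.

Lemma cmod_sum (I : Type) (r : seq I) (P : pred I) (F : I -> R[i]) :
  cmod (\sum_(i <- r | P i) F i) <= \sum_(i <- r | P i) cmod (F i).
Proof.
elim/big_rec2: _ => [|i x z _ h]; first by rewrite cmod0.
by rewrite (le_trans (cmodD _ _))// lerD2l.
Qed.

Lemma cReD z w : complex.Re (z + w) = complex.Re z + complex.Re w.
Proof. by case: z w => [a b] [c d]. Qed.
Lemma cImD z w : complex.Im (z + w) = complex.Im z + complex.Im w.
Proof. by case: z w => [a b] [c d]. Qed.
Lemma cReN z : complex.Re (- z) = - complex.Re z.
Proof. by case: z. Qed.
Lemma cImN z : complex.Im (- z) = - complex.Im z.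
Proof. by case: z. Qed.
Lemma cReM z w : complex.Re (z * w) =
  complex.Re z * complex.Re w - complex.Im z * complex.Im w.
Proof. by case: z w => [a b] [c d]. Qed.
Lemma cImM z w : complex.Im (z * w) =
  complex.Re z * complex.Im w + complex.Im z * complex.Re w.
Proof. by case: z w => [a b] [c d]. Qed.
Lemma cReV z : complex.Re z^-1 = complex.Re z / cmod z ^+ 2.
Proof. by rewrite sqr_cmod; case: z => a b. Qed.
Lemma cImV z : complex.Im z^-1 = - (complex.Im z / cmod z ^+ 2).
Proof. by rewrite sqr_cmod; case: z => a b. Qed.
Lemma cRe_sum (I : Type) (r : seq I) (P : pred I) (F : I -> R[i]) :
  complex.Re (\sum_(i <- r | P i) F i) = \sum_(i <- r | P i) complex.Re (F i).
Proof. by elim/big_rec2: _ => [//|i x z _ h]; rewrite cReD h. Qed.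
Lemma cIm_sum (I : Type) (r : seq I) (P : pred I) (F : I -> R[i]) :
  complex.Im (\sum_(i <- r | P i) F i) = \sum_(i <- r | P i) complex.Im (F i).
Proof. by elim/big_rec2: _ => [//|i x z _ h]; rewrite cImD h. Qed.

Lemma cReZ x z : complex.Re (x%:C * z) = x * complex.Re z.
Proof. by rewrite cReM/= mul0r subr0. Qed.

Lemma cImZ x z : complex.Im (x%:C * z) = x * complex.Im z.
Proof. by rewrite cImM/= mul0r addr0. Qed.

Lemma complex_ext z w :
  complex.Re z = complex.Re w -> complex.Im z = complex.Im w -> z = w.
Proof. by case: z w => [a b] [c d] /= -> ->. Qed.

Lemma Im_neq0 z : complex.Im z != 0 -> z != 0.
Proof. by apply: contraNneq => ->. Qed.

Lemma cmod_sub_real_ge z x : `|complex.Im z| <= cmod (z - x%:C).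
Proof. by apply: le_trans (Im_le_cmod _); case: z => a b /=; rewrite subr0. Qed.

Lemma sub_real_neq0 z x : complex.Im z != 0 -> z - x%:C != 0.
Proof. by move=> z0; apply: Im_neq0; case: z z0 => a b /=; rewrite subr0. Qed.

Lemma cmod_resolvent_le z x : complex.Im z != 0 ->
  cmod (z - x%:C)^-1 <= `|complex.Im z|^-1.
Proof.
move=> z0; rewrite cmodV lef_pV2 ?posrE ?normr_gt0// ?cmod_sub_real_ge//.
by rewrite cmod_gt0 sub_real_neq0.
Qed.

End complex_modulus.

Section bounded_measurable.
Context {R : realType}.
Implicit Types (f : R -> R) (g : R -> R[i]).

(** One class of test functions for all measures at once: it is stable under sums and products, and
    each member is integrable for every probability measure. *)
Definition bdm f := measurable_fun setT f /\ exists M, forall x, `|f x| <= M.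

Lemma bdm_cst a : bdm (fun=> a).
Proof. by split=> //; exists `|a|. Qed.

Lemma bdmD f1 f2 : bdm f1 -> bdm f2 -> bdm (fun x => f1 x + f2 x).
Proof.
move=> [m1 [M1 b1]] [m2 [M2 b2]]; split; first exact: measurable_funD.
by exists (M1 + M2) => x; rewrite (le_trans (ler_normD _ _))// lerD.
Qed.

Lemma bdmM f1 f2 : bdm f1 -> bdm f2 -> bdm (fun x => f1 x * f2 x).
Proof.
move=> [m1 [M1 b1]] [m2 [M2 b2]]; split; first exact: measurable_funM.
by exists (M1 * M2) => x; rewrite normrM ler_pM.
Qed.

Lemma bdmN f : bdm f -> bdm (fun x => - f x).
Proof.
move=> bf; have := bdmM (bdm_cst (-1)) bf.
by under eq_fun do rewrite mulN1r.
Qed.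

Lemma bdmB f1 f2 : bdm f1 -> bdm f2 -> bdm (fun x => f1 x - f2 x).
Proof. by move=> b1 b2; apply: bdmD => //; exact: bdmN. Qed.

Lemma bdm_continuous f M : continuous f -> (forall x, `|f x| <= M) -> bdm f.
Proof. by move=> cf fM; split; [exact: continuous_measurable_fun|exists M]. Qed.

Lemma bdm_comp f (h : R -> R) : measurable_fun setT h -> bdm f ->
  bdm (fun x => f (h x)).
Proof.
move=> mh [mf [M fM]]; split; first exact: measurableT_comp.
by exists M => x; exact: fM.
Qed.

Section integral.
Variable m : probability R R.

Lemma bdm_integrable f : bdm f -> m.-integrable setT (EFin \o f).
Proof.
move=> [mf [M fM]]; apply: measurable_bounded_integrable => //=.
  by rewrite probability_setT ltry.
exists M; split; first exact: num_real.
by move=> y My x _; exact: le_trans (fM x) (ltW My).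
Qed.

Lemma bdm_integral_cst a : \int[m]_x a = a.
Proof.
rewrite Rintegral_cst// -[RHS]mulr1; congr (_ * _).
exact: (congr1 fine (probability_setT m)).
Qed.

Lemma bdm_integralD f1 f2 : bdm f1 -> bdm f2 ->
  \int[m]_x (f1 x + f2 x) = \int[m]_x f1 x + \int[m]_x f2 x.
Proof. by move=> b1 b2; rewrite RintegralD//; exact: bdm_integrable. Qed.

Lemma bdm_integralB f1 f2 : bdm f1 -> bdm f2 ->
  \int[m]_x (f1 x - f2 x) = \int[m]_x f1 x - \int[m]_x f2 x.
Proof. by move=> b1 b2; rewrite RintegralB//; exact: bdm_integrable. Qed.

Lemma bdm_integralZ a f : bdm f -> \int[m]_x (a * f x) = a * \int[m]_x f x.
Proof. by move=> b; rewrite RintegralZl//; exact: bdm_integrable. Qed.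

Lemma bdm_integral_le f1 f2 : bdm f1 -> bdm f2 -> (forall x, f1 x <= f2 x) ->
  \int[m]_x f1 x <= \int[m]_x f2 x.
Proof. by move=> b1 b2 h; apply: le_Rintegral => //; exact: bdm_integrable. Qed.

Lemma bdm_integral_norm_le f M : bdm f -> (forall x, `|f x| <= M) ->
  `|\int[m]_x f x| <= M.
Proof.
move=> bf fM; rewrite ler_norml; apply/andP; split.
  rewrite -(bdm_integral_cst (- M)); apply: bdm_integral_le => // [|x].
    exact: bdm_cst.
  by have := fM x; rewrite ler_norml => /andP[].
rewrite -[leRHS]bdm_integral_cst; apply: bdm_integral_le => // [|x].
  exact: bdm_cst.
by have := fM x; rewrite ler_norml => /andP[].
Qed.

Lemma bdm_dominated (f_ : nat -> R -> R) f M : (forall n, bdm (f_ n)) -> bdm f ->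
  (forall n x, `|f_ n x| <= M) ->
  (forall x, f_ n x @[n --> \oo] --> f x) ->
  \int[m]_x f_ n x @[n --> \oo] --> \int[m]_x f x.
Proof.
move=> bf_ bf f_M f_f.
have [] := @dominated_convergence _ _ _ m setT measurableT
  (fun n => EFin \o f_ n) (EFin \o f) (EFin \o (fun=> M)).
- by move=> n; apply/measurable_EFinP; have [] := bf_ n.
- by apply/measurable_EFinP; have [] := bf.
- by apply: aeW => x _; apply: cvg_EFin; [exact: nearW|exact: f_f].
- exact: bdm_integrable (bdm_cst M).
- by apply: aeW => x n _ /=; rewrite lee_fin.
- move=> _ _ /= h; apply: fine_cvg.
  rewrite /Rintegral fineK; first exact: h.
  exact: integrable_fin_num (bdm_integrable bf).
Qed.

End integral.

Definition cbdm g := bdm (fun x => complex.Re (g x)) /\ bdm (fun x => complex.Im (g x)).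

Lemma cbdm_cst a : cbdm (fun=> a).
Proof. by split; exact: bdm_cst. Qed.

Lemma cbdmD g1 g2 : cbdm g1 -> cbdm g2 -> cbdm (fun x => g1 x + g2 x).
Proof.
move=> [r1 i1] [r2 i2]; split; [under eq_fun do rewrite cReD|under eq_fun do rewrite cImD];
  exact: bdmD.
Qed.

Lemma cbdmM g1 g2 : cbdm g1 -> cbdm g2 -> cbdm (fun x => g1 x * g2 x).
Proof.
move=> [r1 i1] [r2 i2]; split; [under eq_fun do rewrite cReM|under eq_fun do rewrite cImM].
  by apply: bdmB; exact: bdmM.
by apply: bdmD; exact: bdmM.
Qed.

Lemma cbdmN g : cbdm g -> cbdm (fun x => - g x).
Proof.
by move=> [r i]; split; [under eq_fun do rewrite cReN|under eq_fun do rewrite cImN];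
  exact: bdmN.
Qed.

Lemma cbdmB g1 g2 : cbdm g1 -> cbdm g2 -> cbdm (fun x => g1 x - g2 x).
Proof. by move=> b1 b2; apply: cbdmD => //; exact: cbdmN. Qed.

Lemma cbdmX g n : cbdm g -> cbdm (fun x => g x ^+ n).
Proof.
move=> bg; elim: n => [|n ih]; first exact: cbdm_cst.
by under eq_fun do rewrite exprS; exact: cbdmM.
Qed.

Lemma cbdm_real f : bdm f -> cbdm (fun x => (f x)%:C).
Proof. by move=> bf; split => //=; exact: bdm_cst. Qed.

Lemma cbdm_comp g (h : R -> R) : measurable_fun setT h -> cbdm g ->
  cbdm (fun x => g (h x)).
Proof. by move=> mh [bR bI]; split; [exact: (bdm_comp mh bR)|exact: (bdm_comp mh bI)]. Qed.

Lemma continuous_Re_resolvent (z : R[i]) : complex.Im z != 0 ->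
  continuous (fun x : R => complex.Re (z - x%:C)^-1).
Proof.
case: z => a b; rewrite [complex.Im _]/= => b0; under eq_fun do rewrite cReV sqr_cmod /= subr0.
move=> x; apply: cvgM; first by apply: cvgB; [exact: cvg_cst|exact: cvg_id].
apply: cvgV.
  by rewrite paddr_eq0 ?sqr_ge0// negb_and !expf_eq0/= b0 orbT.
apply: cvgD; last exact: cvg_cst.
apply: (cvg_comp (fun x : R => a - x) (fun v => v ^+ 2)).
  by apply: cvgB; [exact: cvg_cst|exact: cvg_id].
exact: exprn_continuous.
Qed.

Lemma continuous_Im_resolvent (z : R[i]) : complex.Im z != 0 ->
  continuous (fun x : R => complex.Im (z - x%:C)^-1).
Proof.
case: z => a b; rewrite [complex.Im _]/= => b0; under eq_fun do rewrite cImV sqr_cmod /= subr0.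
move=> x; apply: cvgN; apply: cvgM; first exact: cvg_cst.
apply: cvgV.
  by rewrite paddr_eq0 ?sqr_ge0// negb_and !expf_eq0/= b0 orbT.
apply: cvgD; last exact: cvg_cst.
apply: (cvg_comp (fun x : R => a - x) (fun v => v ^+ 2)).
  by apply: cvgB; [exact: cvg_cst|exact: cvg_id].
exact: exprn_continuous.
Qed.

Lemma cbdm_resolvent (z : R[i]) : complex.Im z != 0 ->
  cbdm (fun x : R => (z - x%:C)^-1).
Proof.
move=> z0; split.
  apply: (@bdm_continuous _ `|complex.Im z|^-1 (continuous_Re_resolvent z0)) => x.
  by rewrite (le_trans (Re_le_cmod _))// cmod_resolvent_le.
apply: (@bdm_continuous _ `|complex.Im z|^-1 (continuous_Im_resolvent z0)) => x.
by rewrite (le_trans (Im_le_cmod _))// cmod_resolvent_le.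
Qed.

End bounded_measurable.

Section complex_integral.
Context {R : realType}.
Variable m : probability R R.
Implicit Types (g : R -> R[i]).

Definition cint g : R[i] :=
  (\int[m]_x complex.Re (g x)) +i* (\int[m]_x complex.Im (g x)).

Lemma cint_cst a : cint (fun=> a) = a.
Proof. by apply: complex_ext; rewrite /= bdm_integral_cst. Qed.

Lemma eq_cint g1 g2 : g1 =1 g2 -> cint g1 = cint g2.
Proof. by move=> /funext ->. Qed.

Lemma cintD g1 g2 : cbdm g1 -> cbdm g2 ->
  cint (fun x => g1 x + g2 x) = cint g1 + cint g2.
Proof.
move=> [r1 i1] [r2 i2]; apply: complex_ext; rewrite ?cReD ?cImD /=.
  by under eq_Rintegral do rewrite cReD; exact: bdm_integralD.
by under eq_Rintegral do rewrite cImD; exact: bdm_integralD.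
Qed.

Lemma cintZ a g : cbdm g -> cint (fun x => a * g x) = a * cint g.
Proof.
move=> [r i]; apply: complex_ext; rewrite ?cReM ?cImM /=.
  under eq_Rintegral do rewrite cReM.
  rewrite bdm_integralB ?bdm_integralZ//; apply: bdmM => //; exact: bdm_cst.
under eq_Rintegral do rewrite cImM.
rewrite bdm_integralD ?bdm_integralZ//; apply: bdmM => //; exact: bdm_cst.
Qed.

Lemma cintB g1 g2 : cbdm g1 -> cbdm g2 ->
  cint (fun x => g1 x - g2 x) = cint g1 - cint g2.
Proof.
move=> b1 b2; under eq_cint do rewrite -mulN1r.
by rewrite cintD// ?cintZ ?mulN1r//; apply: cbdmM => //; exact: cbdm_cst.
Qed.

(** The factor 2 comes from estimating the real and the imaginary part separately. Most estimates
    below can afford it; [Im_cauchy_transform_le] avoids it. *)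
Lemma cmod_cint_le g M : cbdm g -> (forall x, cmod (g x) <= M) ->
  cmod (cint g) <= 2 * M.
Proof.
move=> [r i] gM; rewrite (le_trans (cmod_le_ReIm _))// mulr_natl mulr2n lerD//=.
  by apply: bdm_integral_norm_le => // x; rewrite (le_trans (Re_le_cmod _)).
by apply: bdm_integral_norm_le => // x; rewrite (le_trans (Im_le_cmod _)).
Qed.

Lemma cauchy_transformE z : cauchy_transform m z = cint (fun x => (z - x%:C)^-1).
Proof. by []. Qed.

End complex_integral.

(** * A probability measure is determined by its resolvent integrals *)

Section uniqueness.
Context {R : realType}.
Variables m m' : probability R R.
Implicit Types (f : R -> R) (g : R -> R[i]).

(** The class is closed under linear combinations and bounded pointwise limits, but nothing makes it
    closed under products; powers of a resolvent therefore need the argument of [cagree_pow]. *)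
Definition agree f := bdm f /\ \int[m]_x f x = \int[m']_x f x.

Lemma agree_cst a : agree (fun=> a).
Proof. by split; [exact: bdm_cst|rewrite !bdm_integral_cst]. Qed.

Lemma agreeD f1 f2 : agree f1 -> agree f2 -> agree (fun x => f1 x + f2 x).
Proof.
by move=> [b1 e1] [b2 e2]; split; [exact: bdmD|rewrite !bdm_integralD// e1 e2].
Qed.

Lemma agreeZ a f : agree f -> agree (fun x => a * f x).
Proof.
move=> [b e]; split; first by apply: bdmM => //; exact: bdm_cst.
by rewrite !bdm_integralZ// e.
Qed.

Lemma agree_lim (f_ : nat -> R -> R) f M : (forall n, agree (f_ n)) ->
  (forall n x, `|f_ n x| <= M) -> (forall x, f_ n x @[n --> \oo] --> f x) ->
  agree f.
Proof.
move=> af f_M f_f.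
have bf : bdm f.
  split; first by apply: (@measurable_fun_cvg _ _ _ _ f_) => [n|x _];
    [have [[]] := af n|exact: f_f].
  exists M => x; have /cvgrPdist_le fx := f_f x.
  apply/ler_addgt0Pr => e e0.
  have [n _ /(_ n (leqnn _)) h] := fx e e0.
  by rewrite -(subrK (f_ n x) (f x)) addrC (le_trans (ler_normD _ _))// lerD.
split=> //.
have h1 := @bdm_dominated _ m f_ f M (fun n => (af n).1) bf f_M f_f.
have h2 := @bdm_dominated _ m' f_ f M (fun n => (af n).1) bf f_M f_f.
apply: (cvg_unique _ h1) => //.
by rewrite (_ : (fun n => _) = fun n => \int[m']_x f_ n x)//;
  apply/funext => n; exact: (af n).2.
Qed.

Definition cagree g := agree (fun x => complex.Re (g x)) /\ agree (fun x => complex.Im (g x)).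

Lemma cagreeD g1 g2 : cagree g1 -> cagree g2 -> cagree (fun x => g1 x + g2 x).
Proof.
by move=> [r1 i1] [r2 i2]; split; [under eq_fun do rewrite cReD|
  under eq_fun do rewrite cImD]; exact: agreeD.
Qed.

Lemma cagreeZ a g : cagree g -> cagree (fun x => a * g x).
Proof.
move=> [r i]; split; [under eq_fun do rewrite cReM|under eq_fun do rewrite cImM].
  by under eq_fun do rewrite -mulNr; apply: agreeD; exact: agreeZ.
by apply: agreeD; exact: agreeZ.
Qed.

Lemma cagree_cst a : cagree (fun=> a).
Proof. by split; exact: agree_cst. Qed.

Lemma cagree_sum (I : Type) (r : seq I) (F : I -> R -> R[i]) :
  (forall i, cagree (F i)) -> cagree (fun x => \sum_(i <- r) F i x).
Proof.
move=> h; elim: r => [|i r ih].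
  by under eq_fun do rewrite big_nil; exact: cagree_cst.
by under eq_fun do rewrite big_cons; exact: cagreeD.
Qed.

Lemma cagree_lim (g_ : nat -> R -> R[i]) g M : (forall n, cagree (g_ n)) ->
  (forall n x, cmod (g_ n x) <= M) ->
  (forall x, cmod (g_ n x - g x) @[n --> \oo] --> (0 : R)) -> cagree g.
Proof.
move=> ag g_M g_g; split.
- apply: (@agree_lim (fun n x => complex.Re (g_ n x)) _ M).
  + by move=> n; have [] := ag n.
  + by move=> n x; rewrite (le_trans (Re_le_cmod _)).
  + move=> x; apply/cvgrPdist_le => e e0; have /cvgrPdist_le := g_g x.
    move=> /(_ e e0); apply: filterS => n.
    rewrite sub0r normrN ger0_norm ?cmod_ge0// => h.
    by rewrite (le_trans _ h)// distrC -cReN -cReD Re_le_cmod.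
- apply: (@agree_lim (fun n x => complex.Im (g_ n x)) _ M).
  + by move=> n; have [] := ag n.
  + by move=> n x; rewrite (le_trans (Im_le_cmod _)).
  + move=> x; apply/cvgrPdist_le => e e0; have /cvgrPdist_le := g_g x.
    move=> /(_ e e0); apply: filterS => n.
    rewrite sub0r normrN ger0_norm ?cmod_ge0// => h.
    by rewrite (le_trans _ h)// distrC -cImN -cImD Im_le_cmod.
Qed.

(** Geometric expansion with exact remainder. It serves twice: solved for the remainder it gives
    divided differences, and for k tending to infinity it gives the Taylor series. *)
Lemma inv_taylor (w w0 v : R[i]) k : w - v != 0 -> w0 - v != 0 ->
  (w - v)^-1 = \sum_(j < k) (w0 - w) ^+ j * (w0 - v)^-1 ^+ j.+1
    + (w0 - w) ^+ k * ((w0 - v)^-1 ^+ k * (w - v)^-1).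
Proof.
move=> wv w0v; elim: k => [|k ih]; first by rewrite big_ord0 add0r !expr0 !mul1r.
rewrite {1}ih big_ord_recr/= -addrA; congr (_ + _).
rewrite !exprSr; move: ((w0 - w) ^+ k) ((w0 - v)^-1 ^+ k) => A B.
by field; rewrite w0v wv.
Qed.

(** Divided differences in place of derivatives. By [inv_taylor], [(w0 - v)^-1 ^+ k * (w n - v)^-1]
    is a linear combination of the resolvent at [w n] and of the powers up to k at [w0], which agree
    by induction; as [w n] tends to [w0] it tends boundedly to the power k + 1. The function [v] is
    kept general: it is used for [x] and for [- (x - c) ^+ 2]. *)
Lemma cagree_pow (v : R -> R[i]) (w : nat -> R[i]) (w0 : R[i]) (d : R) : 0 < d ->
  (forall n, w n != w0) -> cmod (w n - w0) @[n --> \oo] --> (0 : R) ->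
  (forall n x, d <= cmod (w n - v x)) -> (forall x, d <= cmod (w0 - v x)) ->
  (forall n, cagree (fun x => (w n - v x)^-1)) ->
  forall k, cagree (fun x => (w0 - v x)^-1 ^+ k.+1).
Proof.
move=> d0 ww0 w_w0 dw dw0 aw k; elim/ltn_ind: k => k ih.
have wv n x : w n - v x != 0 by rewrite -cmod_gt0 (lt_le_trans d0).
have w0v x : w0 - v x != 0 by rewrite -cmod_gt0 (lt_le_trans d0).
have le_d z : d <= cmod z -> cmod z^-1 <= d^-1.
  by move=> dz; rewrite cmodV lef_pV2// posrE (lt_le_trans d0).
apply: (@cagree_lim (fun n x => (w0 - v x)^-1 ^+ k * (w n - v x)^-1) _ (d^-1 ^+ k.+1)).
- move=> n.
  have e : (fun x => (w0 - v x)^-1 ^+ k * (w n - v x)^-1) =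
    (fun x => (w0 - w n) ^- k * ((w n - v x)^-1 +
       (-1) * \sum_(j < k) (w0 - w n) ^+ j * (w0 - v x)^-1 ^+ j.+1)).
    apply/funext => x; apply: (@mulfI _ ((w0 - w n) ^+ k)).
      by rewrite expf_neq0// subr_eq0 eq_sym.
    rewrite mulVKf ?expf_neq0 ?subr_eq0 1?eq_sym//; apply/eqP.
    rewrite mulN1r eq_sym subr_eq [X in _ == X]addrC; apply/eqP.
    exact: inv_taylor.
  rewrite e; apply/cagreeZ/cagreeD/cagreeZ/cagree_sum => // j.
  exact/cagreeZ/ih.
- move=> n x; rewrite cmodM cmodX exprSr ler_pM ?cmod_ge0 ?exprn_ge0 ?cmod_ge0//.
    by apply: lerXn2r; rewrite ?nnegrE ?cmod_ge0 ?invr_ge0 ?(ltW d0)// le_d.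
  exact: le_d.
- move=> x; apply/cvgrPdist_le => e e0.
  have /cvgrPdist_le /(_ (e * d ^+ k.+2)) := w_w0.
  move=> /(_ (mulr_gt0 e0 (exprn_gt0 _ d0))); apply: filterS => n.
  rewrite !sub0r !normrN !ger0_norm ?cmod_ge0// => h.
  have -> : (w0 - v x)^-1 ^+ k * (w n - v x)^-1 - (w0 - v x)^-1 ^+ k.+1 =
    (w0 - v x)^-1 ^+ k.+1 * ((w n - v x)^-1 * (w0 - w n)).
    by rewrite exprSr -mulrA -mulrBr; congr (_ * _); field; rewrite wv w0v.
  rewrite !cmodM [cmod (w0 - _)]cmod_distC cmodX mulrA.
  rewrite (@le_trans _ _ (d^-1 ^+ k.+2 * cmod (w n - w0)))//.
    rewrite ler_wpM2r ?cmod_ge0// [leRHS]exprSr ler_pM ?exprn_ge0 ?cmod_ge0//.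
      by apply: lerXn2r; rewrite ?nnegrE ?cmod_ge0 ?invr_ge0 ?(ltW d0)// le_d.
    exact: le_d.
  by rewrite exprVn mulrC ler_pdivrMr ?exprn_gt0.
Qed.

(** Every real x has distance at least [Im w0] from [w0], so the Taylor series of the resolvent
    about [w0] converges, uniformly in x, at each point of the disc of that radius. *)
Lemma cagree_taylor (w0 w : R[i]) : 0 < complex.Im w0 ->
  cmod (w0 - w) < complex.Im w0 ->
  (forall k, cagree (fun x : R => (w0 - x%:C)^-1 ^+ k.+1)) ->
  cagree (fun x : R => (w - x%:C)^-1).
Proof.
move=> w00 ww0 aw0.
have w1 : 0 < complex.Im w.
  have := le_lt_trans (Im_le_cmod _) ww0; rewrite cImD cImN => h.
  by have := le_lt_trans (ler_norm _) h; rewrite ltrBlDr ltrDl.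
have w0n : complex.Im w0 != 0 by rewrite gt_eqF.
have wn : complex.Im w != 0 by rewrite gt_eqF.
pose q := cmod (w0 - w) / complex.Im w0.
have q0 : 0 <= q by rewrite divr_ge0 ?cmod_ge0 ?ltW.
have q1 : q < 1 by rewrite ltr_pdivrMr// mul1r.
have rem k x : cmod ((w0 - w) ^+ k * ((w0 - x%:C)^-1 ^+ k * (w - x%:C)^-1)) <=
    q ^+ k * (complex.Im w)^-1.
  rewrite mulrA -exprMn cmodM cmodX ler_pM ?exprn_ge0 ?cmod_ge0//.
    rewrite lerXn2r ?nnegrE ?cmod_ge0// cmodM ler_pM ?cmod_ge0//.
    by rewrite (le_trans (cmod_resolvent_le _ _))// ger0_norm// ltW.
  by rewrite (le_trans (cmod_resolvent_le _ _))// ger0_norm// ltW.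
have E k x := @inv_taylor w w0 x%:C k (sub_real_neq0 _ wn) (sub_real_neq0 _ w0n).
apply: (@cagree_lim
  (fun k x => \sum_(j < k) (w0 - w) ^+ j * (w0 - x%:C)^-1 ^+ j.+1) _
  ((complex.Im w)^-1 + (complex.Im w)^-1)).
- by move=> k; apply: cagree_sum => j; exact/cagreeZ.
- move=> k x; have -> := esym (addrK ((w0 - w) ^+ k * ((w0 - x%:C)^-1 ^+ k * (w - x%:C)^-1))
    (\sum_(j < k) (w0 - w) ^+ j * (w0 - x%:C)^-1 ^+ j.+1)).
  rewrite -E (le_trans (cmodB _ _))// lerD//.
    by rewrite (le_trans (cmod_resolvent_le _ _))// ger0_norm// ltW.
  rewrite (le_trans (rem _ _))// ler_piMl ?invr_ge0 ?(ltW w1)//.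
  by rewrite exprn_ile1// ltW.
- move=> x; apply: (@squeeze_cvgr _ _ _ _ (fun=> 0)
    (fun k => q ^+ k * (complex.Im w)^-1)).
  + apply: nearW => k; rewrite cmod_ge0/= (E k x) opprD addNKr cmodN.
    exact: rem.
  + exact: cvg_cst.
  + rewrite -(mul0r (complex.Im w)^-1); apply: cvgM; last exact: cvg_cst.
    by apply: cvg_expr; rewrite ger0_norm.
Qed.

Hypothesis agree_resolvent : forall w : R[i], 0 < complex.Im w ->
  cagree (fun x : R => (w - x%:C)^-1).

(** Up to the factor [- sqrt p], this is the imaginary part of the resolvent at [c + i sqrt p]. *)
Lemma agree_cauchy_kernel (p c : R) : 0 < p ->
  agree (fun x => (p + (x - c) ^+ 2)^-1).
Proof.
move=> p0; pose b := Num.sqrt p; have b0 : 0 < b by rewrite sqrtr_gt0.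
have [_ h] := @agree_resolvent (c +i* b) b0.
have := agreeZ (- b^-1) h; congr agree; apply/funext => x.
rewrite cImV sqr_cmod/= subr0 sqr_sqrtr ?ltW// [p + _]addrC -[(c - x) ^+ 2]sqrrN.
rewrite opprB; have : (x - c) ^+ 2 + p != 0 by rewrite gt_eqF// ltr_wpDl// sqr_ge0.
by set u := _ + p => u0; field; rewrite u0 gt_eqF.
Qed.

(** As a function of p the kernel [1 / (p + (x - c)^2)] is again a resolvent, now of [- (x - c)^2],
    so [cagree_pow] applies along [p + 1 / (n + 1)]. *)
Lemma agree_cauchy_kernel_exp (p c : R) k : 0 < p ->
  agree (fun x => (p / (p + (x - c) ^+ 2)) ^+ k).
Proof.
case: k => [_|k p0]; first by under eq_fun do rewrite expr0; exact: agree_cst.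
pose v x : R[i] := (- (x - c) ^+ 2)%:C.
have pv (q : R) x : q%:C - v x = (q + (x - c) ^+ 2)%:C.
  by rewrite /v -rmorphB opprK.
have cv : cagree (fun x => (p%:C - v x)^-1 ^+ k.+1).
  apply: (@cagree_pow v (fun n => (p + n.+1%:R^-1)%:C) p%:C p) => //.
  - by move=> n; rewrite rmorphD/= -subr_eq0 addrAC subrr add0r fmorph_eq0
      invr_eq0 pnatr_eq0.
  - under eq_fun do rewrite -rmorphB addrAC subrr add0r cmod_real ger0_norm//.
    exact: cvg_harmonic.
  - move=> n x; rewrite pv cmod_real (le_trans _ (ler_norm _))// -addrA lerDl.
    by rewrite addr_ge0// sqr_ge0.
  - by move=> x; rewrite pv cmod_real (le_trans _ (ler_norm _))// lerDl sqr_ge0.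
  - move=> n; have pn : 0 < p + n.+1%:R^-1 by rewrite addr_gt0.
    split.
      under eq_fun do rewrite pv -fmorphV/=.
      exact: agree_cauchy_kernel.
    under eq_fun do rewrite pv -fmorphV/=.
    exact: agree_cst.
have := agreeZ (p ^+ k.+1) cv.1; congr agree; apply/funext => x.
by rewrite pv -fmorphV -rmorphXn/= exprMn.
Qed.

Lemma agree_cauchy_kernel_poly (p c : R) (q : {poly R}) : 0 < p ->
  agree (fun x => q.[p / (p + (x - c) ^+ 2)]).
Proof.
move=> p0; under eq_fun do rewrite horner_coef.
have : forall k, agree (fun x => \sum_(i < k) q`_i * (p / (p + (x - c) ^+ 2)) ^+ i).
  elim=> [|k ih]; first by under eq_fun do rewrite big_ord0; exact: agree_cst.
  under eq_fun do rewrite big_ord_recr/=.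
  by apply: agreeD => //; exact/agreeZ/agree_cauchy_kernel_exp.
exact.
Qed.

End uniqueness.

(** * Indicators of intervals as limits of polynomials in a Cauchy kernel *)

Section step_polynomial.
Context {R : realType}.

Lemma bernoulli (u : R) n : 0 <= u -> 1 + n%:R * u <= (1 + u) ^+ n.
Proof.
move=> u0; elim: n => [|n ih]; first by rewrite mul0r addr0 expr0.
rewrite exprS (le_trans _ (ler_wpM2l _ ih)) ?addr_ge0//.
rewrite -natr1; have : 0 <= n%:R * u * u by rewrite !mulr_ge0.
by set N := n%:R => h; nra.
Qed.

(** Combine [(1 - u)^n (1 + u)^n <= 1] with Bernoulli's inequality for [(1 + u)^n]. *)
Lemma one_sub_exp_le (u : R) n : 0 <= u <= 1 ->
  (1 - u) ^+ n <= (1 + n%:R * u)^-1.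
Proof.
move=> /andP[u0 u1]; have h : 0 < 1 + n%:R * u by rewrite ltr_pwDl// mulr_ge0.
rewrite -[leRHS]mul1r ler_pdivlMr// -[leRHS](expr1n _ n).
apply: le_trans (_ : (1 - u) ^+ n * (1 + u) ^+ n <= _).
  by rewrite ler_wpM2l ?bernoulli// exprn_ge0// subr_ge0.
rewrite -exprMn lerXn2r ?nnegrE ?ler01//.
  by rewrite mulr_ge0 ?subr_ge0// addr_ge0.
by rewrite -subr_sqr expr1n gerBl sqr_ge0.
Qed.

Lemma one_sub_exp_ge (u : R) n : 0 <= u <= 1 -> 1 - n%:R * u <= (1 - u) ^+ n.
Proof.
move=> /andP[u0 u1]; elim: n => [|n ih]; first by rewrite mul0r subr0 expr0.
rewrite exprS (le_trans _ (ler_wpM2l _ ih)) ?subr_ge0//.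
rewrite -natr1; have : 0 <= n%:R * u * u by rewrite !mulr_ge0.
by set N := n%:R => h; nra.
Qed.

(** With p the square root of q, [n q^n = (n p^n) p^n], and [n p^n] is at most [1 / (1 - p)] by
    [one_sub_exp_le] for [u = 1 - p]. *)
Lemma cvg_natrM_expr (q : R) : 0 <= q < 1 -> n%:R * q ^+ n @[n --> \oo] --> (0 : R).
Proof.
move=> /andP[q0 q1]; pose p := Num.sqrt q.
have p0 : 0 <= p := sqrtr_ge0 _.
have p1 : p < 1 by rewrite -(sqrtr1 R) ltr_sqrt.
have u0 : 0 < 1 - p by rewrite subr_gt0.
have qE n : q ^+ n = p ^+ n * p ^+ n by rewrite -exprMn -expr2 sqr_sqrtr.
apply: (@squeeze_cvgr _ _ _ _ (fun=> 0) (fun n => (1 - p)^-1 * p ^+ n)).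
- apply: nearW => n; rewrite mulr_ge0 ?exprn_ge0//= qE mulrA ler_wpM2r ?exprn_ge0//.
  have := @one_sub_exp_le (1 - p) n; rewrite ltW// gerBl p0 subKr => /(_ isT) h.
  rewrite (le_trans (ler_wpM2l (ler0n _ n) h))//.
  have n0 : 0 < 1 + n%:R * (1 - p) by rewrite ltr_pwDl// mulr_ge0// ltW.
  rewrite ler_pdivrMr// mulrDr mulr1 mulrCA mulVf ?gt_eqF// mulr1.
  by rewrite lerDr invr_ge0 ltW.
- exact: cvg_cst.
- rewrite -(mulr0 (1 - p)^-1); apply: cvgM; first exact: cvg_cst.
  by apply: cvg_expr; rewrite ger0_norm.
Qed.

End step_polynomial.

Section uniqueness_step.
Context {R : realType}.
Variables m m' : probability R R.
Hypothesis agree_resolvent : forall w : R[i], 0 < complex.Im w ->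
  cagree m m' (fun x : R => (w - x%:C)^-1).

(* With [s] the Cauchy kernel scaled so that [1 / 2 <= s x] exactly on [[a, b]], the
   polynomials [1 - (1 - s ^+ n) ^+ (n * 2 ^ n)] in [s] tend to [\1_(`[a, b])]. *)
Lemma agree_indic_itvcc (a b : R) : a < b -> agree m m' (\1_(`[a, b])).
Proof.
move=> ab; pose c := (a + b) / 2; pose l := (b - a) / 2.
have cla : c - l = a by rewrite /c /l; lra.
have clb : c + l = b by rewrite /c /l; lra.
pose p := l ^+ 2.
have l0 : 0 < l by rewrite divr_gt0// subr_gt0.
have p0 : 0 < p by rewrite exprn_gt0.
pose s x := p / (p + (x - c) ^+ 2).
have sd x : 0 < p + (x - c) ^+ 2 by rewrite ltr_pwDl// sqr_ge0.
have s0 x : 0 < s x by rewrite divr_gt0.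
have s1 x : s x <= 1 by rewrite ler_pdivrMr// mul1r lerDl sqr_ge0.
have s01 n x : 0 <= s x ^+ n <= 1 by rewrite exprn_ge0 ?exprn_ile1// ltW.
pose Q n : {poly R} := 1 - (1 - 'X^n) ^+ (n * 2 ^ n)%N.
have QE n x : (Q n).[s x] = 1 - (1 - s x ^+ n) ^+ (n * 2 ^ n)%N by rewrite !hornerE.
have h n x : 0 <= (1 - s x ^+ n) ^+ (n * 2 ^ n)%N <= 1.
  have /andP[h0 h1] := s01 n x.
  by rewrite exprn_ge0 ?exprn_ile1 ?subr_ge0// gerBl.
have sP x : (2^-1 <= s x) = (x \in `[a, b]).
  rewrite /s ler_pdivlMr// mulrC ler_pdivrMr// [_ * 2]mulr_natr mulr2n lerD2l.
  rewrite /p -[(x - c) ^+ 2]real_normK ?num_real// ler_pXn2r ?nnegrE ?(ltW l0)//.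
  by rewrite ler_distl in_itv/= cla clb.
apply: (@agree_lim _ _ _ (fun n x => (Q n).[s x]) _ 1).
- by move=> n; exact: agree_cauchy_kernel_poly.
- move=> n x; rewrite QE ger0_norm ?subr_ge0; have /andP[h0 h1] := h n x => //.
  by rewrite gerBl.
- move=> x; rewrite indicE mem_setE -sP; under eq_fun do rewrite QE.
  have [sx|sx] := leP 2^-1 (s x).
    have -> : (true%:R : R) = 1 - 0 by rewrite subr0.
    apply: cvgB; first exact: cvg_cst.
    (* On [[a, b]], [2 s >= 1], hence [n 2^n s^n >= n], and [one_sub_exp_le] bounds the power by
       [1 / (n + 1)]. *)
    apply: (@squeeze_cvgr _ _ _ _ (fun=> 0) harmonic).
    + apply: nearW => n; have /andP[-> _] := h n x; rewrite /=.
      rewrite (le_trans (one_sub_exp_le _ (s01 _ _)))//.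
      rewrite lef_pV2 ?posrE//; last by rewrite ltr_pwDl// mulr_ge0// exprn_ge0// ltW.
      rewrite -natr1 addrC lerD2l natrM -mulrA ler_peMr// natrX -exprMn.
      by rewrite exprn_ege1// -ler_pdivrMl// mulr1.
    + exact: cvg_cst.
    + exact: cvg_harmonic.
  (* Outside [[a, b]], [2 s < 1], and Bernoulli's inequality bounds the polynomial by
     [n (2 s)^n]. *)
  apply: (@squeeze_cvgr _ _ _ _ (fun=> 0) (fun n => n%:R * (2 * s x) ^+ n)).
  + apply: nearW => n; have /andP[h0 h1] := h n x; rewrite subr_ge0 h1/=.
    rewrite lerBlDr -lerBlDl.
    have := one_sub_exp_ge (n * 2 ^ n) (s01 n x).
    by rewrite natrM natrX -mulrA -exprMn.
  + exact: cvg_cst.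
  + by apply: cvg_natrM_expr; rewrite mulr_ge0 ?ltW//= -ltr_pdivlMl// mulr1.
Qed.

Lemma agree_indic_itvcy (a : R) : agree m m' (\1_(`[a, +oo[)).
Proof.
apply: (@agree_lim _ _ _ (fun n => \1_(`[a, a + n.+1%:R])) _ 1).
- by move=> n; apply: agree_indic_itvcc; rewrite ltrDl.
- by move=> n x; rewrite indicE; case: (_ \in _); rewrite ?normr1 ?normr0.
- move=> x; apply: cvg_near_cst; near=> n.
  rewrite !indicE !mem_setE !in_itv/= andbT; congr (_%:R); congr nat_of_bool.
  case: (leP a x) => //= ax; apply/esym/idP; rewrite -lerBlDl.
  near: n; have := nbhs_infty_ger (x - a).
  apply: filterS => n h; rewrite (le_trans h)// ler_nat//.
Unshelve. all: end_near. Qed.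

Lemma eq_measure_of_resolvent A : measurable A -> m A = m' A.
Proof.
apply: (measure_unique (@RGenCInfty.G R) (fun n => `[- n%:R, +oo[%classic)).
- exact: RGenCInfty.measurableE.
- move=> _ _ [a ->] [b ->]; exists (Num.max a b); apply/seteqP.
  by split=> x /=; rewrite !in_itv/= !andbT ge_max => /andP.
- by move=> n; eexists.
- rewrite -subTset => x _; exists (Num.bound `|x|) => //=.
  rewrite in_itv/= andbT lerNl (le_trans (ler_norm _))// normrN.
  by rewrite ltW// archi_boundP.
- move=> _ [a ->]; have [_] := agree_indic_itvcy a.
  rewrite /Rintegral !integral_indic// !setIT => h.
  rewrite -[LHS]fineK ?fin_num_measure// h fineK//.
  by rewrite fin_num_measure.
- by move=> n; rewrite (le_lt_trans (probability_le1 _ _))// ltry.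
Qed.

Lemma eq_integral_of_resolvent (f : R -> R) : \int[m]_x f x = \int[m']_x f x.
Proof.
by congr fine; apply: eq_measure_integral => A mA _; exact: eq_measure_of_resolvent.
Qed.

End uniqueness_step.

(** * Cauchy transforms and Burgers characteristics *)

Lemma imB {R : realType} (y y' : R) : (y *i - y' *i : R[i]) = (y - y') *i.
Proof. by apply: complex_ext; rewrite /= ?subr0. Qed.

Lemma cmod_im {R : realType} (y : R) : cmod (y *i) = `|y|.
Proof. by rewrite /cmod/= expr0n/= add0r sqrtr_sqr. Qed.

Section cauchy_transform_theory.
Context {R : realType}.
Implicit Types (m : probability R R) (z w : R[i]).

Lemma cauchy_transformB m z w : complex.Im z != 0 -> complex.Im w != 0 ->
  cauchy_transform m z - cauchy_transform m w =
  (w - z) * cint m (fun x => (z - x%:C)^-1 * (w - x%:C)^-1).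
Proof.
move=> z0 w0; have bz := cbdm_resolvent z0; have bw := cbdm_resolvent w0.
rewrite !cauchy_transformE -cintB// -cintZ; last exact: cbdmM.
apply: eq_cint => x; have := sub_real_neq0 x z0; have := sub_real_neq0 x w0.
by move=> xw xz; field; rewrite xw xz.
Qed.

Lemma cmod_cauchy_transformB m z w : 0 < complex.Im z -> 0 < complex.Im w ->
  cmod (cauchy_transform m z - cauchy_transform m w) <=
  2 / (complex.Im z * complex.Im w) * cmod (z - w).
Proof.
move=> z0 w0; have z1 : complex.Im z != 0 by rewrite gt_eqF.
have w1 : complex.Im w != 0 by rewrite gt_eqF.
rewrite cauchy_transformB// cmodM cmod_distC mulrC ler_wpM2r ?cmod_ge0// invfM.
apply: cmod_cint_le; first by apply: cbdmM; exact: cbdm_resolvent.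
move=> x; rewrite cmodM ler_pM ?cmod_ge0// (le_trans (cmod_resolvent_le _ _))//.
  by rewrite gtr0_norm.
by rewrite gtr0_norm.
Qed.

Lemma cmod_cauchy_transform_le m z : 0 < complex.Im z ->
  cmod (cauchy_transform m z) <= 2 / complex.Im z.
Proof.
move=> z0; have z1 : complex.Im z != 0 by rewrite gt_eqF.
rewrite cauchy_transformE cmod_cint_le//; first exact: cbdm_resolvent.
by move=> x; rewrite (le_trans (cmod_resolvent_le _ _))// gtr0_norm.
Qed.

(** Only one component is integrated, so the factor 2 of [cmod_cint_le] does not appear. This sharp
    bound makes [t < (Im z)^2] enough to keep a characteristic in the upper half-plane up to time
    t. *)
Lemma Im_cauchy_transform_le m z : 0 < complex.Im z ->
  `|complex.Im (cauchy_transform m z)| <= (complex.Im z)^-1.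
Proof.
move=> z0; have z1 : complex.Im z != 0 by rewrite gt_eqF.
apply: bdm_integral_norm_le; first by have [] := cbdm_resolvent z1.
move=> x; rewrite (le_trans (Im_le_cmod _))// (le_trans (cmod_resolvent_le _ _))//.
by rewrite gtr0_norm.
Qed.

Lemma cagree_resolvent m m' w : complex.Im w != 0 ->
  cauchy_transform m w = cauchy_transform m' w ->
  cagree m m' (fun x : R => (w - x%:C)^-1).
Proof.
move=> w0 [eR eI]; have [bR bI] := cbdm_resolvent w0.
by split.
Qed.

(* A point [w] of the upper half-plane lies in the disc of centre [om y] and radius
   [Im (om y)] as soon as [y] is large, so a single Taylor expansion reaches it. *)
Lemma eq_integral_of_cauchy_points m m' (om : R -> R[i]) (C : R) :
  (forall y, C < y -> `|complex.Re (om y)| <= C /\ y - C <= complex.Im (om y)) ->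
  (forall y n, C < y -> om (y + n.+1%:R^-1) != om y) ->
  (forall y, C < y -> cmod (om (y + n.+1%:R^-1) - om y) @[n --> \oo] --> (0 : R)) ->
  (forall y, C < y -> cauchy_transform m (om y) = cauchy_transform m' (om y)) ->
  forall f : R -> R, \int[m]_x f x = \int[m']_x f x.
Proof.
move=> omC om_neq om_cvg eG f; apply: eq_integral_of_resolvent => w w0.
pose u := complex.Re w; pose v := complex.Im w.
(* With [I = Im (om y)], the inequality [|om y - w| < I] amounts to
   [(Re (om y) - u)^2 + v^2 < 2 v I]. As [|Re (om y)| <= C] and [I >= y - C], this y makes the right
   side large enough. *)
pose y := `|C| + ((`|u| + `|C|) ^+ 2 + v ^+ 2) / (2 * v) + 1.
have r0 : 0 <= ((`|u| + `|C|) ^+ 2 + v ^+ 2) / (2 * v).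
  by rewrite divr_ge0 ?addr_ge0 ?sqr_ge0// mulr_ge0// ltW.
have Cy : C < y by rewrite /y; have := ler_norm C; lra.
have [omR omI] := omC y Cy.
have om0 : 0 < complex.Im (om y) by lra.
apply: (cagree_taylor om0).
- rewrite -(ltr_pXn2r (ltn0Sn 1)) ?nnegrE ?cmod_ge0 ?(ltW om0)//.
  rewrite sqr_cmod !(cReD, cImD, cReN, cImN) -/u -/v.
  have h1 : (complex.Re (om y) - u) ^+ 2 <= (`|u| + `|C|) ^+ 2.
    rewrite -[X in X <= _]real_normK ?num_real//.
    rewrite lerXn2r ?nnegrE ?addr_ge0// (le_trans (ler_normB _ _))//.
    by rewrite addrC lerD2l (le_trans omR)// ler_norm.
  have h2 : (`|u| + `|C|) ^+ 2 + v ^+ 2 < 2 * v * complex.Im (om y).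
    rewrite -ltr_pdivrMl ?mulr_gt0// mulrC (lt_le_trans _ omI)// /y.
    by have := ler_norm C; lra.
  by nra.
(* The powers of the resolvent at [om y] come from the neighbouring points [om (y + 1 / (n + 1))] of
   the curve. *)
- pose wn n := om (y + n.+1%:R^-1).
  have Cyn n : C < y + n.+1%:R^-1 by rewrite ltr_wpDr.
  have wnI n : y - C <= complex.Im (wn n).
    by have [_] := omC _ (Cyn n); apply: le_trans; rewrite lerD2r lerDl.
  have yC : 0 < y - C by rewrite subr_gt0.
  apply: (@cagree_pow _ m m' (fun x => x%:C) wn (om y) (y - C)) => //.
  + by move=> n; exact: om_neq.
  + exact: om_cvg.
  + by move=> n x; rewrite (le_trans (wnI n))// (le_trans (ler_norm _))//
      cmod_sub_real_ge.
  + by move=> x; rewrite (le_trans omI)// (le_trans (ler_norm _))// cmod_sub_real_ge.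
  + move=> n; apply: cagree_resolvent; last exact: eG.
    by rewrite gt_eqF// (lt_le_trans _ (wnI n)).
Qed.

Definition burgers_char m t w := w + t%:C * cauchy_transform m w.

(** High on the imaginary axis [t G] is bounded and [1/2]-Lipschitz, so [y |-> i y + t G(i y)] is
    continuous, injective and stays at bounded distance from the axis, as
    [eq_integral_of_cauchy_points] requires. *)
Lemma eq_integral_of_burgers m m' mu (t B : R) : 0 <= t ->
  (forall y, B < y -> cauchy_transform m (burgers_char mu t (y *i)) =
                      cauchy_transform m' (burgers_char mu t (y *i))) ->
  forall f : R -> R, \int[m]_x f x = \int[m']_x f x.
Proof.
move=> t0 eG.
(* For [y, y' > C] this gives [4 t <= y y'], which makes the Lipschitz constant [2 t / (y y')] at
   most [1/2], and also [2 t / y <= C]. *)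
pose C := `|B| + 4 * t + 4.
have C4 : 4 <= C by rewrite /C; have := normr_ge0 B; lra.
have Ct : 4 * t <= C by rewrite /C; have := normr_ge0 B; lra.
have CB : B <= C by rewrite /C; have := ler_norm B; lra.
have Lip y y' : C < y -> C < y' ->
    cmod (t%:C * cauchy_transform mu (y *i) - t%:C * cauchy_transform mu (y' *i))
    <= 2^-1 * `|y - y'|.
  move=> Cy Cy'; have y0 : 0 < y by lra.
  have y'0 : 0 < y' by lra.
  rewrite -mulrBr cmodM cmod_real ger0_norm//.
  have h := @cmod_cauchy_transformB mu (y *i) (y' *i) y0 y'0.
  rewrite imB cmod_im /= in h.
  apply: le_trans (ler_wpM2l t0 h) _; rewrite mulrA ler_wpM2r// mulrA.
  by rewrite ler_pdivrMr ?mulr_gt0//; nra.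
apply: (@eq_integral_of_cauchy_points m m' (fun y => burgers_char mu t (y *i)) C).
- move=> y Cy; have y0 : 0 < y by lra.
  have h : cmod (t%:C * cauchy_transform mu (y *i)) <= C.
    rewrite cmodM cmod_real ger0_norm//.
    rewrite (le_trans (ler_wpM2l t0 (cmod_cauchy_transform_le _ _)))//=.
    by rewrite mulrA ler_pdivrMr//; nra.
  rewrite cReD cImD [complex.Re (y *i)]/= [complex.Im (y *i)]/= add0r; split; first exact: le_trans (Re_le_cmod _) h.
  by rewrite lerD2l lerNl (le_trans (ler_norm _))// normrN (le_trans (Im_le_cmod _)).
- move=> y n Cy; apply/eqP => e; have yn : C < y + n.+1%:R^-1 by rewrite ltr_wpDr.
  have := Lip _ _ yn Cy; rewrite addrAC subrr add0r.
  have -> : t%:C * cauchy_transform mu ((y + n.+1%:R^-1) *i) -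
      t%:C * cauchy_transform mu (y *i) = - (n.+1%:R^-1 *i).
    move: e; rewrite /burgers_char; set P := t%:C * _; set Q := t%:C * _ => e.
    have -> : P - Q = ((y + n.+1%:R^-1) *i + P) - (y *i + Q) -
                      ((y + n.+1%:R^-1) *i - y *i) by ring.
    by rewrite e subrr sub0r imB addrAC subrr add0r.
  rewrite cmodN cmod_im ger0_norm//; apply/negP; rewrite -ltNge.
  by rewrite gtr_pMl// invf_lt1// ltr1n.
- move=> y Cy; apply: (@squeeze_cvgr _ _ _ _ (fun=> 0) (fun n => 2 * n.+1%:R^-1)).
  + apply: nearW => n; rewrite cmod_ge0 andTb.
    have yn : C < y + n.+1%:R^-1 by rewrite ltr_wpDr.
    have := Lip _ _ yn Cy; rewrite addrAC subrr add0r => h.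
    rewrite /burgers_char opprD addrACA (le_trans (cmodD _ _))//.
    rewrite imB cmod_im addrAC subrr add0r mulr_natl mulr2n lerD//.
      by rewrite ger0_norm.
    by rewrite (le_trans h)// ger0_norm// ger_pMl// invf_le1// ler1n.
  + exact: cvg_cst.
  + rewrite -(mulr0 2); apply: cvgM; [exact: cvg_cst|exact: cvg_harmonic].
- by move=> y Cy; apply: eG; lra.
Qed.

End cauchy_transform_theory.

(** * The Cauchy transform along the flow *)

Section complex_curves.
Context {R : realType}.
Implicit Types (f g : R -> R[i]) (s : R).

Definition is_cderive s f (df : R[i]) :=
  is_derive s (1 : R) (fun u => complex.Re (f u)) (complex.Re df) /\
  is_derive s (1 : R) (fun u => complex.Im (f u)) (complex.Im df).

Lemma is_cderiveD s f g df dg : is_cderive s f df -> is_cderive s g dg ->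
  is_cderive s (fun u => f u + g u) (df + dg).
Proof.
by move=> [r1 i1] [r2 i2]; split; [under eq_fun do rewrite cReD; rewrite cReD|
  under eq_fun do rewrite cImD; rewrite cImD]; exact: is_deriveD.
Qed.

Lemma is_cderive_cst s a : is_cderive s (fun=> a) 0.
Proof. by split; exact: is_derive_cst. Qed.

Lemma is_cderiveZ s a f df : is_cderive s f df ->
  is_cderive s (fun u => a * f u) (a * df).
Proof.
move=> [r i]; split.
  under eq_fun do rewrite cReM; rewrite cReM.
  by apply: is_deriveB; apply: is_deriveZ.
under eq_fun do rewrite cImM; rewrite cImM.
by apply: is_deriveD; apply: is_deriveZ.
Qed.

Lemma is_cderive_sum s (I : Type) (r : seq I) (F : I -> R -> R[i]) dF :
  (forall i, is_cderive s (F i) (dF i)) ->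
  is_cderive s (fun u => \sum_(i <- r) F i u) (\sum_(i <- r) dF i).
Proof.
move=> h; elim: r => [|i r ih].
  by rewrite big_nil; under eq_fun do rewrite big_nil; exact: is_cderive_cst.
by rewrite big_cons; under eq_fun do rewrite big_cons; exact: is_cderiveD.
Qed.

Lemma is_cderiveV s f df : f s != 0 -> is_cderive s f df ->
  is_cderive s (fun u => (f u)^-1) (- df * (f s)^-1 ^+ 2).
Proof.
move=> fs [r i].
have n0 : complex.Re (f s) ^+ 2 + complex.Im (f s) ^+ 2 != 0.
  by rewrite -sqr_cmod expf_neq0// cmod_eq0.
have dn : is_derive s (1 : R)
    (fun u => complex.Re (f u) ^+ 2 + complex.Im (f u) ^+ 2)
    (2 * complex.Re (f s) * complex.Re df + 2 * complex.Im (f s) * complex.Im df).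
  apply: is_derive_eq; rewrite /GRing.scale/= ?mulr2n; ring.
have dnV := @is_deriveV _
  (fun u => complex.Re (f u) ^+ 2 + complex.Im (f u) ^+ 2) s _ 1 n0 dn.
split.
  under eq_fun do rewrite cReV sqr_cmod.
  apply: (is_derive_eq (is_deriveM r dnV)).
  rewrite /GRing.scale/= [_^-1 ^+ 2]expr2 !(cReM, cImM, cReN, cImN, cReV, cImV) !sqr_cmod.
  by field.
under eq_fun do rewrite cImV sqr_cmod.
apply: (is_derive_eq (is_deriveN (is_deriveM i dnV))).
rewrite /GRing.scale/= [_^-1 ^+ 2]expr2 !(cReM, cImM, cReN, cImN, cReV, cImV) !sqr_cmod.
by field.
Qed.

Definition ccont_within (A : set R) f :=
  {within A, continuous (fun u => complex.Re (f u))} /\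
  {within A, continuous (fun u => complex.Im (f u))}.

Lemma ccont_withinD A f g : ccont_within A f -> ccont_within A g ->
  ccont_within A (fun u => f u + g u).
Proof.
by move=> [r1 i1] [r2 i2]; split; [under eq_fun do rewrite cReD|
  under eq_fun do rewrite cImD] => x; apply: cvgD; [exact: r1|exact: r2|exact: i1|exact: i2].
Qed.

Lemma ccont_within_cst A a : ccont_within A (fun=> a).
Proof. by split => x; exact: cvg_cst. Qed.

Lemma ccont_withinM A f g : ccont_within A f -> ccont_within A g ->
  ccont_within A (fun u => f u * g u).
Proof.
move=> [r1 i1] [r2 i2]; split.
  under eq_fun do rewrite cReM.
  by move=> x; apply: cvgB; apply: cvgM; [exact: r1|exact: r2|exact: i1|exact: i2].
under eq_fun do rewrite cImM.
by move=> x; apply: cvgD; apply: cvgM; [exact: r1|exact: i2|exact: i1|exact: r2].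
Qed.

Lemma ccont_within_sum A (I : Type) (r : seq I) (F : I -> R -> R[i]) :
  (forall i, ccont_within A (F i)) ->
  ccont_within A (fun u => \sum_(i <- r) F i u).
Proof.
move=> h; elim: r => [|i r ih].
  by under eq_fun do rewrite big_nil; exact: ccont_within_cst.
by under eq_fun do rewrite big_cons; exact: ccont_withinD.
Qed.

Lemma ccont_withinV A f : (forall u, A u -> f u != 0) ->
  ccont_within A f -> ccont_within A (fun u => (f u)^-1).
Proof.
move=> f0 [/subspace_continuousP r /subspace_continuousP i].
have n0 u : A u -> complex.Re (f u) ^+ 2 + complex.Im (f u) ^+ 2 != 0.
  by move=> Au; rewrite -sqr_cmod expf_neq0// cmod_eq0 f0.
have nV x : A x -> (complex.Re (f u) ^+ 2 + complex.Im (f u) ^+ 2)^-1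
    @[u --> within A (nbhs x)] --> (complex.Re (f x) ^+ 2 + complex.Im (f x) ^+ 2)^-1.
  move=> Ax; apply: cvgV; first exact: n0.
  by apply: cvgD; rewrite expr2; under eq_cvg do rewrite expr2;
    apply: cvgM; (exact: r || exact: i).
split.
  under eq_fun do rewrite cReV sqr_cmod.
  by apply/subspace_continuousP => x Ax; apply: cvgM; [exact: r|exact: nV].
under eq_fun do rewrite cImV sqr_cmod.
apply/subspace_continuousP => x Ax; apply: cvgN.
by apply: cvgM; [exact: i|exact: nV].
Qed.

Lemma ccont_within_sqr_cmod A f : ccont_within A f ->
  {within A, continuous (fun u => cmod (f u) ^+ 2)}.
Proof.
move=> [r i]; under eq_fun do rewrite sqr_cmod !expr2.
by move=> x; apply: cvgD; apply: cvgM; (exact: r || exact: i).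
Qed.

Lemma is_derive_sqr_cmod s f df : is_cderive s f df ->
  is_derive s (1 : R) (fun u => cmod (f u) ^+ 2)
    (2 * (complex.Re (f s) * complex.Re df + complex.Im (f s) * complex.Im df)).
Proof.
move=> [r i]; under eq_fun do rewrite sqr_cmod.
by apply: is_derive_eq; rewrite /GRing.scale/= ?mulr2n; ring.
Qed.

(** The left side is the real part of z times the conjugate of w; it is half the derivative of the
    squared modulus of a curve at z with velocity w. *)
Lemma Re_conj_mul_le (z w : R[i]) :
  complex.Re z * complex.Re w + complex.Im z * complex.Im w <= cmod z * cmod w.
Proof.
have := Re_le_cmod (z * w^*); rewrite cmodM.
have -> : cmod w^* = cmod w by case: w => a b; rewrite /cmod/= sqrrN.
apply: le_trans; rewrite (le_trans _ (ler_norm _))//.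
by case: z w => [a b] [c d] /=; rewrite mulrN opprK.
Qed.

(** The function [exp (- K s) (E s + b)] is nonincreasing; [1 <= K] is what lets [K (E + b)] absorb
    the inhomogeneous term b. The derivative is asked for in the open interval only, since the flow
    may start on the boundary of the chamber, where the equation need not make sense. *)
Lemma gronwall (E dE : R -> R) (t K b : R) : 0 <= t -> 1 <= K -> 0 <= b ->
  {within `[0, t], continuous E} ->
  (forall s, s \in `]0, t[ -> is_derive s (1 : R) E (dE s)) ->
  (forall s, s \in `]0, t[ -> dE s <= K * E s + b) ->
  E t <= expR (K * t) * (E 0 + b).
Proof.
move=> t0 K1 b0 cE dEE dEle.
pose F s := expR (- K * s) * (E s + b).
have dexp s : is_derive s (1 : R) (fun s => expR (- K * s)) (- K * expR (- K * s)).
  have dl : is_derive s (1 : R) (fun s => - K * s) (- K).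
    by apply: is_derive_eq; rewrite /GRing.scale/= mulr1.
  by apply: (is_derive_eq (is_derive1_comp _ dl)); rewrite mulrC.
have dF s : s \in `]0, t[ ->
    is_derive s (1 : R) F (expR (- K * s) * (dE s - K * (E s + b))).
  move=> st; have ds := dEE s st.
  by apply: is_derive_eq; rewrite /GRing.scale/=; ring.
have F0 : F t <= F 0.
  apply: (@ler0_derive1_le_cc _ F 0 t) => //.
  - by move=> s /dF ds; exact: ex_derive.
  - move=> s st; have ds := dF s st; rewrite derive1E derive_val.
    rewrite mulr_ge0_le0 ?expR_ge0// subr_le0 (le_trans (dEle s st))//.
    by rewrite mulrDr lerD2l ler_peMl.
  - move=> x; apply: cvgM; last by apply: cvgD; [exact: cE|exact: cvg_cst].
    apply: continuous_subspaceT => {}x.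
    exact/differentiable_continuous/derivable1_diffP/ex_derive.
  - by rewrite in_itv/= t0 lexx.
  - by rewrite in_itv/= t0 lexx.
move: F0; rewrite /F mulr0 expR0 mul1r mulNr expRN => F0.
rewrite -ler_pdivrMl ?expR_gt0// (le_trans _ F0)//.
by rewrite ler_wpM2l ?invr_ge0 ?expR_ge0// lerDl.
Qed.

End complex_curves.

Section empirical_cauchy_transform.
Context {R : realType}.

(** Written as a sum because [cauchy_transform] takes a probability, which [empirical] is not for
    [N = 0], and because the sum is what gets differentiated in time. *)
Definition empirical_cauchy N (y : 'I_N -> R) (z : R[i]) : R[i] :=
  (N%:R^-1)%:C * \sum_(i < N) (z - (y i)%:C)^-1.

(* With [e i = 1 / (z - y i)], [(e i)^2 / (y i - y j)] equals
   [e i e j / (y i - y j) + (e i)^2 e j], and the first term is antisymmetric. *)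
Lemma sum_interaction N (y : 'I_N -> R) (z : R[i]) : injective y ->
  (forall i, z - (y i)%:C != 0) ->
  \sum_(i < N) (\sum_(j < N | j != i) (y i - y j)^-1)%:C * (z - (y i)%:C)^-1 ^+ 2 =
  (\sum_(i < N) (z - (y i)%:C)^-1) * (\sum_(i < N) (z - (y i)%:C)^-1 ^+ 2)
  - \sum_(i < N) (z - (y i)%:C)^-1 ^+ 3.
Proof.
move=> yI zy; pose e i := (z - (y i)%:C)^-1.
pose c i j : R[i] := ((y i)%:C - (y j)%:C)^-1.
have step i j : j != i -> c i j * e i ^+ 2 = c i j * (e i * e j) + e i ^+ 2 * e j.
  move=> ji; rewrite /c /e.
  have yij : (y i)%:C - (y j)%:C != 0 :> R[i].
    by rewrite -rmorphB fmorph_eq0 subr_eq0; apply: contraNneq ji => /yI ->.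
  by field; rewrite yij !zy.
transitivity (\sum_(i < N) \sum_(j < N | j != i) (c i j * (e i * e j) + e i ^+ 2 * e j)).
  apply: eq_bigr => i _; rewrite rmorph_sum mulr_suml; apply: eq_bigr => j ji.
  by rewrite -step// /c fmorphV rmorphB.
under eq_bigr do rewrite big_split/=.
rewrite big_split/=.
have -> : \sum_(i < N) \sum_(j < N | j != i) c i j * (e i * e j) = 0.
  (* The diagonal terms may be added freely since the inverse of 0 is 0. Over the full square,
     exchanging i and j turns the sum into its opposite. *)
  have h : \sum_(i < N) \sum_(j < N | j != i) c i j * (e i * e j) =
      \sum_(i < N) \sum_(j < N) c i j * (e i * e j).
    apply: eq_bigr => i _; rewrite [RHS](bigD1 i)//=.
    by rewrite /c subrr invr0 mul0r add0r.
  rewrite h; set S := LHS.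
  have SN : S = - S.
    rewrite /S {1}exchange_big/= -sumrN; apply: eq_bigr => i _.
    rewrite -sumrN; apply: eq_bigr => j _.
    by rewrite /c -opprB invrN mulNr [e j * _]mulrC.
  have : S *+ 2 == 0 by rewrite mulr2n {1}SN addNr.
  by rewrite mulrn_eq0/= => /eqP.
rewrite add0r mulr_sumr -sumrB; apply: eq_bigr => i _; rewrite -/(e i).
rewrite [in RHS](bigD1 i)//= -/(e i) mulrDl -exprS addrAC subrr add0r.
by rewrite mulr_suml; apply: eq_bigr => j _; rewrite mulrC.
Qed.

End empirical_cauchy_transform.

Section weyl_chamber.
Context {R : realType}.

(** Lowering the coordinate i by half the radius of a ball inside the chamber stays in the chamber,
    so every later coordinate is smaller by at least that amount. *)
Lemma weyl_interior_injective N (v : 'rV[R]_N) :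
  (weyl_chamberA N)° v -> injective (fun i => v 0 i).
Proof.
move=> /nbhs_ballP[e /= e0 evW].
suff lt_v (i j : 'I_N) : (i < j)%N -> v 0 j < v 0 i.
  move=> i j vij; apply/val_inj; case: (ltngtP i j) => // /lt_v;
  by rewrite vij ltxx.
move=> ij; pose w : 'rV[R]_N := \row_k (v 0 k - (if k == i then e / 2 else 0)).
have /evW/(_ _ _ (ltnW ij)) : ball v e w.
  split=> // k l; rewrite !ord1 /w mxE /ball/= opprB addrC subrK.
  by case: ifP => _; rewrite ?normr0// gtr0_norm ?divr_gt0//; lra.
rewrite !mxE eqxx ifF; last by apply/eqP => ji; rewrite ji ltnn in ij.
by lra.
Qed.

End weyl_chamber.

Section flow.
Context {R : realType} (N : nat) (x0 : 'rV[R]_N) (phi : R -> 'rV[R]_N).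
Hypothesis N0 : (0 < N)%N.
Hypothesis phi_sol : is_frozen_solution x0 phi.

Let y s (i : 'I_N) := phi s 0 i / Num.sqrt N%:R.

Let sN : Num.sqrt N%:R != 0 :> R.
Proof. by rewrite sqrtr_eq0 -ltNge ltr0n. Qed.

(** The scaling enters twice, once in front and once inside the differences, and so produces the
    mean-field factor [1 / N]. *)
Lemma scaled_flow_derive (s : R) (i : 'I_N) : 0 < s ->
  is_derive s (1 : R) (fun u => y u i)
    (N%:R^-1 * \sum_(j < N | j != i) (y s i - y s j)^-1).
Proof.
case: phi_sol => _ _ _ _ dphi s0.
have ds := dphi s s0 i; rewrite /y.
under eq_fun do rewrite mulrC.
apply: (is_derive_eq (is_deriveZ _ ds)); rewrite /GRing.scale/= !mulr_sumr.
apply: eq_bigr => j _; rewrite -mulrBl invfM invrK [_^-1 * Num.sqrt _]mulrC mulrA.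
congr (_ * _); rewrite -[X in _ = X^-1 * _](@sqr_sqrtr _ N%:R)// expr2 invfM.
by rewrite -mulrA mulVf// mulr1.
Qed.

Lemma scaled_flow_injective (s : R) : 0 < s -> injective (y s).
Proof.
case: phi_sol => _ _ _ h _ s0 i j /(divIf sN).
exact: (weyl_interior_injective (h s s0)).
Qed.

Lemma scaled_flow_continuous (i : 'I_N) : {within `[0, +oo[, continuous (fun u => y u i)}.
Proof.
case: phi_sol => c _ _ _ _ x; apply: cvgM; last exact: cvg_cst.
apply: (@cvg_comp _ _ _ phi (fun M : 'rV[R]_N => M 0 i) _ _ _ (c x)).
exact: coord_continuous.
Qed.

(** Along the line [z + s g] the error satisfies exactly [(h - g)' = (h - g) A - B]: A is the mean
    of the squared resolvents, bounded by [c^-2], and B is the self-interaction left over by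
    [sum_interaction], of size [1 / N]. Gronwall is applied to the square of the modulus, which is
    differentiable even where the error vanishes. *)
Lemma flow_cauchy_bound (z g : R[i]) (t c : R) : 0 <= t -> 0 < c ->
  (forall s, 0 <= s <= t -> c <= complex.Im (z + s%:C * g)) ->
  cmod (empirical_cauchy (y t) (z + t%:C * g) - g) ^+ 2 <=
  expR ((2 * c^-1 ^+ 2 + 1) * t) *
  (cmod (empirical_cauchy (y 0) z - g) ^+ 2 + (N%:R^-1 * c^-1 ^+ 3) ^+ 2).
Proof.
move=> t0 c0 zc.
pose h s := empirical_cauchy (y s) (z + s%:C * g).
pose e s i := (z + s%:C * g - (y s i)%:C)^-1.
pose A s := (N%:R^-1)%:C * \sum_(i < N) e s i ^+ 2.
pose B s := ((N%:R^-1)%:C ^+ 2) * \sum_(i < N) e s i ^+ 3.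
have zI (s : R) : 0 <= s <= t -> complex.Im (z + s%:C * g) != 0.
  by move=> st; rewrite gt_eqF// (lt_le_trans c0)// zc.
have le_e (s : R) i : 0 <= s <= t -> cmod (e s i) <= c^-1.
  move=> st; rewrite (le_trans (cmod_resolvent_le _ (zI s st)))//.
  have cs := zc s st; rewrite gtr0_norm ?(lt_le_trans c0)//.
  by rewrite lef_pV2 ?posrE// (lt_le_trans c0).
have NN : N%:R != 0 :> R by rewrite pnatr_eq0 -lt0n.
have A_le (s : R) : 0 <= s <= t -> cmod (A s) <= c^-1 ^+ 2.
  move=> st; rewrite cmodM cmod_real ger0_norm ?invr_ge0// ler_pdivrMl ?ltr0n//.
  rewrite (le_trans (cmod_sum _ _ _))//.
  rewrite (@le_trans _ _ (\sum_(i < N) c^-1 ^+ 2))//; last first.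
    by rewrite sumr_const card_ord mulr_natl.
  apply: ler_sum => i _; rewrite cmodX lerXn2r ?nnegrE ?cmod_ge0 ?le_e//.
  by rewrite invr_ge0 ltW.
have B_le (s : R) : 0 <= s <= t -> cmod (B s) <= N%:R^-1 * c^-1 ^+ 3.
  move=> st; rewrite cmodM cmodX cmod_real ger0_norm ?invr_ge0//.
  rewrite expr2 -mulrA ler_wpM2l ?invr_ge0// ler_pdivrMl ?ltr0n//.
  rewrite (le_trans (cmod_sum _ _ _))//.
  rewrite (@le_trans _ _ (\sum_(i < N) c^-1 ^+ 3))//; last first.
    by rewrite sumr_const card_ord mulr_natl.
  apply: ler_sum => i _; rewrite cmodX lerXn2r ?nnegrE ?cmod_ge0 ?le_e//.
  by rewrite invr_ge0 ltW.
have dh (s : R) : s \in `]0, t[ -> is_cderive s (fun s => h s - g) ((h s - g) * A s - B s).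
  rewrite in_itv/= => /andP[s0 st]; have st' : 0 <= s <= t by rewrite !ltW.
  pose dy i := N%:R^-1 * \sum_(j < N | j != i) (y s i - y s j)^-1.
  have de i : is_cderive s (e ^~ i) ((- (g - (dy i)%:C)) * e s i ^+ 2).
    apply: (@is_cderiveV _ s (fun s => z + s%:C * g - (y s i)%:C)).
      exact: sub_real_neq0 (zI s st').
    apply: is_cderiveD; last first.
      have ds := scaled_flow_derive i s0.
      split; last by rewrite /= oppr0; exact: is_derive_cst.
      exact: is_deriveN.
    rewrite -[X in is_cderive _ _ X]add0r; apply: is_cderiveD.
      exact: is_cderive_cst.
    rewrite -[X in is_cderive _ _ X]mulr1; under eq_fun do rewrite mulrC.
    apply: is_cderiveZ; split => /=; [exact: is_derive_id|exact: is_derive_cst].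
  rewrite (_ : _ - B s = (N%:R^-1)%:C * \sum_(i < N) ((- (g - (dy i)%:C)) * e s i ^+ 2) + 0).
    apply: is_cderiveD; last exact: is_cderive_cst.
    exact/is_cderiveZ/is_cderive_sum.
  have := @sum_interaction _ N (y s) (z + s%:C * g) (scaled_flow_injective s0)
    (fun i => sub_real_neq0 _ (zI s st')).
  under eq_bigr do rewrite -/(e s _).
  under [X in _ = X * _ - _]eq_bigr do rewrite -/(e s _).
  under [X in _ = _ * X - _]eq_bigr do rewrite -/(e s _).
  under [X in _ = _ - X]eq_bigr do rewrite -/(e s _).
  move=> E.
  have -> : \sum_(i < N) - (g - (dy i)%:C) * e s i ^+ 2 =
    (N%:R^-1)%:C * ((\sum_(i < N) e s i) * (\sum_(i < N) e s i ^+ 2) -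
       \sum_(i < N) e s i ^+ 3) - g * \sum_(i < N) e s i ^+ 2.
    rewrite -E !mulr_sumr -sumrB; apply: eq_bigr => i _.
    by rewrite /dy rmorphM/=; ring.
  rewrite /h /empirical_cauchy /A /B.
  under eq_bigr do rewrite -/(e s _).
  by ring.
rewrite -[X in cmod (empirical_cauchy _ X - _) ^+ 2 + _](addr0 z) -(mul0r g).
apply: (@gronwall _ (fun s => cmod (h s - g) ^+ 2)
  (fun s => 2 * (complex.Re (h s - g) * complex.Re ((h s - g) * A s - B s) +
                 complex.Im (h s - g) * complex.Im ((h s - g) * A s - B s)))) => //.
- by rewrite lerDr mulr_ge0// exprn_ge0// invr_ge0 ltW.
- exact: sqr_ge0.
- apply: ccont_within_sqr_cmod.
  apply: ccont_withinD; last exact: ccont_within_cst.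
  apply: ccont_withinM; first exact: ccont_within_cst.
  apply: ccont_within_sum => i; apply: ccont_withinV.
    move=> s; rewrite /= in_itv/= => st; exact: sub_real_neq0 (zI s st).
  have cr (f : R -> R) : {within `[0, t], continuous f} -> ccont_within `[0, t] (fun u : R => (f u)%:C).
    by move=> cf; split => //= x; exact: cvg_cst.
  apply: ccont_withinD; first apply: ccont_withinD; first exact: ccont_within_cst.
    apply: ccont_withinM; last exact: ccont_within_cst.
    by apply: cr; apply: continuous_subspaceT => x; exact: cvg_id.
  have cy : {within `[0, t], continuous (fun u => y u i)}.
    apply: (@continuous_subspaceW _ _ `[0, t] `[0, +oo[); last exact: scaled_flow_continuous.
    by move=> u /=; rewrite !in_itv/= andbT => /andP[].
  by split=> /= x; [apply: cvgN; exact: cy|exact: cvg_cst].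
- by move=> s /dh; exact: is_derive_sqr_cmod.
- move=> s; rewrite in_itv/= => /andP[s0 st].
  have st' : 0 <= s <= t by rewrite !ltW.
  have := Re_conj_mul_le (h s - g) ((h s - g) * A s - B s).
  have := cmodB ((h s - g) * A s) (B s); rewrite cmodM.
  have := A_le s st'; have := B_le s st'.
  have := cmod_ge0 (h s - g); have := cmod_ge0 (B s); have := cmod_ge0 (A s).
  set X := cmod (h s - g); set b := cmod (B s); set a := cmod (A s).
  set u := cmod (_ - _); set q := complex.Re _ * _ + _.
  set al := c^-1 ^+ 2; set be := N%:R^-1 * _.
  move=> a0 b0 X0 bb aa uu qq.
  have : X * u <= X * (X * a + b) by rewrite ler_wpM2l.
  have : X * (X * a) <= X * (X * al) by rewrite !ler_wpM2l.
  have : b ^+ 2 <= be ^+ 2 by rewrite ler_pXn2r// nnegrE// (le_trans b0).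
  (* From [2 X b <= X^2 + b^2]; this is where the summand 1 in [2 c^-2 + 1] comes from. *)
  have := sqr_ge0 (X - b).
  by nra.
Qed.

End flow.

(** * Weak limits of empirical measures along an ultrafilter *)

Section uniform01.
Context {R : realType}.

(* [uniform_prob] lives on [measurableTypeR R], whose display is not the default one
   of [R]. *)
Definition unif01 (A : set R) : \bar R := uniform_prob (@ltr01 R) A.

Let unif01_0 : unif01 set0 = 0%E.
Proof. exact: measure0. Qed.

Let unif01_ge0 A : (0 <= unif01 A)%E.
Proof. exact: measure_ge0. Qed.

Let unif01_sigma_additive : semi_sigma_additive unif01.
Proof. exact: (@measure_semi_sigma_additive _ _ _ (uniform_prob (@ltr01 R))). Qed.

HB.instance Definition _ := isMeasure.Build _ _ _ unif01
  unif01_0 unif01_ge0 unif01_sigma_additive.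

Let unif01_setT : unif01 [set: _] = 1%E.
Proof. exact: (@probability_setT _ _ _ (uniform_prob (@ltr01 R))). Qed.

HB.instance Definition _ := @Measure_isProbability.Build _ _ R unif01 unif01_setT.

Lemma unif01_itv (a b : R) : 0 <= a -> a <= b -> b <= 1 ->
  unif01 `[a, b[%classic = (b - a)%:E.
Proof.
move=> a0 ab b1.
rewrite /unif01 /uniform_prob.
rewrite (eq_integral (fun=> 1%:E)); last first.
  move=> x; rewrite inE/= in_itv/= /uniform_pdf => /andP[ax xb].
  by rewrite (le_trans a0 ax)/= (le_trans (ltW xb) b1) subr0 invr1.
rewrite integral_cst// mul1e; apply: (etrans (lebesgue_measure_itv `[a, b[)).
rewrite /= lte_fin; by case: ltP => //= ba; rewrite (@le_anti _ _ a b) ?subrr// ab.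
Qed.

Lemma unif01_integral_eq (f g : R -> R) : bdm f -> bdm g ->
  (forall u, 0 < u < 1 -> f u = g u) -> \int[unif01]_u f u = \int[unif01]_u g u.
Proof.
move=> bf bg fg; congr fine; apply: ae_eq_integral => //.
- by apply/measurable_EFinP; have [] := bf.
- by apply/measurable_EFinP; have [] := bg.
- exists (~` `]0, 1[%classic); split.
  + exact: measurableC.
  + apply: (etrans (@probability_setC _ _ _ unif01 `]0, 1[%classic _)) => //.
    have : unif01 `]0, 1[%classic = 1%E.
      rewrite /unif01 /uniform_prob.
      rewrite (eq_integral (fun=> 1%:E)); last first.
        move=> x; rewrite inE/= in_itv/= /uniform_pdf => /andP[ax xb].
        by rewrite !ltW//= subr0 invr1.
      rewrite integral_cst// mul1e; apply: (etrans (lebesgue_measure_itv `]0, 1[)).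
      by rewrite /= lte_fin ltr01 oppr0 adde0.
    move=> h; rewrite -[RHS](@subee _ 1%E)//; congr (_ - _)%E.
    exact: h.
  + move=> u /= h; apply: contra_not h => h _; congr EFin.
    by apply: fg; move: h; rewrite /= in_itv.
Qed.

Lemma bdm_indic (A : set R) : measurable A -> bdm (\1_A : R -> R).
Proof.
move=> mA; split; first exact: measurable_indic.
by exists 1 => x; rewrite indicE; case: (_ \in _); rewrite ?normr1 ?normr0.
Qed.

Lemma bdm_sum n (F : nat -> R -> R) : (forall k, bdm (F k)) ->
  bdm (fun x => \sum_(k < n) F k x).
Proof.
move=> bF; elim: n => [|n ih].
  by under eq_fun do rewrite big_ord0; exact: bdm_cst.
by under eq_fun do rewrite big_ord_recr/=; exact: bdmD.
Qed.

Lemma bdm_integral_sum (m : probability R R) n (F : nat -> R -> R) :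
  (forall k, bdm (F k)) ->
  \int[m]_x (\sum_(k < n) F k x) = \sum_(k < n) \int[m]_x F k x.
Proof.
move=> bF; elim: n => [|n ih].
  by under eq_Rintegral do rewrite big_ord0; rewrite bdm_integral_cst big_ord0.
under eq_Rintegral do rewrite big_ord_recr/=.
by rewrite bdm_integralD//; [rewrite ih big_ord_recr|exact: bdm_sum].
Qed.

Lemma integral_indic_bdm (m : probability R R) (A : set R) : measurable A ->
  \int[m]_x (\1_A x) = fine (m A).
Proof. by move=> mA; rewrite /Rintegral integral_indic// setIT. Qed.

Lemma measurable_step K (c : nat -> R) :
  measurable_fun setT (fun u : R => c (Num.truncn (K%:R * u))).
Proof.
move=> _ Y mY; rewrite setTI.
rewrite (_ : _ @^-1` Y = \bigcup_(n in c @^-1` Y) [set u : R | Num.truncn (K%:R * u) = n]).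
  apply: bigcup_measurable => n _; apply: is_interval_measurable => u v /= un vn w.
  move=> /andP[uw wv]; apply/eqP; rewrite eqn_leq -{1}vn -un.
  by rewrite !le_truncn// ler_wpM2l.
apply/seteqP; split=> u /=; first by move=> Yu; exists (Num.truncn (K%:R * u)).
by move=> [n Yn /= ->].
Qed.

Lemma truncn_mul_lt K (u : R) : 0 <= u < 1 -> (0 < K)%N -> (Num.truncn (K%:R * u) < K)%N.
Proof.
move=> /andP[u0 u1] K0; rewrite truncn_lt_nat ?mulr_ge0//.
by rewrite -[ltRHS]mulr1 ltr_pM2l// ltr0n.
Qed.

(** Used in two roles: with K = N it writes an empirical mean as an integral of the quantile
    function, and with K the number of cells it writes a Riemann sum as an integral. *)
Lemma unif01_step K (c : nat -> R) : (0 < K)%N ->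
  bdm (fun u => c (Num.truncn (K%:R * u))) ->
  \int[unif01]_u c (Num.truncn (K%:R * u)) = K%:R^-1 * \sum_(k < K) c k.
Proof.
move=> K0 bc; have KR : 0 < K%:R :> R by rewrite ltr0n.
pose I k : set R := `[k%:R / K%:R, k.+1%:R / K%:R[%classic.
have mI k : measurable (I k) by exact: measurable_itv.
have bI k : bdm (fun u => c k * \1_(I k) u).
  by apply: bdmM; [exact: bdm_cst|apply: bdm_indic; exact: mI].
transitivity (\int[unif01]_u \sum_(k < K) c k * \1_(I k) u).
  apply: unif01_integral_eq => //.
    exact: (@bdm_sum K (fun k u => c k * \1_(I k) u)).
  move=> u /andP[u0 u1].
  have Ku0 : 0 <= K%:R * u by rewrite mulr_ge0// ltW.
  have tK : (Num.truncn (K%:R * u) < K)%N by apply: truncn_mul_lt; rewrite ?u1 ?ltW.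
  have IE k : (u \in I k) = (Num.truncn (K%:R * u) == k).
    rewrite truncn_eq// mem_setE in_itv/= ler_pdivrMr// ltr_pdivlMr//.
    by rewrite [u * _]mulrC.
  rewrite (bigD1 (Ordinal tK))//= indicE IE eqxx mulr1 big1 ?addr0// => k kt.
  rewrite indicE IE; case: eqP => [e|_]; last by rewrite mulr0.
  by move/eqP: kt; case; apply/val_inj.
rewrite (@bdm_integral_sum _ K (fun k u => c k * \1_(I k) u))// mulr_sumr; apply: eq_bigr => k _.
rewrite bdm_integralZ; last by apply: bdm_indic; exact: mI.
rewrite integral_indic_bdm//.
transitivity (c k * (k.+1%:R / K%:R - k%:R / K%:R)).
  congr (_ * _); apply: (congr1 fine (unif01_itv _ _ _)).
  - by rewrite divr_ge0.
  - by rewrite ler_wpM2r ?invr_ge0// ler_nat.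
  - by rewrite ler_pdivrMr// mul1r ler_nat.
by rewrite -mulrBl -natr1 addrAC subrr add0r mul1r mulrC.
Qed.

End uniform01.

(** * Riemann sums of monotone functions with a uniform error *)

Section modulus.
Context {R : realType}.

(** For [|x - y| < d] uniform continuity gives e; for larger distances [2 M / d * |x - y|] exceeds
    the oscillation 2 M. The bound is linear in [|x - y|] so that it can be telescoped along a
    monotone function. *)
Lemma continuous_modulus (f : R -> R) (A e : R) : continuous f -> 0 < e ->
  exists2 C, 0 <= C & forall x y, -A <= x <= A -> -A <= y <= A ->
    `|f x - f y| <= e + C * `|x - y|.
Proof.
move=> cf e0.
have [d d0 hd] : exists2 d : R, 0 < d & forall x y, -A <= x <= A ->
    `|x - y| < d -> `|f x - f y| <= e.
  have h x : `[- A, A]%classic x -> \forall x' \near x & d \near 0^'+,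
      forall y, `|x' - y| < d -> `|f x' - f y| <= e.
    move=> _; have /cvgrPdist_le/(_ (e / 2)) := cf x.
    rewrite divr_gt0// => /(_ isT) /nbhs_ballP[r /= r0 hr].
    exists (ball x (r / 2), [set d | d < r / 2]).
      split => /=; first by apply: nbhsx_ballx; rewrite divr_gt0.
      by apply: nbhs_right_lt; rewrite divr_gt0.
    move=> [x' d] /= [xx' dr] y x'y.
    have fy : `|f x - f y| <= e / 2.
      apply: hr; rewrite /ball/= -(subrK x' x) -addrA (le_lt_trans (ler_normD _ _))//.
      by rewrite [ltRHS]splitr ltrD// (lt_trans x'y).
    have fx' : `|f x - f x'| <= e / 2.
      apply: hr; rewrite /ball/= (lt_le_trans xx')// ler_pdivrMr//.
      by rewrite ler_peMr// ?ler1n// ltW.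
    rewrite -(subrK (f x) (f x')) -addrA (le_trans (ler_normD _ _))//.
    by rewrite [leRHS]splitr lerD// distrC.
  have := (compact_near_coveringP _).1 (@segment_compact R (- A) A) R (0^'+) _ _ h => hd.
  have [d [d0 {}hd]] : exists d, 0 < d /\ (`[- A, A]%classic `<=` (fun x' => forall y,
      `|x' - y| < d -> `|f x' - f y| <= e)).
    near (0 : R)^'+ => d; exists d; split => //; near: d; exact: hd.
  by exists d => // x y xA; apply: hd; rewrite /= in_itv.
have [M M0 fM] : exists2 M, 0 <= M & forall x, -A <= x <= A -> `|f x| <= M.
  have /compact_bounded[M [_ hM]] := continuous_compact
    (continuous_subspaceT cf) (@segment_compact R (- A) A).
  exists (`|M| + 1); first by rewrite addr_ge0.
  move=> x xA; apply: hM; first by rewrite ltr_pwDr// ler_norm.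
  by exists x => //=; rewrite in_itv.
exists (2 * M / d); first by rewrite divr_ge0 ?mulr_ge0// ltW.
move=> x y xA yA; have [xy|xy] := ltP `|x - y| d.
  by rewrite (le_trans (hd _ _ xA xy))// lerDl mulr_ge0// divr_ge0 ?mulr_ge0// ltW.
rewrite (le_trans (ler_normB _ _))// (@le_trans _ _ (2 * M))//.
  by rewrite mulr_natl mulr2n lerD// fM.
rewrite (@le_trans _ _ (2 * M / d * `|x - y|))//; last by rewrite lerDr ltW.
by rewrite -mulrA ler_peMr ?mulr_ge0// mulrC ler_pdivlMr// mul1r.
Unshelve. all: end_near. Qed.

End modulus.

Section clip.
Context {R : realType}.

Definition clip (A x : R) : R := Num.max (- A) (Num.min A x).

Lemma clip_itv A x : 0 <= A -> - A <= clip A x <= A.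
Proof. by move=> A0; rewrite /clip le_max lexx ge_max ge_min lexx/= andbT; lra. Qed.

Lemma clip_id A x : - A <= x <= A -> clip A x = x.
Proof.
by move=> /andP[x1 x2]; rewrite /clip (min_idPr _)// (max_idPr _).
Qed.

Lemma le_clip A x y : x <= y -> clip A x <= clip A y.
Proof. by move=> xy; apply: le_max2 => //; exact: le_min2. Qed.

Lemma continuous_clip A : continuous (clip A).
Proof.
move=> x.
have ci : {for x, continuous (@id R)} by exact: cvg_id.
have h := @continuous_min R R (fun=> A) id x (@cst_continuous _ _ A x) ci.
exact: (@continuous_max R R (fun=> - A) _ x (@cst_continuous _ _ (- A) x) h).
Qed.

Lemma measurable_clip A : measurable_fun setT (clip A).
Proof. by apply: continuous_measurable_fun; exact: continuous_clip. Qed.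

End clip.

Section riemann_sum.
Context {R : realType}.

Lemma unif01_integral_le (f g : R -> R) : bdm f -> bdm g ->
  (forall u, 0 < u < 1 -> f u <= g u) -> \int[unif01]_u f u <= \int[unif01]_u g u.
Proof.
move=> bf bg fg.
have bm : bdm (fun u => Num.min (f u) (g u)).
  split; first exact: measurable_minr bf.1 bg.1.
  have [_ [M fM]] := bf; have [_ [M' gM]] := bg.
  exists (Num.max M M') => x; rewrite /Num.min; case: ifP => _.
    by rewrite le_max fM.
  by rewrite le_max gM orbT.
rewrite (unif01_integral_eq bf bm); last by move=> u /fg h; rewrite (min_idPl h).
by apply: bdm_integral_le => // u; rewrite ge_min lexx orbT.
Qed.

Lemma unif01_integral_dist_le (f g h : R -> R) : bdm f -> bdm g -> bdm h ->
  (forall u, 0 < u < 1 -> `|f u - g u| <= h u) ->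
  `|\int[unif01]_u f u - \int[unif01]_u g u| <= \int[unif01]_u h u.
Proof.
move=> bf bg bh fgh; rewrite -bdm_integralB// ler_norml; apply/andP; split.
  rewrite -mulN1r -bdm_integralZ//; apply: unif01_integral_le => [||u /fgh].
  - by apply: bdmM => //; exact: bdm_cst.
  - exact: bdmB.
  - by rewrite mulN1r ler_norml => /andP[].
apply: unif01_integral_le => [||u /fgh] //; first exact: bdmB.
by rewrite ler_norml => /andP[].
Qed.

(** Sample points of a nonincreasing function on []0, 1[], of which nothing is known at the end
    points. Setting the outer values to A and - A makes the total drop of the nodes exactly 2 A. *)
Definition node (p : R -> R) (A : R) (K k : nat) : R :=
  if k == 0%N then A else if k == K then - A else clip A (p (k%:R / K%:R)).

Lemma node_itv p A K k : 0 <= A -> - A <= node p A K k <= A.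
Proof.
move=> A0; rewrite /node; case: ifP => _; first by rewrite lexx andbT; lra.
by case: ifP => _; [rewrite lexx /=; lra|exact: clip_itv].
Qed.

Lemma bdm_step K (c : nat -> R) M : (forall k, `|c k| <= M) ->
  bdm (fun u => c (Num.truncn (K%:R * u))).
Proof. by move=> cM; split; [exact: measurable_step|exists M => u; exact: cM]. Qed.

Lemma bdm_continuous_comp (f p : R -> R) M : continuous f -> (forall x, `|f x| <= M) ->
  measurable_fun setT p -> bdm (fun u => f (p u)).
Proof.
by move=> cf fM mp; apply: (bdm_comp mp); exact: bdm_continuous cf fM.
Qed.

(** On the cell number k the clipped value lies between the nodes k + 1 and k, so the error there is
    at most [e + C] times the drop of the nodes, and the drops telescope to 2 A. The bound does not
    depend on p. *)
Lemma riemann_sum_le (p f : R -> R) (A M e C : R) K : 0 <= A -> (0 < K)%N -> 0 <= C ->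
  measurable_fun setT p ->
  (forall u v, 0 < u -> u <= v -> v < 1 -> p v <= p u) ->
  continuous f -> (forall x, `|f x| <= M) ->
  (forall x y, - A <= x <= A -> - A <= y <= A -> `|f x - f y| <= e + C * `|x - y|) ->
  `|\int[unif01]_u f (clip A (p u)) - K%:R^-1 * \sum_(k < K) f (node p A K k)|
  <= e + C * (2 * A) / K%:R.
Proof.
move=> A0 K0 C0 mp pni cf fM fmod; have KR : 0 < K%:R :> R by rewrite ltr0n.
have bs : bdm (fun u => f (node p A K (Num.truncn (K%:R * u)))).
  by apply: (@bdm_step K (fun k => f (node p A K k)) M).
have bf : bdm (fun u => f (clip A (p u))).
  apply: (bdm_continuous_comp cf fM).
  exact: (measurableT_comp (measurable_clip A) mp).
have nM k : `|node p A K k| <= A by rewrite ler_norml node_itv.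
have bt : bdm (fun u => (fun k => e + C * (node p A K k - node p A K k.+1))
    (Num.truncn (K%:R * u))).
  apply: (@bdm_step K (fun k => e + C * (node p A K k - node p A K k.+1))
    (`|e| + C * (A + A))) => k.
  rewrite (le_trans (ler_normD _ _))// lerD2l normrM ger0_norm// ler_wpM2l//.
  by rewrite (le_trans (ler_normB _ _))// lerD.
have Es := @unif01_step _ K (fun k => f (node p A K k)) K0 bs.
have Et := @unif01_step _ K (fun k => e + C * (node p A K k - node p A K k.+1)) K0 bt.
rewrite /= in Es Et; rewrite -Es.
rewrite (le_trans (unif01_integral_dist_le bf bs bt _))//; last first.
  rewrite Et big_split/= sumr_const card_ord -mulr_sumr.
  rewrite -(big_mkord xpredT (fun k => node p A K k - node p A K k.+1)).
  rewrite (@telescope_sumr_eq _ 0 K (fun k => - node p A K k))//; last first.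
    by move=> k _; rewrite opprK addrC.
  have -> : node p A K K = - A by rewrite /node eqxx gtn_eqF.
  rewrite /node eqxx !opprK mulrDr -[e *+ K]mulr_natl mulKf ?gt_eqF// lerD2l.
  by rewrite mulrC mulr_natl mulr2n.
move=> u /andP[u0 u1]; set k := Num.truncn _.
have Ku0 : 0 <= K%:R * u by rewrite mulr_ge0// ltW.
have kK : (k < K)%N by apply: truncn_mul_lt; rewrite // u1 ltW.
have /andP[ku uk] := Num.Theory.truncn_itv Ku0.
have lo : node p A K k.+1 <= clip A (p u).
  rewrite /node/=; case: eqP => [_|/eqP kK1]; first by have /andP[] := clip_itv (p u) A0.
  have kK2 : (k.+1 < K)%N by rewrite ltn_neqAle kK1.
  apply/le_clip/pni => //; first by rewrite ler_pdivlMr// mulrC ltW.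
  by rewrite ltr_pdivrMr// mul1r ltr_nat.
have hi : clip A (p u) <= node p A K k.
  rewrite /node; case: eqP => [_|/eqP k0]; first by have /andP[] := clip_itv (p u) A0.
  rewrite ltn_eqF//; apply/le_clip/pni => //; last by rewrite ler_pdivrMr// mulrC.
  by rewrite divr_gt0// ltr0n lt0n.
rewrite (le_trans (fmod _ _ (clip_itv _ A0) (node_itv _ _ _ A0)))// lerD2l ler_wpM2l//.
by rewrite distrC ger0_norm ?subr_ge0// lerD2l lerN2.
Qed.

(** Clipping matters only on a set of measure 2 eta, where the two integrands differ by at most 2
    M. *)
Lemma integral_clip_le (p f : R -> R) (A M eta : R) : 0 < eta -> eta <= 1 / 2 ->
  continuous f -> (forall x, `|f x| <= M) -> measurable_fun setT p ->
  (forall u, eta <= u < 1 - eta -> - A <= p u <= A) ->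
  `|\int[unif01]_u f (p u) - \int[unif01]_u f (clip A (p u))| <= 4 * M * eta.
Proof.
move=> eta0 eta1 cf fM mp pA.
have mI : measurable (`[eta, 1 - eta[%classic : set R) by exact: measurable_itv.
have bI := bdm_indic mI.
have bh : bdm (fun u => 2 * M * (1 - \1_(`[eta, 1 - eta[%classic) u)).
  by apply: bdmM; [exact: bdm_cst|apply: bdmB => //; exact: bdm_cst].
have M0 : 0 <= M by rewrite (le_trans (normr_ge0 _) (fM 0)).
apply: le_trans (unif01_integral_dist_le _ _ bh _) _.
- exact: bdm_continuous_comp cf fM mp.
- apply: (bdm_continuous_comp cf fM).
  exact: (measurableT_comp (measurable_clip A) mp).
- move=> u _; rewrite indicE; have [uI|uI] := boolP (u \in _).
    rewrite clip_id ?subrr ?normr0 ?mulr0//.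
    by apply: pA; move: uI; rewrite inE/= in_itv.
  rewrite subr0 mulr1 (le_trans (ler_normB _ _))// mulr_natl mulr2n lerD//.
- rewrite bdm_integralZ; last by apply: bdmB => //; exact: bdm_cst.
  rewrite bdm_integralB//; last exact: bdm_cst.
  rewrite bdm_integral_cst integral_indic_bdm//.
  have -> : fine (unif01 `[eta, 1 - eta[%classic) = (1 - eta) - eta.
    by apply: (congr1 fine (unif01_itv _ _ _)); lra.
  by nra.
Qed.

End riemann_sum.

(** * Limits of quantile functions along an ultrafilter *)

Section ultrafilter_compactness.
Context {R : realType}.

Let itv_interior (u eta : R) : 0 < eta -> eta <= u -> u < 1 - eta ->
  [/\ 0 < u, u < 1 & 1 - eta < 1].
Proof. by move=> h1 h2 h3; split; lra. Qed.

Let sandwich_itv (A a b x y w : R) : `|a| + 1 <= A -> `|b| + 1 <= A ->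
  `|a - x| <= 1 -> `|b - y| <= 1 -> y <= w -> w <= x -> - A <= w <= A.
Proof.
have := ler_norm a; have := ler_norm (- b); rewrite normrN !ler_norml.
by move=> h1 h2 h3 h4 /andP[h5 h6] /andP[h7 h8] h9 h10; apply/andP; split; lra.
Qed.

(** The chain of [ultra_weak_limit]: limiting integral, its clipping, its Riemann sum, then the
    Riemann sum for N, the clipping for N and the empirical mean. The errors are
    [e/4 + e/8 + e/4 + e/8 + e/4]. *)
Let five_dist_le (a1 a2 a3 a4 a5 a6 d r e : R) :
  `|a1 - a2| <= d -> `|a2 - a3| <= e / 16 + r -> `|a3 - a4| <= e / 4 ->
  `|a5 - a4| <= e / 16 + r -> `|a6 - a5| <= d -> r <= e / 16 -> d <= e / 4 ->
  `|a1 - a6| <= e.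
Proof.
rewrite !ler_norml => /andP[? ?] /andP[? ?] /andP[? ?] /andP[? ?] /andP[? ?] ? ?.
by apply/andP; split; lra.
Qed.

Lemma cvg_ord_sum (T : Type) (F : set_system T) (FF : Filter F) n
    (f : nat -> T -> R) (l : nat -> R) :
  (forall k, (k < n)%N -> f k x @[x --> F] --> l k) ->
  \sum_(k < n) f k x @[x --> F] --> \sum_(k < n) l k.
Proof.
elim: n => [_|n ih h].
  by rewrite big_ord0; under eq_fun do rewrite big_ord0; exact: cvg_cst.
rewrite big_ord_recr; under eq_fun do rewrite big_ord_recr.
by apply: cvgD; [apply: ih => k kn; apply: h; exact: ltnW|exact: h].
Qed.

(** Compactness provides a cluster point, and a cluster point of an ultrafilter is a limit. *)
Lemma ultra_cvg_itv (U : set_system nat) (UU : UltraFilter U) (u : nat -> R) (A : R) :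
  (\forall n \near U, - A <= u n <= A) -> cvg (u n @[n --> U]).
Proof.
move=> uA; have PF : ProperFilter (u @ U) by exact: fmap_proper_filter.
have [|l [_ lcl]] := @segment_compact R (- A) A (u @ U) PF.
  by apply: filterS uA => n h; rewrite /= in_itv.
apply/cvg_ex; exists l => B lB.
have [//|UB] := in_ultra_setVsetC (u @^-1` B) UU.
by have [x [? ?]] := lcl (~` B) B UB lB.
Qed.

Variables (U : set_system nat) (UU : UltraFilter U).
Variable Y : nat -> nat -> R.
Hypothesis U_gt0 : \forall N \near U, (0 < N)%N.
Hypothesis Y_noninc : forall N k l, (k <= l)%N -> (l < N)%N -> Y N l <= Y N k.
Hypothesis Y_tight : forall eta : R, 0 < eta -> exists A : R, \forall N \near U,
  N%:R^-1 * \sum_(i < N) (A <= `|Y N i|)%R%:R <= eta.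

(** Quantile function of the empirical measure in decreasing order: on [[0, 1[] it is the
    nonincreasing step function through the ordered particles. *)
Let qN N (u : R) := Y N (Num.truncn (N%:R * u)).

Let qN_noninc N u v : (0 < N)%N -> 0 <= u -> u <= v -> v < 1 -> qN N v <= qN N u.
Proof.
move=> N0 u0 uv v1; apply: Y_noninc.
  by apply: le_truncn; rewrite ler_wpM2l.
by apply: truncn_mul_lt; rewrite // v1 (le_trans u0).
Qed.

(** If [qN N u] exceeded A, so would all values on [[0, u[], a set of mass u; if it were below - A,
    so would all values on [[u, 1[]. Both masses exceed eta, against tightness. *)
Let qN_bounded (u : R) : 0 < u < 1 -> exists A, \forall N \near U, - A <= qN N u <= A.
Proof.
move=> /andP[u0 u1]; pose eta := Num.min u (1 - u) / 2.
have m0 : 0 < Num.min u (1 - u) by rewrite lt_min u0 subr_gt0.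
have eta0 : 0 < eta by rewrite divr_gt0.
have etau : eta < u.
  have h : Num.min u (1 - u) <= u by rewrite ge_min lexx.
  by rewrite /eta; lra.
have eta1u : eta < 1 - u.
  have h : Num.min u (1 - u) <= 1 - u by rewrite ge_min lexx orbT.
  by rewrite /eta; lra.
have [A hA] := Y_tight eta0; exists A; near=> N.
have N0 : (0 < N)%N by near: N.
have hN : N%:R^-1 * \sum_(i < N) (A <= `|Y N i|)%R%:R <= eta by near: N.
have bs : bdm (fun u => ((fun k => (A <= `|Y N k|)%R%:R) (Num.truncn (N%:R * u)) : R)).
  apply: (@bdm_step _ N (fun k => (A <= `|Y N k|)%R%:R) 1) => k.
  by case: (A <= _); rewrite ?normr1 ?normr0.
have Es := @unif01_step _ N (fun k => (A <= `|Y N k|)%R%:R) N0 bs.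
rewrite /= in Es; rewrite -Es in hN.
have lowI (a b : R) : 0 <= a -> a <= b -> b <= 1 ->
    (forall v, a <= v < b -> A <= `|qN N v|) -> b - a <= eta.
  move=> a0 ab b1 h; apply: le_trans hN.
  have mI : measurable (`[a, b[%classic : set R) by exact: measurable_itv.
  have -> : b - a = \int[unif01]_v (\1_(`[a, b[%classic) v : R).
    rewrite integral_indic_bdm//; apply: esym.
    exact: (congr1 fine (unif01_itv a0 ab b1)).
  apply: bdm_integral_le => //; first exact: bdm_indic.
  move=> v; rewrite indicE; have [|_] := boolP (v \in _); last by case: (A <= _).
  by rewrite inE/= in_itv/= => /h; rewrite /qN => ->.
apply/andP; split; rewrite leNgt; apply/negP => hq.
- suff : 1 - u <= eta by rewrite leNgt eta1u.
  apply: (lowI u 1 (ltW u0) (ltW u1) (lexx _)) => v /andP[uv v1].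
  rewrite -normrN (le_trans _ (ler_norm _))// lerNr (le_trans _ (ltW hq))//.
  by apply: qN_noninc => //; exact: ltW.
- suff : u - 0 <= eta by rewrite subr0 leNgt etau.
  apply: (lowI 0 u (lexx _) (ltW u0) (ltW u1)) => v /andP[v0 vu].
  rewrite (le_trans _ (ler_norm _))// (le_trans (ltW hq))//.
  by apply: qN_noninc => //; exact: ltW.
Unshelve. all: end_near. Qed.

Let q u : R := lim (qN N u @[N --> U]).

Let cvg_q u : 0 < u < 1 -> qN N u @[N --> U] --> q u.
Proof. by move=> /qN_bounded[A]; exact: ultra_cvg_itv. Qed.

Let q_noninc u v : 0 < u -> u <= v -> v < 1 -> q v <= q u.
Proof.
move=> u0 uv v1; apply: (ler_cvg_to (cvg_q _) (cvg_q _)).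
- by rewrite (lt_le_trans u0)// uv.
- by rewrite u0 (le_lt_trans uv).
- by apply: filterS U_gt0 => N N0; apply: qN_noninc => //; exact: ltW.
Qed.

(** At and beyond the end points the limit defining [q] need not exist; the restriction replaces it
    there, which costs no mass. *)
Let X : R -> R := q \_ `]0, 1[.

Let XE u : 0 < u < 1 -> X u = q u.
Proof. by move=> u01; rewrite /X patchE mem_set//= in_itv. Qed.

Let measurable_X : measurable_fun setT X.
Proof.
have mD : measurable (`]0, 1[%classic : set R) by exact: measurable_itv.
apply: (measurable_restrictT q mD).1.
apply: (measurability (@RGenCInfty.G R)) => [|/= _ [_] [r] -> <-].
  exact: RGenCInfty.measurableE.
apply: is_interval_measurable => s t /=.
rewrite !in_itv/= !andbT => -[/andP[s0 s1] rs] [/andP[t0 t1] rt] w /andP[sw wt].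
have w0 := lt_le_trans s0 sw; have w1 := le_lt_trans wt t1.
by split; [rewrite in_itv/= w0 w1|rewrite in_itv/= andbT (le_trans rt)// q_noninc].
Qed.

Let X_mfun : {mfun R >-> R} :=
  MeasurableFun.Pack (MeasurableFun.Class (isMeasurableFun.Build _ _ _ _ _ measurable_X)).

(** The limit is the law of [X] under the uniform measure. Away from the ends of []0, 1[], [X] and
    [qN N] are bounded by a common A, so a common number of cells serves both Riemann sums, and
    these are compared at finitely many nodes, where [qN N] converges along U. *)
Lemma ultra_weak_limit : exists m : probability R R, forall f : R -> R, continuous f ->
  (exists M, forall x, `|f x| <= M) ->
  N%:R^-1 * (\sum_(i < N) f (Y N i)) @[N --> U] --> \int[m]_x f x.
Proof.
exists (distribution unif01 X_mfun) => f cf [M fM].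
have -> : \int[distribution unif01 X_mfun]_x f x = \int[unif01]_u f (X u).
  rewrite /Rintegral integral_distribution//=.
    by apply/measurable_EFinP; exact: continuous_measurable_fun.
  apply: (@bdm_integrable _ unif01 (fun u => f (X u))).
  exact: bdm_continuous_comp cf fM measurable_X.
have M0 : 0 <= M by rewrite (le_trans (normr_ge0 _) (fM 0)).
have PU : ProperFilter U := ultra_proper.
apply/cvgrPdist_le => e e0.
pose eta := Num.min (1 / 2) (e / (16 * (M + 1))).
have eta0 : 0 < eta by rewrite lt_min !divr_gt0// mulr_gt0// ltr_wpDl.
have eta2 : eta <= 1 / 2 by rewrite ge_min lexx.
have Meta : 4 * M * eta <= e / 4.
  have h : eta <= e / (16 * (M + 1)) by rewrite ge_min lexx orbT.
  rewrite (le_trans (ler_wpM2l _ h)) ?mulr_ge0//.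
  have M1 : 0 < 16 * (M + 1) by rewrite mulr_gt0// ltr_wpDl.
  by rewrite mulrA ler_pdivrMr//; nra.
have eta01 : 0 < eta < 1 by lra.
have eta10 : 0 < 1 - eta < 1 by lra.
(* The margin 1 leaves room for [qN N] at eta and at 1 - eta once it is close to [q]; monotonicity
   extends the bound to all points in between. *)
pose A := Num.max `|q eta| `|q (1 - eta)| + 1.
have A0 : 0 <= A by rewrite addr_ge0// le_max normr_ge0.
have Aq1 : `|q eta| + 1 <= A by rewrite lerD2r le_max lexx.
have Aq2 : `|q (1 - eta)| + 1 <= A by rewrite lerD2r le_max lexx orbT.
have e16 : 0 < e / 16 by rewrite divr_gt0.
have [C C0 fC] := continuous_modulus A cf e16.
(* K is fixed before N: the error bound involves A and the modulus of f only. *)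
pose K := (Num.truncn (C * (2 * A) / (e / 16))).+1.
have K0 : (0 < K)%N by [].
have CK : C * (2 * A) / K%:R <= e / 16.
  have : C * (2 * A) / (e / 16) <= K%:R by rewrite ltW// /K Num.Theory.truncnS_gt.
  by rewrite !ler_pdivrMr ?ltr0n// [K%:R * _]mulrC.
pose S (p : R -> R) := K%:R^-1 * \sum_(k < K) f (node p A K k).
have KI (k : nat) : (k < K)%N -> k != 0%N -> 0 < (k%:R / K%:R : R) < 1.
  move=> kK k0; rewrite divr_gt0 ?ltr0n ?lt0n//=.
  by rewrite ltr_pdivrMr ?ltr0n// mul1r ltr_nat.
have cvgS : S (qN N) @[N --> U] --> S X.
  apply: cvgM; first exact: cvg_cst.
  apply: (@cvg_ord_sum _ _ _ K (fun k N => f (node (qN N) A K k))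
    (fun k => f (node X A K k))) => k kK; apply: (cvg_comp _ f); last exact: cf.
  rewrite /node; case: eqP => [_|/eqP k0]; first exact: cvg_cst.
  rewrite ltn_eqF//; apply: (cvg_comp _ (clip A)); last exact: continuous_clip.
  by rewrite XE ?KI//; apply: cvg_q; exact: KI.
near=> N.
have N0 : (0 < N)%N by near: N.
have qN1 : `|q eta - qN N eta| <= 1.
  by near: N; have /cvgrPdist_le := cvg_q eta01; apply.
have qN2 : `|q (1 - eta) - qN N (1 - eta)| <= 1.
  by near: N; have /cvgrPdist_le := cvg_q eta10; apply.
have SN : `|S X - S (qN N)| <= e / 4.
  by near: N; move/cvgrPdist_le : cvgS; apply; rewrite divr_gt0.
have mqN : measurable_fun setT (qN N) by exact: measurable_step.
have XA u : eta <= u < 1 - eta -> - A <= X u <= A.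
  move=> /andP[u1 u2].
  have [u0 u1' eta1] : [/\ 0 < u, u < 1 & 1 - eta < 1] by exact: itv_interior.
  rewrite XE ?u0//; have h1 : q u <= q eta by exact: q_noninc.
  have h2 : q (1 - eta) <= q u by apply: q_noninc => //; exact: ltW.
  by apply: (sandwich_itv Aq1 Aq2 _ _ h2 h1); rewrite subrr normr0.
have qNA u : eta <= u < 1 - eta -> - A <= qN N u <= A.
  move=> /andP[u1 u2].
  have [u0 u1' eta1] : [/\ 0 < u, u < 1 & 1 - eta < 1] by exact: itv_interior.
  have h1 : qN N u <= qN N eta by apply: qN_noninc => //; exact: ltW.
  have h2 : qN N (1 - eta) <= qN N u by apply: qN_noninc => //; exact: ltW.
  exact: sandwich_itv Aq1 Aq2 qN1 qN2 h2 h1.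
have H1 := integral_clip_le eta0 eta2 cf fM measurable_X XA.
have H2 := integral_clip_le eta0 eta2 cf fM mqN qNA.
have X_ni u v : 0 < u -> u <= v -> v < 1 -> X v <= X u.
  by move=> u0 uv v1; rewrite !XE ?u0 ?(lt_le_trans u0 uv) ?(le_lt_trans uv)//; exact: q_noninc.
have qN_ni u v : 0 < u -> u <= v -> v < 1 -> qN N v <= qN N u.
  by move=> u0 uv v1; apply: qN_noninc => //; exact: ltW.
have H3 := riemann_sum_le A0 K0 C0 measurable_X X_ni cf fM fC.
have H4 := riemann_sum_le A0 K0 C0 mqN qN_ni cf fM fC.
have -> : N%:R^-1 * (\sum_(i < N) f (Y N i)) = \int[unif01]_u f (qN N u).
  apply: esym; apply: (@unif01_step _ N (fun k => f (Y N k))) => //.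
  by apply: (@bdm_step _ N (fun k => f (Y N k)) M).
exact: five_dist_le H1 H3 SN H4 H2 CK Meta.
Unshelve. all: end_near. Qed.

End ultrafilter_compactness.

(** * The reciprocal Cauchy transform of a compactly supported measure *)

Section compact_support.
Context {R : realType}.
Variables (m : probability R R) (k : R).
Hypothesis k0 : 0 < k.
Hypothesis m_supp : m (~` `[- k, k]%classic) = 0%E.

Lemma bdm_integral_clip (f : R -> R) : bdm f ->
  \int[m]_x f x = \int[m]_x f (clip k x).
Proof.
move=> bf; have bfc := bdm_comp (measurable_clip k) bf.
congr fine; apply: ae_eq_integral => //.
- by apply/measurable_EFinP; have [] := bf.
- by apply/measurable_EFinP; have [] := bfc.
- exists (~` `[- k, k]%classic); split => //.
    by apply: measurableC; exact: measurable_itv.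
  by move=> x /=; apply: contra_not => h _; rewrite clip_id.
Qed.

Lemma cint_clip (g : R -> R[i]) : cbdm g -> cint m g = cint m (fun x => g (clip k x)).
Proof.
by move=> [bR bI]; apply: complex_ext; rewrite /=;
  [rewrite (bdm_integral_clip bR)|rewrite (bdm_integral_clip bI)].
Qed.

(** Clipping the variable leaves the integrals unchanged and makes the bound [|w - x| >= |w| - k]
    hold at every point instead of almost everywhere. *)
Let e (w : R[i]) (x : R) : R[i] := (w - (clip k x)%:C)^-1.
Let c (x : R) : R[i] := (clip k x)%:C.

Let cbdm_e w : complex.Im w != 0 -> cbdm (e w).
Proof. by move=> w0; exact: (cbdm_comp (measurable_clip k) (cbdm_resolvent w0)). Qed.

Let cbdm_c : cbdm c.
Proof.
apply: cbdm_real; split; [exact: measurable_clip|exists k => x].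
by rewrite ler_norml clip_itv// ltW.
Qed.

Let cmod_c x : cmod (c x) <= k.
Proof. by rewrite cmod_real ler_norml clip_itv// ltW. Qed.

(** The factor 1000 is generous: it yields [|P w| <= 1/2] and brings the Lipschitz constant
    [128 k / (|w| - k)] of [w - F(w)] below [1/4]. *)
Definition far w := 0 < complex.Im w /\ 1000 * k <= cmod w.

Let far_neq0 w : far w -> complex.Im w != 0.
Proof. by move=> [w0 _]; rewrite gt_eqF. Qed.

Let r w := cmod w - k.

Let r_ge w : far w -> 999 * k <= r w.
Proof. by move=> [_ h]; rewrite /r; lra. Qed.

Let r_gt0 w : far w -> 0 < r w.
Proof. by move=> fw; have := r_ge fw; have := k0; lra. Qed.

Let cmod_le_r w : far w -> cmod w <= 2 * r w.
Proof. by have kp := k0; move=> [_ h]; rewrite /r; lra. Qed.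

Let e_le w x : far w -> cmod (e w x) <= (r w)^-1.
Proof.
move=> fw; have rw := r_gt0 fw.
have h : r w <= cmod (w - c x).
  by rewrite (le_trans _ (cmod_tri _ _))// /r lerD2l lerN2 cmod_c.
by rewrite cmodV lef_pV2// posrE// (lt_le_trans rw).
Qed.

Let G w := cauchy_transform m w.
(** The deviation of [w G(w)] from its limit 1 at infinity. As [w / (w - x) - 1 = x / (w - x)], it
    is the integral of [x / (w - x)], hence of order [k / |w|]. *)
Let P w := w * G w - 1.

Let GE w : far w -> G w = cint m (e w).
Proof. by move=> fw; exact: (cint_clip (cbdm_resolvent (far_neq0 fw))). Qed.

Let ec w x : far w -> w * e w x - 1 = c x * e w x.
Proof.
move=> fw; have h := sub_real_neq0 (clip k x) (far_neq0 fw).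
by rewrite /e /c; field.
Qed.

Let PE w : far w -> P w = cint m (fun x => c x * e w x).
Proof.
move=> fw; have b := cbdm_e (far_neq0 fw).
rewrite /P (GE fw) -cintZ// -[X in _ - X](cint_cst m 1) -cintB.
- by apply: eq_cint => x; rewrite ec.
- by apply: cbdmM => //; exact: cbdm_cst.
- exact: cbdm_cst.
Qed.

Let G_le w : far w -> cmod (G w) <= 2 / r w.
Proof.
move=> fw; rewrite (GE fw) cmod_cint_le//; first exact/cbdm_e/far_neq0.
by move=> x; exact: e_le.
Qed.

Let P_le w : far w -> cmod (P w) <= 2 * (k / r w).
Proof.
move=> fw; rewrite (PE fw) cmod_cint_le//.
  by apply: cbdmM; [exact: cbdm_c|exact/cbdm_e/far_neq0].
by move=> x; rewrite cmodM ler_pM ?cmod_ge0// e_le.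
Qed.

Let GB w w' : far w -> far w' ->
  cmod (G w - G w') <= 2 / (r w * r w') * cmod (w - w').
Proof.
move=> fw fw'; have b := cbdm_e (far_neq0 fw); have b' := cbdm_e (far_neq0 fw').
have -> : G w - G w' = (w' - w) * cint m (fun x => e w x * e w' x).
  rewrite (GE fw) (GE fw') -cintB// -cintZ; last exact: cbdmM.
  apply: eq_cint => x; have := sub_real_neq0 (clip k x) (far_neq0 fw).
  have := sub_real_neq0 (clip k x) (far_neq0 fw').
  by move=> h h'; rewrite /e; field; rewrite h h'.
rewrite cmodM cmod_distC mulrC ler_wpM2r ?cmod_ge0// invfM.
apply: cmod_cint_le; first exact: cbdmM.
by move=> x; rewrite cmodM ler_pM ?cmod_ge0// e_le.
Qed.

Let PB w w' : far w -> far w' ->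
  cmod (P w - P w') <= 2 * (k / (r w * r w')) * cmod (w - w').
Proof.
move=> fw fw'; have b := cbdm_e (far_neq0 fw); have b' := cbdm_e (far_neq0 fw').
have -> : P w - P w' = (w' - w) * cint m (fun x => c x * (e w x * e w' x)).
  rewrite (PE fw) (PE fw') -cintB; [|exact: cbdmM|exact: cbdmM].
  rewrite -cintZ; last by apply: cbdmM => //; exact: cbdmM.
  apply: eq_cint => x; have := sub_real_neq0 (clip k x) (far_neq0 fw).
  have := sub_real_neq0 (clip k x) (far_neq0 fw').
  by move=> h h'; rewrite /e; field; rewrite h h'.
rewrite cmodM cmod_distC mulrC ler_wpM2r ?cmod_ge0// invfM.
apply: cmod_cint_le; first by apply: cbdmM => //; exact: cbdmM.
by move=> x; rewrite !cmodM ler_pM ?mulr_ge0 ?cmod_ge0// ler_pM ?cmod_ge0// e_le.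
Qed.

Let G_ge w : far w -> 1 <= 2 * cmod w * cmod (G w).
Proof.
have kp := k0; move=> fw; have h := P_le fw; have rw := r_ge fw; have r0 := r_gt0 fw.
have : 2 * (k / r w) <= 1 / 2.
  by rewrite mulrA ler_pdivrMr//; lra.
have : 1 - cmod (P w) <= cmod (w * G w).
  have -> : w * G w = 1 - (- P w) by rewrite /P opprK addrC subrK.
  by rewrite (le_trans _ (cmod_tri _ _))// cmod1 cmodN.
by rewrite -mulrA -cmodM; lra.
Qed.

Let cauchy_transform_far_neq0 w : far w -> G w != 0.
Proof.
move=> fw; have := G_ge fw; apply: contraTneq => ->.
by rewrite cmod0 mulr0 -ltNge.
Qed.

(** Since [K = P / G], with P and G both of order [1 / |w|], it is bounded far out. Thus F is the
    identity minus a bounded contraction, which gives both its injectivity and its surjectivity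
    there. *)
Let K w := w - reciprocal_cauchy m w.

Let KE w : far w -> K w = P w / G w.
Proof.
move=> fw; have g0 := cauchy_transform_far_neq0 fw.
by rewrite /K /P /reciprocal_cauchy -/(G w); field.
Qed.

Let GV_le w : far w -> cmod (G w)^-1 <= 2 * cmod w.
Proof.
move=> fw; have g0 := cauchy_transform_far_neq0 fw.
by rewrite cmodV -[leLHS]mul1r ler_pdivrMr ?cmod_gt0// G_ge.
Qed.

(** The constant is the product of [|P| <= 2 k / r] and [|1 / G| <= 2 |w| <= 4 r]. *)
Lemma cmod_sub_reciprocal_le w : far w -> cmod (w - reciprocal_cauchy m w) <= 8 * k.
Proof.
have kp := k0; move=> fw; rewrite -/(K w) (KE fw) cmodM.
have r0 := r_gt0 fw.
rewrite (le_trans (ler_pM (cmod_ge0 _) (cmod_ge0 _) (P_le fw) (GV_le fw)))//.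
have := cmod_le_r fw => h.
rewrite (@le_trans _ _ (2 * (k / r w) * (2 * (2 * r w))))//.
  by rewrite !ler_wpM2l// mulr_ge0// divr_ge0// ltW.
by rewrite -!mulrA [_^-1 * _]mulrC !mulrA mulfK ?gt_eqF//; lra.
Qed.

(** Over the common denominator [G w * G w'] the numerator is at most [8 k d / (r r'^2)], and the
    inverse of the denominator is at most [16 r r']. *)
Lemma sub_reciprocal_lipschitz w w' : far w -> far w' ->
  cmod ((w - reciprocal_cauchy m w) - (w' - reciprocal_cauchy m w')) <=
  1 / 4 * cmod (w - w').
Proof.
have kp := k0; move=> fw fw'; rewrite -/(K w) -/(K w') (KE fw) (KE fw').
have g0 := cauchy_transform_far_neq0 fw; have g0' := cauchy_transform_far_neq0 fw'.
have r0 := r_gt0 fw; have r0' := r_gt0 fw'.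
have -> : P w / G w - P w' / G w' =
    ((P w - P w') * G w' - P w' * (G w - G w')) * ((G w)^-1 * (G w')^-1).
  by field; rewrite g0 g0'.
set d := cmod (w - w'); have d0 : 0 <= d := cmod_ge0 _.
rewrite cmodM.
have h1 : cmod ((P w - P w') * G w' - P w' * (G w - G w')) <=
    8 * k * d / (r w * r w' * r w').
  rewrite (le_trans (cmodB _ _))// !cmodM.
  rewrite (le_trans (lerD (ler_pM (cmod_ge0 _) (cmod_ge0 _) (PB fw fw') (G_le fw'))
    (ler_pM (cmod_ge0 _) (cmod_ge0 _) (P_le fw') (GB fw fw'))))// -/d.
  rewrite le_eqVlt; apply/orP; left; apply/eqP.
  by field; rewrite !gt_eqF.
have h2 : cmod ((G w)^-1 * (G w')^-1) <= 16 * (r w * r w').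
  rewrite cmodM (le_trans (ler_pM (cmod_ge0 _) (cmod_ge0 _) (GV_le fw) (GV_le fw')))//.
  rewrite (le_trans (ler_pM _ _ (ler_wpM2l _ (cmod_le_r fw)) (ler_wpM2l _ (cmod_le_r fw'))))//.
  - by rewrite mulr_ge0 ?cmod_ge0.
  - by rewrite mulr_ge0 ?cmod_ge0.
  - by rewrite le_eqVlt; apply/orP; left; apply/eqP; ring.
rewrite (le_trans (ler_pM (cmod_ge0 _) (cmod_ge0 _) h1 h2))//.
have -> : 8 * k * d / (r w * r w' * r w') * (16 * (r w * r w')) = 128 * k * d / r w'.
  by field; rewrite !gt_eqF.
rewrite ler_pdivrMr//; have := r_ge fw'.
move: (r w') => rr h; have := ler_wpM2r d0 h; have := mulr_ge0 (ltW k0) d0.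
by nra.
Qed.

Lemma reciprocal_cauchy_injective w w' : far w -> far w' ->
  reciprocal_cauchy m w = reciprocal_cauchy m w' -> w = w'.
Proof.
move=> fw fw' E; have := sub_reciprocal_lipschitz fw fw'.
rewrite E opprB addrA subrK => h; apply/eqP; rewrite -subr_eq0 -cmod_eq0.
by rewrite eq_le cmod_ge0 andbT; have := cmod_ge0 (w - w'); lra.
Qed.

(** Fixed point iteration for [w = z + K w], started at z. The iterates stay within 8 k of z and the
    limit within 9 k, one k being slack; [1009 k] leaves the whole disc of radius 9 k in the region
    [far]. *)
Lemma reciprocal_cauchy_surjective z : 9 * k < complex.Im z -> 1009 * k <= cmod z ->
  exists w, cmod (w - z) <= 9 * k /\ reciprocal_cauchy m w = z.
Proof.
have kp := k0; move=> zI zk.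
have near_far w : cmod (w - z) <= 9 * k -> far w.
  move=> wz; split.
    have := le_trans (ler_norm _) (le_trans (Im_le_cmod (z - w)) _).
    rewrite cImD cImN => /(_ (9 * k)); rewrite cmod_distC => /(_ wz); lra.
  by have := cmod_tri z (z - w); rewrite subKr [cmod (z - w)]cmod_distC; lra.
pose wn := fix f n := if n is n'.+1 then z + K (f n') else z.
have wn8 n : cmod (wn n - z) <= 8 * k.
  elim: n => [|n ih]; first by rewrite subrr cmod0 mulr_ge0// ltW.
  rewrite /= addrAC subrr add0r; apply: cmod_sub_reciprocal_le; apply: near_far.
  by rewrite (le_trans ih)// ler_wpM2r ?ltW//; lra.
have wnf n : far (wn n).
  by apply: near_far; rewrite (le_trans (wn8 n))// ler_wpM2r ?ltW//; lra.
have wnB n : cmod (wn n.+1 - wn n) <= 8 * k * (1 / 4) ^+ n.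
  elim: n => [|n ih]; first by rewrite expr0 mulr1; exact: wn8.
  rewrite /= opprD addrACA subrr add0r.
  rewrite (le_trans (sub_reciprocal_lipschitz (wnf n.+1) (wnf n)))//.
  by rewrite exprS mulrCA ler_wpM2l.
(* Boundedness already gives a limit along an ultrafilter; the contraction estimate is needed only
   to see that this limit solves the equation. *)
have [U [UU sU]] := @ultraFilterLemma _ \oo _.
have PU : ProperFilter U := ultra_proper.
have cR : cvg (complex.Re (wn n) @[n --> U]).
  apply: (@ultra_cvg_itv _ U UU _ (cmod z + 8 * k)); apply: nearW => n.
  rewrite -ler_norml (le_trans (Re_le_cmod _))//.
  by have := cmod_tri (wn n) z; have := wn8 n; lra.
have cI : cvg (complex.Im (wn n) @[n --> U]).
  apply: (@ultra_cvg_itv _ U UU _ (cmod z + 8 * k)); apply: nearW => n.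
  rewrite -ler_norml (le_trans (Im_le_cmod _))//.
  by have := cmod_tri (wn n) z; have := wn8 n; lra.
pose w := lim (complex.Re (wn n) @[n --> U]) +i* lim (complex.Im (wn n) @[n --> U]).
have wnw (d : R) : 0 < d -> \forall n \near U, cmod (w - wn n) <= d.
  move=> d0; have d2 : 0 < d / 2 by rewrite divr_gt0.
  move/cvgrPdist_le : cR => /(_ _ d2) hR; move/cvgrPdist_le : cI => /(_ _ d2) hI.
  near=> n; rewrite (le_trans (cmod_le_ReIm _))// cReD cReN cImD cImN [leRHS]splitr.
  by rewrite lerD//; near: n.
have wz : cmod (w - z) <= 9 * k.
  have [n h] := filter_ex (wnw k k0).
  have -> : w - z = (w - wn n) + (wn n - z) by rewrite addrA subrK.
  by rewrite (le_trans (cmodD _ _))//; have := wn8 n; lra.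
exists w; split => //; apply/eqP; rewrite -subr_eq0 -cmod_eq0 eq_le cmod_ge0 andbT.
apply/ler_addgt0Pr => d d0; rewrite add0r.
have d3 : 0 < d / 3 by rewrite divr_gt0.
have hB : \forall n \near U, 8 * k * (1 / 4) ^+ n <= d / 3.
  apply: sU; have : 8 * k * (1 / 4) ^+ n @[n --> \oo] --> (0 : R).
    rewrite -(mulr0 (8 * k)); apply: cvgM; first exact: cvg_cst.
    by apply: cvg_expr; rewrite ger0_norm; lra.
  move/cvgrPdist_le => /(_ _ d3); apply: filterS => n.
  by rewrite sub0r normrN; apply: le_trans; exact: ler_norm.
have [n [h1 h2]] := filter_ex (filterI (wnw _ d3) hB).
have L := sub_reciprocal_lipschitz (near_far _ wz) (wnf n).
(* Uses [K (wn n) = wn n.+1 - z]; each of the three differences tends to 0 along U. *)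
have -> : reciprocal_cauchy m w - z =
    (w - wn n) - (wn n.+1 - wn n) - (K w - K (wn n)).
  by rewrite /= /K; ring.
rewrite (le_trans (cmodB _ _))// (le_trans (lerD (cmodB _ _) (lexx _)))//.
by have := wnB n; have := cmod_ge0 (w - wn n); move: L; rewrite -/(K w) -/(K (wn n)); lra.
Unshelve. all: end_near. Qed.

End compact_support.

(** * The Cauchy transform of the semicircle law *)

Section density.
Context {R : realType}.
Notation lambda := (@lebesgue_measure R).

(** The identity carries [m] to [measurableTypeR R], where it can be compared with Lebesgue
    measure. *)
Let measurable_toR : measurable_fun setT (idfun : R -> measurableTypeR R).
Proof. by move=> _ Y mY; rewrite setTI. Qed.

Let toR : {mfun R >-> measurableTypeR R} :=
  MeasurableFun.Pack (MeasurableFun.Class (isMeasurableFun.Build _ _ _ _ _ measurable_toR)).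

(** Both [pdf] and the Radon-Nikodym derivative have the same integral over every measurable set,
    hence they coincide almost everywhere. *)
Lemma integral_density (m : probability R R) (pdf : R -> R) :
  measurable_fun setT (pdf : measurableTypeR R -> R) -> (forall x, 0 <= pdf x) ->
  (forall A : set R, measurable A -> m A = \int[lambda]_(x in A) (pdf x)%:E)%E ->
  forall f : R -> R, bdm f ->
  \int[m]_x f x = \int[lambda]_x (f x * pdf x).
Proof.
move=> mpdf pdf0 mE f bf.
pose nu : probability (measurableTypeR R) R := distribution m toR.
have nuE A : measurable A -> nu A = (\int[lambda]_(x in A) (pdf x)%:E)%E by exact: mE.
have mf : measurable_fun setT (f : measurableTypeR R -> R) by have [h _] := bf.
have numu : nu `<< lambda.
  apply/null_content_dominatesP => A mA A0; rewrite nuE//.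
  apply: null_set_integral => //; apply/measurable_EFinP; exact: measurable_funTS.
have fint : m.-integrable setT (EFin \o f) := bdm_integrable m bf.
have fint' : nu.-integrable setT (EFin \o f).
  apply/integrableP; split; first exact/measurable_EFinP.
  have /integrableP[_] := fint.
  rewrite (@ge0_integral_distribution _ _ _ _ _ m toR (fun x => `|(EFin \o f) x|)%E)//.
  by apply: measurableT_comp => //; exact/measurable_EFinP.
have pdf_int : lambda.-integrable setT (EFin \o pdf).
  apply/integrableP; split; first exact/measurable_EFinP.
  under eq_integral do rewrite /= ger0_norm//.
  rewrite -(nuE setT)//.
  by rewrite (@le_lt_trans _ _ 1%E) ?ltry// probability_le1.
congr fine.
transitivity (\int[nu]_x (f x)%:E)%E.
  rewrite (@integral_distribution _ _ _ _ _ m toR (EFin \o f))//.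
  exact/measurable_EFinP.
rewrite -(Radon_Nikodym_change_of_variables numu)//=.
apply: ae_eq_integral => //.
- apply: emeasurable_funM; first exact/measurable_EFinP.
  by apply: measurable_int; exact: Radon_Nikodym_integrable.
- by apply/measurable_EFinP; exact: measurable_funM.
- under [X in ae_eq _ _ _ X]eq_fun do rewrite EFinM.
  apply: ae_eqe_mul2l; apply: integral_ae_eq => //.
  + exact: Radon_Nikodym_integrable.
  + exact/measurable_EFinP.
  + by move=> A _ mA; rewrite -Radon_Nikodym_integral//= nuE.
Qed.

End density.

Section complex_integral_sum.
Context {R : realType}.

Lemma cbdm_sum n (F : nat -> R -> R[i]) : (forall k, cbdm (F k)) ->
  cbdm (fun x => \sum_(k < n) F k x).
Proof.
move=> bF; elim: n => [|n ih].
  by under eq_fun do rewrite big_ord0; exact: cbdm_cst.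
by under eq_fun do rewrite big_ord_recr/=; exact: cbdmD.
Qed.

Lemma cint_sum (m : probability R R) n (F : nat -> R -> R[i]) :
  (forall k, cbdm (F k)) ->
  cint m (fun x => \sum_(k < n) F k x) = \sum_(k < n) cint m (F k).
Proof.
move=> bF; elim: n => [|n ih].
  by under eq_cint do rewrite big_ord0; rewrite cint_cst big_ord0.
under eq_cint do rewrite big_ord_recr/=.
by rewrite cintD//; [rewrite ih big_ord_recr|exact: cbdm_sum].
Qed.

End complex_integral_sum.

Section semicircle_cauchy_transform.
Context {R : realType}.
Notation lambda := (@lebesgue_measure R).

Lemma unif01_integralE (f : R -> R) : bdm f ->
  \int[unif01]_u f u = \int[lambda]_(u in `[0, 1]) f u.
Proof.
move=> bf.
rewrite (@integral_density _ unif01 (uniform_pdf 0 1))//; last first.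
- by move=> x; exact: uniform_pdf_ge0.
- exact: measurable_uniform_pdf.
rewrite [RHS]Rintegral_mkcond; apply: eq_Rintegral => x _.
rewrite patchE /uniform_pdf subr0 invr1 mem_setE in_itv/=.
by case: ifP => _; rewrite ?mulr1 ?mulr0.
Qed.

(** Substitution [x = - r cos (pi u)], the sign making it increasing; the density and the Jacobian
    combine to [2 sin^2 (pi u)], free of r. *)
Lemma semicircle_integral (r M : R) (f : R -> R) : 0 < r -> continuous f ->
  (forall x, `|f x| <= M) ->
  \int[semicircle r]_x f x =
  \int[unif01]_u (f (- (r * cos (pi * u))) * (2 * sin (pi * u) ^+ 2)).
Proof.
move=> r0 cf fM; have bf := bdm_continuous cf fM.
have pi0 : 0 < @pi R := pi_gt0 _.
have pi_neq0 : @pi R != 0 by rewrite gt_eqF.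
pose F (u : R) := - (r * cos (pi * u)).
have dF (u : R) : is_derive u (1 : R) F (r * pi * sin (pi * u)).
  rewrite /F.
  have dl : is_derive u (1 : R) (fun u : R => pi * u) pi.
    by apply: is_derive_eq; rewrite /GRing.scale/= mulr1.
  have dc := is_derive1_comp (is_derive_cos (pi * u)) dl.
  apply: (is_derive_eq (is_deriveN (is_deriveZ r dc))).
  by rewrite /GRing.scale/=; ring.
have F'E : F^`()%classic = fun u => r * pi * sin (pi * u).
  by apply/funext => u; rewrite derive1E; exact: derive_val.
have cF : continuous F.
  by move=> u; apply/differentiable_continuous/derivable1_diffP/ex_derive.
have csin : continuous (fun u : R => sin (pi * u)).
  move=> u; apply: (cvg_comp _ sin); last exact: continuous_sin.
  by apply: cvgM; [exact: cvg_cst|exact: cvg_id].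
have cF' : continuous (fun u : R => r * pi * sin (pi * u)).
  by move=> u; apply: cvgM; [exact: cvg_cst|exact: csin].
have F0 : F 0 = - r by rewrite /F mulr0 cos0 mulr1.
have F1 : F 1 = r by rewrite /F mulr1 cospi mulrN1 opprK.
have bG : bdm (fun u => f (F u) * (2 * sin (pi * u) ^+ 2)).
  apply: bdmM; first exact: (bdm_continuous_comp cf fM (continuous_measurable_fun cF)).
  apply: bdmM; first exact: bdm_cst.
  apply: (@bdm_continuous _ _ 1) => [u|u].
    apply: (cvg_comp _ (fun v => v ^+ 2)); [exact: csin|exact: exprn_continuous].
  by rewrite ger0_norm ?sqr_ge0// sqr_sin_le1.
rewrite unif01_integralE//.
rewrite (@integral_density _ (semicircle r) (semicircle_pdf r))//; last first.
- by move=> A _; rewrite /= /semicircle r0.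
- by move=> x; exact: semicircle_pdf_ge0.
- exact: measurable_semicircle_pdf.
transitivity (\int[lambda]_(x in `[(- r), r]) (f x * semicircle_pdf r x)).
  rewrite [RHS]Rintegral_mkcond; apply: eq_Rintegral => x _.
  rewrite patchE; case: ifPn => //; rewrite notin_setE/= in_itv/= => xr.
  rewrite /semicircle_pdf ler0_sqrtr ?mulr0// subr_le0.
  rewrite -(ger0_norm (ltW r0)) -[x ^+ 2]real_normK ?num_real// lerXn2r ?nnegrE//.
  by rewrite ger0_norm ?(ltW r0)// leNgt; apply/negP => /ltW; rewrite ler_norml.
rewrite /Rintegral.
have := @integration_by_substitution_increasing R F
  (fun x => f x * semicircle_pdf r x) 0 1.
rewrite F0 F1 F'E => ->; last first.
- apply: continuous_subspaceT => x; apply: cvgM; first exact: cf.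
  exact: continuous_semicircle_pdf.
- split=> [u _||]; first exact: ex_derive.
  + exact/cvg_at_right_filter/cF.
  + exact/cvg_at_left_filter/cF.
- exact/cvgP/cvg_at_left_filter/cF'.
- exact/cvgP/cvg_at_right_filter/cF'.
- by move=> u _; exact: cF'.
- move=> u v; rewrite !in_itv/= => /andP[u0 u1] /andP[v0 v1] uv.
  rewrite /F ltrN2 ltr_pM2l// ltr_cos ?ltr_pM2l// in_itv/=.
    by rewrite mulr_ge0 ?(ltW pi0)//= -[leRHS]mulr1 ler_pM2l.
  by rewrite mulr_ge0 ?(ltW pi0)//= -[leRHS]mulr1 ler_pM2l.
- exact: ler01.
congr fine; apply: eq_integral => u; rewrite inE/= in_itv/= => /andP[u0 u1]; congr EFin.
rewrite !fctE/= -[LHS]mulrA; congr (_ * _).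
rewrite /semicircle_pdf /F sqrrN exprMn.
have -> : r ^+ 2 - r ^+ 2 * cos (pi * u) ^+ 2 = r ^+ 2 * sin (pi * u) ^+ 2.
  by rewrite sin2cos2 mulrBr mulr1.
rewrite sqrtrM ?sqr_ge0// !sqrtr_sqr gtr0_norm// ger0_norm; last first.
  by apply: sin_ge0_pi; rewrite mulr_ge0 ?(ltW pi0)//= -[leRHS]mulr1 ler_pM2l.
move: (sin (pi * u)) pi_neq0 (lt0r_neq0 r0) => c; generalize (@pi R) => q q0 rn0.
by field; rewrite rn0 q0.
Qed.

Lemma integral_cos_pi (k : nat) : (0 < k)%N ->
  \int[unif01]_u (cos (k%:R * (pi * u)) : R) = 0.
Proof.
move=> k0.
have kpi : k%:R * pi != 0 :> R by rewrite mulf_neq0 ?pnatr_eq0 -?lt0n// gt_eqF// pi_gt0.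
have dl (u : R) : is_derive u (1 : R) (fun u : R => k%:R * (pi * u)) (k%:R * pi).
  by apply: is_derive_eq; rewrite /GRing.scale/= mulr1.
have cl : continuous (fun u : R => k%:R * (pi * u)).
  by move=> u; have := dl u => dlu;
    apply/differentiable_continuous/derivable1_diffP/ex_derive.
have cc : continuous (fun u : R => cos (k%:R * (pi * u))).
  by move=> u; apply: (cvg_comp _ cos); [exact: cl|exact: continuous_cos].
pose H (u : R) := (k%:R * pi)^-1 * sin (k%:R * (pi * u)).
have dH (u : R) : is_derive u (1 : R) H (cos (k%:R * (pi * u))).
  have ds := @is_derive1_comp R sin (fun u => k%:R * (pi * u)) u _ _
    (is_derive_sin (k%:R * (pi * u))) (dl u).
  apply: (is_derive_eq (is_deriveZ (k%:R * pi)^-1 ds)).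
  by rewrite /GRing.scale/= mulrCA mulVf ?mulr1.
have cH : continuous H.
  by move=> u; have := dH u => dHu;
    apply/differentiable_continuous/derivable1_diffP/ex_derive.
rewrite unif01_integralE; last first.
  apply: (@bdm_continuous _ _ 1) => // u.
  by rewrite ler_norml cos_geN1 cos_le1.
rewrite /Rintegral (@continuous_FTC2 _ _ H)//.
- rewrite /H !mulr0 sin0 mulr0 mulr1.
  have -> : sin (k%:R * pi) = 0 :> R.
    elim: k {k0 kpi dl cl cc H dH cH} => [|k ih]; first by rewrite mul0r sin0.
    by rewrite -natr1 mulrDl mul1r sinDpi ih oppr0.
  by rewrite mulr0 -EFinB subrr.
- exact: continuous_subspaceT.
- split=> [u _||]; first by have := dH u => dHu; exact: ex_derive.
  + exact/cvg_at_right_filter/cH.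
  + exact/cvg_at_left_filter/cH.
- by move=> u _; rewrite derive1E; have := dH u => dHu; exact: derive_val.
Qed.

Let natSr n : n.+1%:R = n%:R + 1 :> R.
Proof. by rewrite natr1. Qed.

Let s (u : R) (n : nat) : R := sin (n%:R * (pi * u)).

Let sS u n : 2 * cos (pi * u) * s u n.+1 = s u n.+2 + s u n.
Proof.
have -> : s u n.+2 = sin (n.+1%:R * (pi * u) + pi * u).
  by rewrite /s (natSr n.+1) (mulrDl n.+1%:R) mul1r.
have -> : s u n = sin (n.+1%:R * (pi * u) - pi * u).
  by rewrite /s (natSr n) (mulrDl n%:R) mul1r addrK.
by rewrite sinD sinB /s; ring.
Qed.

(* [(D p u)^-1] is the generating function in [p] of the Chebyshev polynomials of the
   second kind at [cos (pi * u)]. *)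
Let D (p : R[i]) (u : R) : R[i] := 1 - 2 * p * (cos (pi * u))%:C + p ^+ 2.

(** The generating function of the sines, truncated with an exact remainder: by the recurrence [sS]
    everything but the boundary terms cancels. *)
Let chebyshev_sum p u K : D p u * (\sum_(n < K) p ^+ n * (s u n.+1)%:C) =
  (s u 1)%:C - p ^+ K * (s u K.+1)%:C + p ^+ K.+1 * (s u K)%:C.
Proof.
elim: K => [|K ih].
  by rewrite big_ord0 mulr0 expr0 mul1r subrr add0r {1}/s mul0r sin0 mulr0.
have h : (s u K.+2)%:C = 2 * (cos (pi * u))%:C * (s u K.+1)%:C - (s u K)%:C :> R[i].
  by rewrite -[2](rmorph_nat (real_complex R)) -!rmorphM -rmorphB sS addrK.
by rewrite big_ord_recr mulrDr ih h /D !exprS; ring.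
Qed.

(** D factors as [(1 - p e)(1 - p e')] with e and e' the conjugate points [exp (i pi u)] and
    [exp (- i pi u)] of the unit circle. *)
Let D_ge (p : R[i]) u : cmod p < 1 -> (1 - cmod p) ^+ 2 <= cmod (D p u).
Proof.
move=> p1; pose e : R[i] := cos (pi * u) +i* sin (pi * u).
pose e' : R[i] := cos (pi * u) +i* (- sin (pi * u)).
have ee : e * e' = 1.
  apply: complex_ext; rewrite ?cReM ?cImM /=; last by ring.
  by rewrite mulrN opprK -!expr2 cos2Dsin2.
have e1 : cmod e = 1 by rewrite /cmod/= cos2Dsin2 sqrtr1.
have e1' : cmod e' = 1 by rewrite /cmod/= sqrrN cos2Dsin2 sqrtr1.
have -> : D p u = (1 - p * e) * (1 - p * e').
  have -> : (1 - p * e) * (1 - p * e') = 1 - p * (e + e') + p ^+ 2 * (e * e') by ring.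
  rewrite ee mulr1 /D; congr (_ - _ + _); rewrite mulrAC mulrC; congr (_ * _).
  by apply: complex_ext; rewrite !(cReD, cImD, cReM, cImM)/=; ring.
rewrite cmodM expr2 ler_pM ?subr_ge0 ?(ltW p1)//.
  by rewrite (le_trans _ (cmod_tri _ _))// cmodM cmod1 e1 mulr1.
by rewrite (le_trans _ (cmod_tri _ _))// cmodM cmod1 e1' mulr1.
Qed.

Let cbdm_s n : cbdm (fun u => (s u n)%:C).
Proof.
apply: cbdm_real; apply: (@bdm_continuous _ _ 1) => u.
  apply: (cvg_comp _ sin); last exact: continuous_sin.
  by apply: cvgM; [exact: cvg_cst|apply: cvgM; [exact: cvg_cst|exact: cvg_id]].
by rewrite ler_norml sin_geN1 sin_le1.
Qed.

(** Orthogonality of the sines: the integrand is [cos (n pi u) - cos ((n + 2) pi u)], and a cosine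
    of nonzero frequency integrates to 0. *)
Let integral_ss n : cint unif01 (fun u => (2 * s u 1 * s u n.+1)%:C) = (n == 0%N)%:R.
Proof.
have bc k : bdm (fun u : R => cos (k%:R * (pi * u))).
  apply: (@bdm_continuous _ _ 1) => u.
    apply: (cvg_comp _ cos); last exact: continuous_cos.
    by apply: cvgM; [exact: cvg_cst|apply: cvgM; [exact: cvg_cst|exact: cvg_id]].
  by rewrite ler_norml cos_geN1 cos_le1.
have E u : 2 * s u 1 * s u n.+1 = cos (n%:R * (pi * u)) - cos (n.+2%:R * (pi * u)).
  rewrite /s mul1r (natSr n.+1) (mulrDl n.+1%:R) mul1r cosD.
  have -> : n%:R * (pi * u) = n.+1%:R * (pi * u) - pi * u.
    by rewrite (natSr n) (mulrDl n%:R) mul1r addrK.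
  by rewrite cosB; ring.
under eq_cint do rewrite E.
apply: complex_ext => /=.
  rewrite bdm_integralB// (integral_cos_pi (ltn0Sn n.+1)) subr0.
  case: n {E} => [|n]; last by rewrite integral_cos_pi.
  under eq_Rintegral do rewrite mul0r cos0.
  by rewrite bdm_integral_cst.
by rewrite bdm_integral_cst; case: eqP.
Qed.

Let cbdm_DV p : cmod p < 1 -> cbdm (fun u => (D p u)^-1).
Proof.
move=> p1; pose d := (1 - cmod p) ^+ 2.
have d0 : 0 < d by rewrite exprn_gt0// subr_gt0.
have D0 u : D p u != 0 by rewrite -cmod_gt0 (lt_le_trans d0)// D_ge.
have cc : continuous (fun u : R => cos (pi * u)).
  move=> u; apply: (cvg_comp _ cos); last exact: continuous_cos.
  by apply: cvgM; [exact: cvg_cst|exact: cvg_id].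
have [cDR cDI] : continuous (fun u => complex.Re (D p u)) /\
    continuous (fun u => complex.Im (D p u)).
  split; rewrite /D; under eq_fun do rewrite !(cReD, cImD, cReN, cImN, cReM, cImM)/=.
    move=> u; apply: cvgD; last exact: cvg_cst.
    apply: cvgB; first exact: cvg_cst.
    by apply: cvgB; apply: cvgM; (exact: cc || exact: cvg_cst).
  move=> u; apply: cvgD; last exact: cvg_cst.
  apply: cvgB; first exact: cvg_cst.
  by apply: cvgD; apply: cvgM; (exact: cc || exact: cvg_cst).
have cn u : (complex.Re (D p v) ^+ 2 + complex.Im (D p v) ^+ 2)^-1 @[v --> u] -->
    (complex.Re (D p u) ^+ 2 + complex.Im (D p u) ^+ 2)^-1.
  apply: cvgV; first by rewrite -sqr_cmod expf_neq0// cmod_eq0.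
  by apply: cvgD; apply: (cvg_comp _ (fun v => v ^+ 2));
    (exact: exprn_continuous || exact: cDR || exact: cDI).
have le_d u : cmod (D p u)^-1 <= d^-1.
  by rewrite cmodV lef_pV2 ?D_ge// posrE (lt_le_trans d0)// D_ge.
have cRV : continuous (fun u => complex.Re (D p u)^-1).
  under eq_fun do rewrite cReV sqr_cmod.
  by move=> u; apply: cvgM; [exact: cDR|exact: cn].
have cIV : continuous (fun u => complex.Im (D p u)^-1).
  under eq_fun do rewrite cImV sqr_cmod.
  by move=> u; apply: cvgN; apply: cvgM; [exact: cDI|exact: cn].
split.
  by apply: (bdm_continuous cRV) => u; exact: le_trans (Re_le_cmod _) (le_d u).
by apply: (bdm_continuous cIV) => u; exact: le_trans (Im_le_cmod _) (le_d u).
Qed.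

(** Expand [sin (pi u) / D] by [chebyshev_sum]: orthogonality keeps the term n = 0 only, and the
    remainder is of order [|p|^K]. *)
Let semicircle_kernel_integral (p : R[i]) : cmod p < 1 ->
  cint unif01 (fun u => (2 * s u 1 ^+ 2)%:C * (D p u)^-1) = 1.
Proof.
move=> p1; pose d := (1 - cmod p) ^+ 2.
have d0 : 0 < d by rewrite exprn_gt0// subr_gt0.
have D0 u : D p u != 0 by rewrite -cmod_gt0 (lt_le_trans d0)// D_ge.
have bDV := cbdm_DV p1.
apply/eqP; rewrite -subr_eq0 -cmod_eq0 eq_le cmod_ge0 andbT.
have bound K : (0 < K)%N ->
    cmod (cint unif01 (fun u => (2 * s u 1 ^+ 2)%:C * (D p u)^-1) - 1) <=
    cmod p ^+ K * (8 / d).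
  move=> K0.
  pose S u := \sum_(n < K) p ^+ n * (2 * s u 1 * s u n.+1)%:C.
  pose T u := (2 * s u 1)%:C *
    ((p ^+ K * (s u K.+1)%:C - p ^+ K.+1 * (s u K)%:C) * (D p u)^-1).
  have bs2 n : cbdm (fun u => p ^+ n * (2 * s u 1 * s u n.+1)%:C).
    apply: cbdmM; first exact: cbdm_cst.
    under eq_fun do rewrite !rmorphM/=.
    apply: cbdmM => //; apply: cbdmM => //; exact: cbdm_cst.
  have bS : cbdm S by exact: (@cbdm_sum _ K (fun n u => p ^+ n * (2 * s u 1 * s u n.+1)%:C)).
  have bT : cbdm T.
    apply: cbdmM.
      by under eq_fun do rewrite rmorphM/=; apply: cbdmM => //; exact: cbdm_cst.
    apply: cbdmM => //; apply: cbdmB; apply: cbdmM => //; exact: cbdm_cst.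
  have -> : cint unif01 (fun u => (2 * s u 1 ^+ 2)%:C * (D p u)^-1) =
      cint unif01 (fun u => S u + T u).
    apply: eq_cint => u; have := chebyshev_sum p u K.
    set Q := \sum_(_ < _) _ => EQ.
    have -> : S u = (2 * s u 1)%:C * Q.
      rewrite /S /Q mulr_sumr; apply: eq_bigr => n _.
      by rewrite !rmorphM/= mulrCA.
    have -> : Q = ((s u 1)%:C - p ^+ K * (s u K.+1)%:C + p ^+ K.+1 * (s u K)%:C) / D p u.
      by rewrite -EQ mulrAC mulfV// mul1r.
    rewrite /T !rmorphM/=.
    move: (D p u) (D0 u) => DD DD0; move: (p ^+ K) (p ^+ K.+1) => A B.
    by field.
  rewrite cintD// (@cint_sum _ _ K (fun n u => p ^+ n * (2 * s u 1 * s u n.+1)%:C))//.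
  have -> : \sum_(n < K) cint unif01 (fun u => p ^+ n * (2 * s u 1 * s u n.+1)%:C) = 1.
    rewrite (bigD1 (Ordinal K0))//= cintZ; last first.
      by have := bs2 0%N; under eq_fun do rewrite expr0 mul1r.
    rewrite integral_ss expr0 mul1r big1 ?addr0// => n n0.
    rewrite cintZ ?integral_ss; last first.
      under eq_fun do rewrite !rmorphM/=.
      apply: cbdmM => //; apply: cbdmM => //; exact: cbdm_cst.
    by case: eqP => [e|_]; [move/eqP: n0; case; exact/val_inj|rewrite mulr0].
  rewrite addrC addKr.
  have -> : cmod p ^+ K * (8 / d) = 2 * (2 * ((cmod p ^+ K + cmod p ^+ K) * d^-1)) by field; rewrite gt_eqF.
  apply: cmod_cint_le => // u; rewrite /T !cmodM.
  have s1 n : cmod (s u n)%:C <= 1 by rewrite cmod_real ler_norml sin_geN1 sin_le1.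
  rewrite ler_pM ?mulr_ge0 ?cmod_ge0//.
    by rewrite cmod_real normrM ger0_norm// -[leRHS]mulr1 ler_wpM2l// -cmod_real.
  rewrite ler_pM ?cmod_ge0//; last first.
    by rewrite cmodV lef_pV2 ?D_ge// posrE (lt_le_trans d0)// D_ge.
  rewrite (le_trans (cmodB _ _))// !cmodM !cmodX lerD//.
    by rewrite -[leRHS]mulr1 ler_wpM2l// exprn_ge0// cmod_ge0.
  rewrite -[leRHS]mulr1 ler_pM ?cmod_ge0 ?exprn_ge0 ?cmod_ge0//.
  by rewrite exprSr -[leRHS]mulr1 ler_wpM2l ?exprn_ge0 ?cmod_ge0// ltW.
apply/ler_addgt0Pr => e e0; rewrite add0r.
have : cmod p ^+ K * (8 / d) @[K --> \oo] --> (0 : R).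
  rewrite -(mul0r (8 / d)); apply: cvgM; last exact: cvg_cst.
  by apply: cvg_expr; rewrite ger0_norm// cmod_ge0.
move=> /cvgrPdist_le /(_ e e0) [K _ /(_ K.+1 (leqnSn K))].
rewrite /= sub0r normrN => h; rewrite (le_trans (bound K.+1 _))// (le_trans _ h)//.
exact: ler_norm.
Qed.

Lemma semicircle0_integral (f : R -> R) : bdm f -> \int[semicircle 0]_x f x = f 0.
Proof.
move=> [mf _]; rewrite /Rintegral (eq_measure_integral (\d_(0 : R))); last first.
  by move=> A _ _; rewrite /= /semicircle ltxx.
have mEf : measurable_fun setT (EFin \o f) by exact/measurable_EFinP.
by rewrite (integral_dirac (0 : R) measurableT mEf) diracT mul1e.
Qed.

(** With [p = - sqrt t / z], the denominator [z + t / z + 2 sqrt t cos (pi u)] equals [z D], and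
    [t < |z|^2] says [|p| < 1]. For t = 0 the law is the Dirac mass at 0. *)
Lemma cauchy_transform_semicircle (t : R) (z : R[i]) : 0 <= t -> t < cmod z ^+ 2 ->
  0 < complex.Im (z + t%:C / z) ->
  cauchy_transform (semicircle (2 * Num.sqrt t)) (z + t%:C / z) = z^-1.
Proof.
move=> t0 tz w0; have w0' : complex.Im (z + t%:C / z) != 0 by rewrite gt_eqF.
have zn0 : z != 0.
  by rewrite -cmod_eq0; apply: contraTneq tz => ->; rewrite expr0n/= -leNgt.
have [bR bI] := cbdm_resolvent w0'.
rewrite cauchy_transformE; move: t0; rewrite le_eqVlt => /orP[/eqP t0|t0].
  subst t; rewrite sqrtr0 mulr0 mul0r addr0 in bR bI *.
  by apply: complex_ext; rewrite /= semicircle0_integral// subr0.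
pose r := 2 * Num.sqrt t; have r0 : 0 < r by rewrite mulr_gt0 ?sqrtr_gt0.
have fM x : cmod (z + t%:C / z - x%:C)^-1 <= `|complex.Im (z + t%:C / z)|^-1.
  exact: cmod_resolvent_le.
pose p : R[i] := - ((Num.sqrt t)%:C / z).
have p1 : cmod p < 1.
  rewrite cmodN cmodM cmodV cmod_real ger0_norm ?sqrtr_ge0//.
  rewrite ltr_pdivrMr ?cmod_gt0// mul1r -(ltr_pXn2r (ltn0Sn 1)) ?nnegrE ?cmod_ge0 ?sqrtr_ge0//.
  by rewrite sqr_sqrtr// ltW.
have tE : t%:C = (Num.sqrt t)%:C ^+ 2 :> R[i].
  by rewrite -rmorphXn/= sqr_sqrtr// ltW.
have -> : cint (semicircle (2 * Num.sqrt t)) (fun x => (z + t%:C / z - x%:C)^-1) =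
    cint unif01 (fun u => z^-1 * ((2 * s u 1 ^+ 2)%:C * (D p u)^-1)).
  transitivity (cint unif01 (fun u => (2 * sin (pi * u) ^+ 2)%:C *
      (z + t%:C / z - (- (r * cos (pi * u)))%:C)^-1)).
    apply: complex_ext => /=.
      rewrite (semicircle_integral r0 (continuous_Re_resolvent w0')
        (fun x => le_trans (Re_le_cmod _) (fM x))).
      by apply: eq_Rintegral => u _; rewrite cReZ mulrC.
    rewrite (semicircle_integral r0 (continuous_Im_resolvent w0')
      (fun x => le_trans (Im_le_cmod _) (fM x))).
    by apply: eq_Rintegral => u _; rewrite cImZ mulrC.
  apply: eq_cint => u; rewrite /s mul1r [RHS]mulrCA -invfM; congr (_ * _^-1).
  rewrite /D /p /r tE rmorphN opprK !rmorphM/=.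
  move: ((Num.sqrt t)%:C : R[i]) => q.
  rewrite (_ : 2%:C = 2 :> R[i]); last by rewrite rmorph_nat.
  by field.
rewrite cintZ ?semicircle_kernel_integral ?mulr1//; apply: cbdmM; last exact: cbdm_DV.
have b1 := cbdm_s 1; under eq_fun do rewrite rmorphM/= rmorphXn/=.
by apply: cbdmM; [exact: cbdm_cst|exact: cbdmX].
Qed.

End semicircle_cauchy_transform.

(** * The limit of the flow *)

Section empirical_integral.
Context {R : realType}.

Lemma semicircle_support (r k : R) : 0 <= r -> r <= k ->
  semicircle r (~` `[- k, k]%classic) = 0%E.
Proof.
move=> r0 rk; have k0 := le_trans r0 rk.
rewrite /semicircle; case: ifPn => [r1|_].
  rewrite (eq_integral (fun=> 0%E)) ?integral0// => x.
  rewrite inE/= in_itv/= => xk; congr EFin.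
  rewrite /semicircle_pdf ler0_sqrtr ?mulr0// subr_le0.
  rewrite -[x ^+ 2]real_normK ?num_real// lerXn2r ?nnegrE// (le_trans rk)//.
  by rewrite leNgt; apply/negP => /ltW; rewrite ler_norml => /xk.
rewrite diracE memNset// /= => h; apply: h.
by rewrite in_itv/= k0 oppr_le0 k0.
Qed.

Lemma empirical_integral N (y : 'I_N -> R) (f : R -> R) : measurable_fun setT f ->
  \int[empirical y]_x f x = N%:R^-1 * \sum_(i < N) f (y i).
Proof.
move=> mf.
pose d (k : nat) : {measure set R -> \bar R} :=
  if insub k is Some i then \d_(y i) else \d_(0 : R).
have dE (i : 'I_N) : d i = \d_(y i) by rewrite /d valK.
have H (g : R -> \bar R) : measurable_fun setT g -> (forall x, 0 <= g x)%E ->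
    (\int[empirical y]_x g x = (N%:R^-1)%:E * \sum_(i < N) g (y i))%E.
  move=> mg g0.
  rewrite (eq_measure_integral (mscale (N%:R^-1)%:nng (msum d N))); last first.
    move=> A _ _; rewrite /mscale /msum /empirical /=; congr (_ * _)%E.
    by apply: eq_bigr => i _; rewrite dE.
  rewrite ge0_integral_mscale//= ge0_integral_measure_sum//; congr (_ * _)%E.
  apply: eq_bigr => i _; rewrite dE (integral_dirac _ measurableT mg).
  by rewrite diracT mul1e.
have mEf : measurable_fun setT (EFin \o f) by exact/measurable_EFinP.
rewrite /Rintegral integralE.
rewrite H; [|exact: measurable_funepos|by move=> x; exact: funepos_ge0].
rewrite H; [|exact: measurable_funeneg|by move=> x; exact: funeneg_ge0].
under eq_bigr do rewrite funeposE/= -EFin_max.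
under [X in (_ - _ * X)%E]eq_bigr do rewrite funenegE/= -EFin_max.
rewrite !sumEFin -!EFinM -EFinB/= -mulrBr -sumrB; congr (_ * _).
apply: eq_bigr => i _; rewrite /Num.max.
by case: ltP => h1; case: ltP => h2; lra.
Qed.

Lemma weakly_convergesE (y : forall N : nat, 'I_N -> R) (m : probability R R)
    (f : R -> R) :
  weakly_converges (fun N => empirical (@y N)) m ->
  continuous f -> (exists M, forall x, `|f x| <= M) ->
  N%:R^-1 * (\sum_(i < N) f (@y N i)) @[N --> \oo] --> \int[m]_x f x.
Proof.
move=> yc cf fM; have mf := continuous_measurable_fun cf.
rewrite (_ : (fun N => _) = fun N => \int[empirical (@y N)]_x f x); first exact: yc.
by apply/funext => N; rewrite empirical_integral.
Qed.

(** The right side is at least [1/2] once [|Re w - x| >= Im w > 0], so its mean controls the mass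
    far from [Re w]; this is how a Cauchy transform at a single point bounds tails. *)
Lemma one_add_Im_resolvent (w : R[i]) (x : R) : complex.Im w != 0 ->
  1 + complex.Im w * complex.Im (w - x%:C)^-1 =
  (complex.Re w - x) ^+ 2 / ((complex.Re w - x) ^+ 2 + complex.Im w ^+ 2).
Proof.
case: w => a b; rewrite [complex.Im _]/= [complex.Re (a +i* b)]/= => b0.
rewrite cImV sqr_cmod /= subr0.
have : (a - x) ^+ 2 + b ^+ 2 != 0.
  by rewrite paddr_eq0 ?sqr_ge0// negb_and orbC expf_neq0.
by move=> h; field.
Qed.

Lemma bounded_Re_resolvent (z : R[i]) : complex.Im z != 0 ->
  exists M, forall u : R, `|complex.Re (z - u%:C)^-1| <= M.
Proof.
move=> z0; exists `|complex.Im z|^-1 => u.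
exact: le_trans (Re_le_cmod _) (cmod_resolvent_le _ z0).
Qed.

Lemma bounded_Im_resolvent (z : R[i]) : complex.Im z != 0 ->
  exists M, forall u : R, `|complex.Im (z - u%:C)^-1| <= M.
Proof.
move=> z0; exists `|complex.Im z|^-1 => u.
exact: le_trans (Im_le_cmod _) (cmod_resolvent_le _ z0).
Qed.

End empirical_integral.

(** * Tightness and limit points of the flow *)

Section flow_limit.
Context {R : realType}.
Variables (mu : probability R R).
Variables (x : forall N : nat, 'rV[R]_N) (phi : forall N : nat, R -> 'rV[R]_N).
Hypothesis x_cvg : weakly_converges
  (fun N => empirical (fun n : 'I_N => x N 0 n / Num.sqrt N%:R)) mu.
Hypothesis phi_sol : forall N : nat, is_frozen_solution (x N) (phi N).
Variable t : R.
Hypothesis t0 : 0 <= t.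

Let y N s (i : 'I_N) : R := phi N s 0 i / Num.sqrt N%:R.

Lemma empirical_cauchy_cvg0 z : complex.Im z != 0 ->
  cmod (empirical_cauchy (@y N 0) z - cauchy_transform mu z) @[N --> \oo] --> (0 : R).
Proof.
move=> z0.
have hR := @weakly_convergesE R (fun N n => x N 0 n / Num.sqrt N%:R) mu _ x_cvg
  (continuous_Re_resolvent z0) (bounded_Re_resolvent z0).
have hI := @weakly_convergesE R (fun N n => x N 0 n / Num.sqrt N%:R) mu _ x_cvg
  (continuous_Im_resolvent z0) (bounded_Im_resolvent z0).
apply/cvgrPdist_le => e e0; have e2 : 0 < e / 2 by rewrite divr_gt0.
move/cvgrPdist_le : hR => /(_ _ e2) hR; move/cvgrPdist_le : hI => /(_ _ e2) hI.
near=> N; rewrite sub0r normrN ger0_norm ?cmod_ge0//.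
have yE i : y 0 i = x N 0 i / Num.sqrt N%:R.
  by rewrite /y; have [_ _ -> _ _] := phi_sol N.
rewrite cmod_distC (le_trans (cmod_le_ReIm _))// [leRHS]splitr /empirical_cauchy.
rewrite cReD cReN cImD cImN cReZ cImZ cRe_sum cIm_sum.
under eq_bigr do rewrite yE.
under [X in _ + `|_ - _ * X|]eq_bigr do rewrite yE.
by rewrite lerD//; near: N.
Unshelve. all: end_near. Qed.

Lemma Im_burgers_char_gt0 z : 0 < complex.Im z -> t < complex.Im z ^+ 2 ->
  0 < complex.Im (burgers_char mu t z).
Proof.
move=> z0 zt; rewrite /burgers_char cImD cImZ.
apply: (@lt_le_trans _ _ (complex.Im z - t / complex.Im z)).
  by rewrite subr_gt0 ltr_pdivrMr// -expr2.
rewrite lerD2l lerNl -mulrN ler_wpM2l// (le_trans (ler_norm _))// normrN.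
exact: Im_cauchy_transform_le.
Qed.

Lemma empirical_cauchy_cvg z : 0 < complex.Im z -> t < complex.Im z ^+ 2 ->
  cmod (empirical_cauchy (@y N t) (burgers_char mu t z) - cauchy_transform mu z)
    @[N --> \oo] --> (0 : R).
Proof.
move=> z0 zt; pose g := cauchy_transform mu z.
(* A lower bound for the imaginary part along the whole characteristic up to time t. *)
pose c := complex.Im z - t / complex.Im z.
have c0 : 0 < c by rewrite subr_gt0 ltr_pdivrMr// -expr2.
have zc (s : R) : 0 <= s <= t -> c <= complex.Im (z + s%:C * g).
  move=> /andP[s0 st]; rewrite cImD cImZ /c lerD2l lerNl.
  have := Im_cauchy_transform_le mu z0; rewrite -/g => h.
  rewrite -mulrN (le_trans (ler_wpM2l s0 (ler_norm _)))// normrN.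
  by rewrite ler_pM.
pose K := expR ((2 * c^-1 ^+ 2 + 1) * t).
pose a N := cmod (empirical_cauchy (@y N 0) z - g).
have bnd : \forall N \near \oo,
    cmod (empirical_cauchy (@y N t) (burgers_char mu t z) - g) ^+ 2 <=
    K * (a N ^+ 2 + (N%:R^-1 * c^-1 ^+ 3) ^+ 2).
  near=> N; have N0 : (0 < N)%N by near: N; exact: nbhs_infty_gt.
  exact: (flow_cauchy_bound N0 (phi_sol N) t0 c0 zc).
have a_cvg : a N @[N --> \oo] --> (0 : R).
  by apply: empirical_cauchy_cvg0; rewrite gt_eqF.
have N_cvg : (N%:R^-1 : R) @[N --> \oo] --> (0 : R).
  rewrite -cvg_shiftS; exact: cvg_harmonic.
have K_cvg : K * (a N ^+ 2 + (N%:R^-1 * c^-1 ^+ 3) ^+ 2) @[N --> \oo] --> (0 : R).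
  rewrite (_ : 0 = K * (0 * 0 + (0 * c^-1 ^+ 3) * (0 * c^-1 ^+ 3))); last first.
    by rewrite !mul0r addr0 mulr0.
  apply: cvgM; first exact: cvg_cst.
  apply: cvgD; first exact: cvgM.
  by apply: cvgM; apply: cvgM => //; exact: cvg_cst.
apply/cvgrPdist_le => e e0.
move/cvgrPdist_le : K_cvg => /(_ (e ^+ 2) (exprn_gt0 _ e0)) hK.
near=> N; rewrite sub0r normrN ger0_norm ?cmod_ge0//.
rewrite -(ler_pXn2r (ltn0Sn 1)) ?nnegrE ?cmod_ge0 ?(ltW e0)//.
apply: (@le_trans _ _ (K * (a N ^+ 2 + (N%:R^-1 * c^-1 ^+ 3) ^+ 2))).
  by near: N.
rewrite (le_trans (ler_norm _))// -normrN -sub0r; near: N; exact: hK.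
Unshelve. all: end_near. Qed.

Variable k : R.
Hypothesis k0 : 0 < k.
Hypothesis mu_supp : mu (~` `[- k, k]%classic) = 0%E.

(** The value [- Im G(i L)] is the integral of [L / (L^2 + x^2)], and [x^2 <= k^2] on the support.
    For tightness it shows that [1 + L Im G(i L)] is small when L is large. *)
Lemma Im_cauchy_transform_ge (L : R) : 0 < L ->
  complex.Im (cauchy_transform mu (L *i)) <= - (L / (L ^+ 2 + k ^+ 2)).
Proof.
move=> L0; have L1 : complex.Im (L *i) != 0 by rewrite gt_eqF.
rewrite cauchy_transformE (cint_clip mu_supp); last exact: cbdm_resolvent.
rewrite -[leRHS](bdm_integral_cst mu).
apply: (@bdm_integral_le _ mu (fun u => complex.Im (L *i - (clip k u)%:C)^-1)).
- exact: (bdm_comp (measurable_clip k) (cbdm_resolvent L1).2).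
- exact: bdm_cst.
- move=> u; rewrite cImV sqr_cmod /= sub0r subr0 sqrrN lerN2.
  rewrite ler_wpM2l ?(ltW L0)// lef_pV2 ?posrE; last first.
  + by rewrite ltr_pwDr ?exprn_gt0// sqr_ge0.
  + by rewrite ltr_pwDl ?exprn_gt0// sqr_ge0.
  rewrite addrC lerD2l -[leLHS]real_normK ?num_real// lerXn2r ?nnegrE ?(ltW k0)//.
  by rewrite ler_norml clip_itv// ltW.
Qed.

(** At the end point w, of imaginary part v, of the characteristic from [i L], twice
    [1 + v Im G_N(t, w)] dominates the mass outside [|u| + v], and its limit is at most
    [2 (k^2 + t) / (L^2 + k^2)]. *)
Lemma empirical_tight (eta : R) : 0 < eta -> exists A : R, \forall N \near \oo,
  N%:R^-1 * \sum_(i < N) (A <= `|@y N t i|)%R%:R <= eta.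
Proof.
move=> eta0.
(* So that [eta / 4 * L^2 >= k^2 + t]: the limit of [1 + v Im G_N] then costs [eta / 4], the
   distance to it another [eta / 4], and the factor 2 makes eta. *)
pose L := Num.sqrt (t + 4 * (k ^+ 2 + t) / eta + 1).
have r0 : 0 <= 4 * (k ^+ 2 + t) / eta.
  by rewrite divr_ge0 ?mulr_ge0 ?addr_ge0 ?sqr_ge0// ltW.
have L2 : L ^+ 2 = t + 4 * (k ^+ 2 + t) / eta + 1.
  by rewrite sqr_sqrtr// !addr_ge0.
have tt := t0; have kk := k0.
have L0 : 0 < L by rewrite sqrtr_gt0 ltr_pwDr// addr_ge0.
have tL : t < L ^+ 2 by rewrite L2; lra.
pose g := cauchy_transform mu (L *i); pose w := burgers_char mu t (L *i).
pose u := complex.Re w; pose v := complex.Im w.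
have gI := Im_cauchy_transform_ge L0; rewrite -/g in gI.
have gI2 := Im_cauchy_transform_le mu (L0 : 0 < complex.Im (L *i)); rewrite -/g /= in gI2.
have vE : v = L + t * complex.Im g by rewrite /v /w /burgers_char cImD cImZ.
have v1 : L - t / L <= v.
  rewrite vE lerD2l lerNl -mulrN ler_wpM2l// (le_trans (ler_norm _))//.
  by rewrite normrN.
have v0 : 0 < v.
  by rewrite (lt_le_trans _ v1)// subr_gt0 ltr_pdivrMr// -expr2.
have v0' : v != 0 by rewrite gt_eqF.
have lim_le : 1 + v * complex.Im g <= eta / 4.
  have LK : 0 < L ^+ 2 + k ^+ 2 by rewrite addr_gt0// exprn_gt0.
  have h1 : v * complex.Im g <= - ((L - t / L) * (L / (L ^+ 2 + k ^+ 2))).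
    rewrite (le_trans (ler_wpM2l (ltW v0) gI))// mulrN lerN2 ler_wpM2r//.
    by rewrite divr_ge0 ?ltW.
  have h2 : (L - t / L) * (L / (L ^+ 2 + k ^+ 2)) = (L ^+ 2 - t) / (L ^+ 2 + k ^+ 2).
    by field; rewrite !gt_eqF.
  rewrite (le_trans (lerD (lexx 1) h1))// h2.
  have -> : 1 - (L ^+ 2 - t) / (L ^+ 2 + k ^+ 2) = (k ^+ 2 + t) / (L ^+ 2 + k ^+ 2).
    by field; rewrite gt_eqF.
  rewrite ler_pdivrMr//.
  have EL : eta / 4 * L ^+ 2 = eta / 4 * (t + 1) + (k ^+ 2 + t).
    by rewrite L2; field; rewrite gt_eqF.
  have q0 : 0 <= eta / 4 by rewrite divr_ge0// ltW.
  rewrite mulrDr EL; have := mulr_ge0 q0 (sqr_ge0 k).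
  have : 0 <= eta / 4 * (t + 1) by rewrite mulr_ge0// addr_ge0.
  by lra.
exists (`|u| + v).
have cvgN := @empirical_cauchy_cvg (L *i) L0 tL; rewrite -/g -/w in cvgN.
move/cvgrPdist_le : cvgN => /(_ (eta / (4 * v))); rewrite divr_gt0 ?mulr_gt0// => /(_ isT) hN.
near=> N.
have N0 : (0 < N)%N by near: N; exact: nbhs_infty_gt.
have NR : N%:R != 0 :> R by rewrite pnatr_eq0 -lt0n.
have hG : cmod (empirical_cauchy (@y N t) w - g) <= eta / (4 * v).
  rewrite -[leLHS]ger0_norm ?cmod_ge0// -normrN -sub0r; near: N; exact: hN.
pose ew := empirical_cauchy (@y N t) w.
have hI : complex.Im ew - complex.Im g <= eta / (4 * v).
  by rewrite -cImN -cImD (le_trans (ler_norm _))// (le_trans (Im_le_cmod _)).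
have key : N%:R^-1 * \sum_(i < N) (`|u| + v <= `|@y N t i|)%R%:R <=
    2 * (1 + v * complex.Im ew).
  have -> : 2 * (1 + v * complex.Im ew) =
      N%:R^-1 * \sum_(i < N) (2 * (1 + v * complex.Im (w - (@y N t i)%:C)^-1)).
    rewrite /ew /empirical_cauchy cImZ cIm_sum -mulr_sumr big_split/=.
    by rewrite sumr_const card_ord -mulr_sumr -[1 *+ N]/(N%:R); field.
  rewrite ler_wpM2l ?invr_ge0// ler_sum// => i _.
  set yy := y t i.
  have -> : 1 + v * complex.Im (w - yy%:C)^-1 = (u - yy) ^+ 2 / ((u - yy) ^+ 2 + v ^+ 2).
    exact: one_add_Im_resolvent.
  have d0 : 0 < (u - yy) ^+ 2 + v ^+ 2 by rewrite ltr_wpDl ?sqr_ge0// exprn_gt0.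
  have [yA|_] := leP (`|u| + v) `|yy|; last first.
    by rewrite mulr0n mulr_ge0// divr_ge0 ?sqr_ge0// ltW.
  rewrite mulr1n.
  rewrite mulrA ler_pdivlMr// mul1r.
  have : v ^+ 2 <= (u - yy) ^+ 2.
    rewrite -[leRHS]real_normK ?num_real// lerXn2r ?nnegrE ?(ltW v0)//.
    have : `|yy| <= `|u| + `|u - yy|.
      by have := ler_normB u (u - yy); rewrite subKr.
    by lra.
  by lra.
rewrite (le_trans key)//.
have : v * (complex.Im ew - complex.Im g) <= eta / 4.
  rewrite (le_trans (ler_wpM2l (ltW v0) hI))// le_eqVlt; apply/orP; left; apply/eqP.
  by field.
by rewrite mulrBr; lra.
Unshelve. all: end_near. Qed.

Let Y N i : R := if insub i is Some j then @y N t j else 0.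

Let YE N (i : 'I_N) : Y N i = y t i.
Proof. by rewrite /Y valK. Qed.

Lemma flow_ultra_limit (U : set_system nat) : UltraFilter U -> \oo `<=` U ->
  exists m : probability R R,
    (forall f : R -> R, continuous f -> (exists M, forall x, `|f x| <= M) ->
      N%:R^-1 * (\sum_(i < N) f (@y N t i)) @[N --> U] --> \int[m]_x f x) /\
    (forall z, 0 < complex.Im z -> t < complex.Im z ^+ 2 ->
      cauchy_transform m (burgers_char mu t z) = cauchy_transform mu z).
Proof.
move=> UU sU; have PU : ProperFilter U := ultra_proper.
have [|||m hm] := @ultra_weak_limit R U UU Y.
- by apply: sU; exact: nbhs_infty_gt.
- move=> N i j ij jN; have iN := leq_ltn_trans ij jN.
  rewrite (YE (Ordinal iN)) (YE (Ordinal jN)) /y ler_wpM2r ?invr_ge0 ?sqrtr_ge0//.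
  by have [_ h _ _ _] := phi_sol N; exact: (h t t0 (Ordinal iN) (Ordinal jN) ij).
- move=> eta eta0; have [A hA] := empirical_tight eta0; exists A; apply: sU.
  apply: filterS hA => N; congr (_ * _ <= _); apply: eq_bigr => i _.
  by rewrite YE.
have hm' (f : R -> R) : continuous f -> (exists M, forall x, `|f x| <= M) ->
    N%:R^-1 * (\sum_(i < N) f (@y N t i)) @[N --> U] --> \int[m]_x f x.
  move=> cf fM.
  rewrite (_ : (fun N => _) = fun N => N%:R^-1 * \sum_(i < N) f (Y N i)); first exact: hm.
  by apply/funext => N; congr (_ * _); apply: eq_bigr => i _; rewrite YE.
exists m; split => // z z0 zt.
pose w := burgers_char mu t z; have w0 : complex.Im w != 0.
  by rewrite gt_eqF// Im_burgers_char_gt0.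
have hR := hm' _ (continuous_Re_resolvent w0) (bounded_Re_resolvent w0).
have hI := hm' _ (continuous_Im_resolvent w0) (bounded_Im_resolvent w0).
have hG := empirical_cauchy_cvg z0 zt.
have hGU (e : R) : 0 < e -> \forall N \near U,
    cmod (empirical_cauchy (@y N t) w - cauchy_transform mu z) <= e.
  move=> e0; apply: sU; move/cvgrPdist_le : hG => /(_ e e0); apply: filterS => N.
  by rewrite sub0r normrN ger0_norm// cmod_ge0.
apply: complex_ext.
  apply: (cvg_unique _ hR) => //; apply/cvgrPdist_le => e e0.
  apply: filterS (hGU e e0) => N h.
  rewrite distrC (le_trans _ h)// (le_trans _ (Re_le_cmod _))//.
  by rewrite /empirical_cauchy cReD cReN cReZ cRe_sum.
apply: (cvg_unique _ hI) => //; apply/cvgrPdist_le => e e0.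
apply: filterS (hGU e e0) => N h.
rewrite distrC (le_trans _ h)// (le_trans _ (Im_le_cmod _))//.
by rewrite /empirical_cauchy cImD cImN cImZ cIm_sum.
Qed.

End flow_limit.

(** * Free convolution with the semicircle law *)

Section free_convolution_semicircle.
Context {R : realType}.
Variables (mu : probability R R) (k t : R).
Hypothesis k0 : 0 < k.
Hypothesis mu_supp : mu (~` `[- k, k]%classic) = 0%E.
Hypothesis t0 : 0 <= t.

Notation sc := (semicircle (2 * Num.sqrt t)).

Let le_cmodC (M : R) (z : R[i]) : (M%:C <= `|z|) = (M <= cmod z).
Proof. by rewrite normcE_cmod lecR. Qed.

Let le_cmodZ (e : R) (z w : R[i]) : (`|w| <= e%:C * `|z|) = (cmod w <= e * cmod z).
Proof. by rewrite !normcE_cmod -rmorphM lecR. Qed.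

Let Im_le (z : R[i]) : complex.Im z <= cmod z.
Proof. exact: le_trans (ler_norm _) (Im_le_cmod z). Qed.

Let cmod_div (z : R[i]) : cmod (t%:C / z) = t / cmod z.
Proof. by rewrite cmodM cmodV cmod_real ger0_norm. Qed.

Let cmod_div_le1 (z : R[i]) : t + 1 <= cmod z -> cmod (t%:C / z) <= 1.
Proof. by have tt := t0; move=> h; rewrite cmod_div ler_pdivrMr; lra. Qed.

Let Im_add_ge (z w : R[i]) : complex.Im z - cmod w <= complex.Im (z + w).
Proof.
by rewrite cImD lerD2l lerNl (le_trans (ler_norm _))// normrN Im_le_cmod.
Qed.

Let small_le (c e : R) (z w : R[i]) : 0 < e -> cmod w <= c -> c / e <= cmod z ->
  cmod w <= e * cmod z.
Proof. by move=> e0 wc; rewrite ler_pdivrMr// mulrC; exact: le_trans. Qed.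

(** If [F_mu(w) = z] then [G(w) = 1 / z], so [z + t / z + (w - z)] is the end point of the
    characteristic from w, where [G_m] equals [1 / z] by hypothesis. The preimage w is chosen by
    [xget] near z, which makes both transforms bounded and settles the growth condition. *)
Lemma free_add_conv_of_burgers (m : probability R R) :
  (forall z, 0 < complex.Im z -> t < complex.Im z ^+ 2 ->
    cauchy_transform m (burgers_char mu t z) = cauchy_transform mu z) ->
  is_free_add_conv sc mu m.
Proof.
have tt := t0; have kk := k0.
move=> hm a a0; pose b := 1009 * k + t + 1.
pose W (z : R[i]) : set R[i] :=
  [set w | cmod (w - z) <= 9 * k /\ reciprocal_cauchy mu w = z].
pose phi1 (z : R[i]) := t%:C / z.
pose phi2 (z : R[i]) := xget 0 (W z) - z.
have WP z : truncated_cone a b z -> W z (xget 0 (W z)).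
  move=> [zb _]; apply: xgetPex; apply: (reciprocal_cauchy_surjective k0 mu_supp).
    by rewrite (le_lt_trans _ zb)// /b; lra.
  by rewrite (le_trans _ (Im_le z))// (le_trans _ (ltW zb))// /b; lra.
have b0 : 0 < b by rewrite /b; lra.
have phi1_le z : truncated_cone a b z -> cmod (phi1 z) <= 1.
  move=> [zb _]; apply: cmod_div_le1.
  by rewrite (le_trans _ (Im_le z))// (le_trans _ (ltW zb))// /b; lra.
have phi2_le z : truncated_cone a b z -> cmod (phi2 z) <= 9 * k.
  by move=> /WP[].
exists b, phi1, phi2; split => //.
- split=> [z zc|z zc|e e0].
  + rewrite (lt_le_trans _ (Im_add_ge _ _))//.
    have := phi1_le z zc; case: zc => zb _; move: zb; rewrite /b; lra.
  + have hI : 0 < complex.Im (z + phi1 z).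
      rewrite (lt_le_trans _ (Im_add_ge _ _))//.
      by have := phi1_le z zc; case: zc => zb _; move: zb; rewrite /b; lra.
    rewrite /reciprocal_cauchy cauchy_transform_semicircle// ?invrK//.
    case: zc => zb _; have := Im_le z => zI.
    have h : t + 1 <= cmod z by move: zb; rewrite /b; lra.
    by rewrite expr2; nra.
  + exists (1 / e) => z zc; rewrite le_cmodC le_cmodZ.
    by apply: small_le => //; exact: phi1_le.
- split=> [z zc|z zc|e e0].
  + rewrite (lt_le_trans _ (Im_add_ge _ _))//.
    have := phi2_le z zc; case: zc => zb _; move: zb; rewrite /b; lra.
  + by rewrite /phi2 addrC subrK; have [] := WP z zc.
  + exists (9 * k / e) => z zc; rewrite le_cmodC le_cmodZ.
    by apply: small_le => //; exact: phi2_le.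
- have phi12_le z : truncated_cone a b z -> cmod ((phi1 \+ phi2) z) <= 9 * k + 1.
    move=> zc; rewrite /= (le_trans (cmodD _ _))// addrC lerD//.
      exact: phi2_le.
    exact: phi1_le.
  split=> [z zc|z zc|e e0].
  + rewrite (lt_le_trans _ (Im_add_ge _ _))//.
    have := phi12_le z zc; case: zc => zb _; move: zb; rewrite /b; lra.
  + have [wz Fw] := WP z zc; set w := xget 0 (W z) in wz Fw.
    have zb : b < complex.Im z by case: zc.
    have wI : t + 1 < complex.Im w.
      have := Im_add_ge z (w - z); rewrite [z + _]addrC subrK => h.
      by move: zb; rewrite /b; lra.
    have Gw : cauchy_transform mu w = z^-1 by rewrite -Fw invrK.
    have -> : z + (phi1 \+ phi2) z = burgers_char mu t w.
      rewrite -[LHS]/(z + (t%:C / z + (w - z))) /burgers_char Gw.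
      by rewrite addrCA subrKC addrC.
    rewrite /reciprocal_cauchy hm ?Gw ?invrK//; first by lra.
    by rewrite expr2; nra.
  + exists ((9 * k + 1) / e) => z zc; rewrite le_cmodC le_cmodZ.
    by apply: small_le => //; exact: phi12_le.
Qed.

(** Put [z = F_mu(i y)]. The growth conditions place [z + phi1 z] and [z + phi2 z] in the regions
    where the two reciprocal transforms are injective, so they must be [z + t / z] and [i y]. The
    equation for m at z is then the claim. *)
Lemma burgers_of_free_add_conv (m : probability R R) : is_free_add_conv sc mu m ->
  exists B : R, forall y, B < y ->
    cauchy_transform m (burgers_char mu t (y *i)) = cauchy_transform mu (y *i).
Proof.
have tt := t0; have kk := k0.
move=> /(_ 1 ltr01)[b [phi1 [phi2 [b0 [I1 F1 S1] [I2 F2 S2] [_ F _]]]]].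
have h2 : 0 < 1 / 2 :> R by [].
have [M1 {}S1] := S1 _ h2; have [M2 {}S2] := S2 _ h2.
(* A radius of support for the semicircle law, kept positive when t = 0. *)
pose ks := 2 * Num.sqrt t + 1.
have st0 : 0 <= Num.sqrt t := sqrtr_ge0 t.
have ks0 : 0 < ks by rewrite /ks; lra.
have sc_supp : sc (~` `[- ks, ks]%classic) = 0%E.
  by apply: semicircle_support; rewrite /ks; lra.
(* Here [|z| >= y - 8 k], and [|phi z| <= |z| / 2] leaves at least half of [|z|], which must still
   exceed [1000 k] and [1000 ks]; the other summands put z in the cone of aperture 1 and past M1 and
   M2. *)
exists (b + `|M1| + `|M2| + 2009 * k + 2002 * ks + t + 10) => y yB.
have := ler_norm M1; have := ler_norm M2.
have := normr_ge0 M1; have := normr_ge0 M2 => p2 p1 l2 l1.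
have y0 : 0 < y by lra.
have cy : cmod (y *i) = y by rewrite cmod_im gtr0_norm.
have fy : far k (y *i) by split; rewrite ?cy//=; lra.
pose z := reciprocal_cauchy mu (y *i).
have zy : cmod (y *i - z) <= 8 * k := cmod_sub_reciprocal_le k0 mu_supp fy.
have zI : y - 8 * k <= complex.Im z.
  have := Im_add_ge (y *i) (z - y *i); rewrite [y *i + _]addrC subrK cmod_distC [complex.Im (y *i)]/= => h.
  by apply: le_trans h; lra.
have zR : `|complex.Re z| <= 8 * k.
  rewrite (le_trans _ zy)// cmod_distC (le_trans _ (Re_le_cmod _))//.
  by rewrite cReD cReN [complex.Re (y *i)]/= oppr0 addr0.
have zm := le_trans zI (Im_le z).
have zc : truncated_cone 1 b z by split; rewrite ?mul1r; lra.
have E2 : z + phi2 z = y *i.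
  apply: (reciprocal_cauchy_injective k0 mu_supp) => //; last exact: F2.
  split; first exact: I2.
  have := S2 z zc; rewrite le_cmodC le_cmodZ => /(_ _) h.
  have {}h : cmod (phi2 z) <= 1 / 2 * cmod z by apply: h; lra.
  have := cmod_tri z (- phi2 z); rewrite opprK cmodN => h'.
  by apply: le_trans h'; lra.
have E1 : z + phi1 z = z + t%:C / z.
  have d1 : cmod (t%:C / z) <= 1 by apply: cmod_div_le1; lra.
  have hI : 0 < complex.Im (z + t%:C / z).
    by rewrite (lt_le_trans _ (Im_add_ge _ _))//; lra.
  apply: (reciprocal_cauchy_injective ks0 sc_supp).
  - split; first exact: I1.
    have := S1 z zc; rewrite le_cmodC le_cmodZ => /(_ _) h.
    have {}h : cmod (phi1 z) <= 1 / 2 * cmod z by apply: h; lra.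
    have := cmod_tri z (- phi1 z); rewrite opprK cmodN => h'.
    by apply: le_trans h'; lra.
  - split; first exact: hI.
    have := cmod_tri z (- (t%:C / z)); rewrite opprK cmodN => h'.
    by apply: le_trans h'; lra.
  - rewrite F1// /reciprocal_cauchy cauchy_transform_semicircle// ?invrK//.
    have h : t + 1 <= cmod z by lra.
    by rewrite expr2; nra.
have Gz : cauchy_transform mu (y *i) = z^-1 by rewrite /z invrK.
have := F z zc.
have -> : z + (phi1 \+ phi2) z = burgers_char mu t (y *i).
  rewrite /burgers_char Gz -E2.
  have <- : phi1 z = t%:C / z by apply: (@addrI _ z); exact: E1.
  by rewrite -[LHS]/(z + (phi1 z + phi2 z)) addrCA addrC.
by rewrite Gz /reciprocal_cauchy => /(congr1 GRing.inv); rewrite invrK.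
Qed.

End free_convolution_semicircle.

(** If the terms at distance more than e from l recurred forever, their index set D would belong to
    some ultrafilter refining [\oo], along which u could not tend to l. *)
Lemma cvg_of_ultrafilters (R : realType) (u : nat -> R) (l : R) :
  (forall U : set_system nat, UltraFilter U -> \oo `<=` U -> u n @[n --> U] --> l) ->
  u n @[n --> \oo] --> l.
Proof.
move=> h; apply/cvgrPdist_le => e e0; apply: contrapT => hn.
pose D := [set n | ~ `|l - u n| <= e].
have PF : ProperFilter (within D \oo).
  apply: Build_ProperFilter_ex => A WA.
  have {}WA : \oo [set n | D n -> A n] := WA.
  apply: contrapT => A0; apply: hn; apply: filterS WA => n /= DA.
  by apply: contrapT => nD; apply: A0; exists n; exact: DA.
have [U [UU sU]] := ultraFilterLemma PF.
have PU : ProperFilter U := ultra_proper.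
have sooU : \oo `<=` U by move=> A nA; apply: sU; apply: filterS nA.
have /cvgrPdist_le/(_ e e0) UA := h U UU sooU.
have UD : U D by apply: sU; exact: withinT.
by have [n [/= h1 h2]] := filter_ex (filterI UA UD).
Qed.

Theorem theorem1p1 (R : realType) (mu : probability R R)
    (x : forall N : nat, 'rV[R]_N) (phi : forall N : nat, R -> 'rV[R]_N)
    (mu_cpt : compactly_supported mu)
    (x_chamber : forall N : nat, weyl_chamberA N (x N))
    (x_cvg : weakly_converges
      (fun N => empirical (fun n : 'I_N => x N 0 n / Num.sqrt N%:R)) mu)
    (phi_sol : forall N : nat, is_frozen_solution (x N) (phi N)) :
  forall t : R, 0 <= t ->
    weakly_converges
      (fun N => empirical (fun n : 'I_N => phi N t 0 n / Num.sqrt N%:R))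
      (free_add_conv (semicircle (2 * Num.sqrt t)) mu).
Proof.
move=> t t0.
have [k k0 mu_supp] : exists2 k, 0 < k & mu (~` `[- k, k]%classic) = 0%E.
  have [K Kc K0] := mu_cpt; have [M [_ hM]] := compact_bounded Kc.
  pose k := `|M| + 1; have k0 : 0 < k by rewrite ltr_wpDl.
  exists k => //; apply/eqP; rewrite eq_le measure_ge0 andbT -K0.
  apply: le_measure; rewrite ?inE.
  - by apply: measurableC; exact: measurable_itv.
  - by apply: measurableC; exact: compact_measurable.
  - apply: subsetC => u Ku /=; rewrite in_itv/= -ler_norml.
    by apply: hM => //; rewrite (le_lt_trans (ler_norm _))// ltrDl.
pose m0 := free_add_conv (semicircle (2 * Num.sqrt t)) mu.
(* Any one ultrafilter provides a measure satisfying [is_free_add_conv]; hence the measure picked by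
   [get] satisfies it too. *)
have [U0 [UU0 sU0]] := @ultraFilterLemma _ \oo _.
have [m [_ hm]] := flow_ultra_limit x_cvg phi_sol t0 k0 mu_supp UU0 sU0.
have m0P : is_free_add_conv (semicircle (2 * Num.sqrt t)) mu m0.
  by apply: getPex; exists m; exact: free_add_conv_of_burgers k0 mu_supp t0 m hm.
have [B hB] := burgers_of_free_add_conv k0 mu_supp t0 m0P.
move=> f cf fM.
rewrite (_ : (fun N => _) =
  fun N => N%:R^-1 * \sum_(n < N) f (phi N t 0 n / Num.sqrt N%:R)); last first.
  by apply/funext => N; rewrite empirical_integral//; exact: continuous_measurable_fun.
apply: cvg_of_ultrafilters => U UU sU.
have [mU [mU_cvg hmU]] := flow_ultra_limit x_cvg phi_sol t0 k0 mu_supp UU sU.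
(* The limit along U and the chosen measure have the same Cauchy transform on the curve. The
   threshold gives [y > B] for the one and [t < y^2] for the other. *)
rewrite -(@eq_integral_of_burgers _ mU m0 mu t (`|B| + t + 1) t0) => [|y yB].
  exact: mU_cvg.
have yBB : B < y by have := ler_norm B; lra.
have y1 : t + 1 < y by have := normr_ge0 B; lra.
rewrite hB// hmU//=; first by lra.
by rewrite expr2; nra.
Qed.
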